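(* There is a randomized algorithm which, given parameters $\varepsilon>0$, $\rho>0$, $\delta\in(0,1)$ and a set $P\subset\mathbb{R}^d$ of $n$ points, runs in time $$O\left(nd+\left(\log\frac{1}{\varepsilon\rho}\right)^{O\left(\frac{1}{\varepsilon^2}\log^3\frac{1}{\varepsilon\rho}\right)}\cdot\log\frac{1}{\delta}+\min\left\{nd\log\frac{1}{\delta},\ \frac{d}{\varepsilon^2\rho^2}\log^2\frac{1}{\delta}\right\}\right)$$ and outputs a point $x'\in\mathbb{R}^d$ such that, with probability at least $1-\delta$, $$\bar{G}_P(x')\ge(1-\varepsilon)\,\bar{G}_P(x^* )$$ whenever $\bar{G}_P(x^* )\ge\rho$, where $x^*=\arg\max_{x\in\mathbb{R}^d}\bar{G}_P(x)$.
   Context: For $x,y\in\mathbb{R}^d$ the Gaussian kernel is $K(x,y)=e^{-\|x-y\|^2}$ (Euclidean norm). For a finite point set $Q\subset\mathbb{R}^d$, the Gaussian kernel density estimate is $\bar{G}_Q(x)=\frac{1}{|Q|}\sum_{p\in Q}K(p,x)$. The lower bound $\rho$ on the maximum density is given to the algorithm. *)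

(* Defs.v *)
From mathcomp Require Import all_boot all_order all_algebra.
From mathcomp Require Import all_classical all_reals all_analysis.

Set Implicit Arguments.
Unset Strict Implicit.
Unset Printing Implicit Defensive.
Import Order.TTheory GRing.Theory Num.Theory.
Local Open Scope ring_scope.

(* The library norm on row vectors is the sup norm, hence [enorm]. *)
Definition enorm (R : realType) (d : nat) (x : 'rV[R]_d) : R :=
  Num.sqrt (\sum_(j < d) x ord0 j ^+ 2).

Definition gauss_kernel (R : realType) (d : nat) (x y : 'rV[R]_d) : R :=
  expR (- enorm (x - y) ^+ 2).

Definition gkde (R : realType) (n d : nat) (P : 'I_n -> 'rV[R]_d)
    (x : 'rV[R]_d) : R :=
  n%:R^-1 * \sum_(i < n) gauss_kernel (P i) x.

Definition is_argmax (R : realType) (T : Type) (f : T -> R) (x : T) : Prop :=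
  forall y, f y <= f x.

(* The usual convention inside O-bounds: a logarithm never drops below 1. *)
Definition logp (R : realType) (x : R) : R := Num.max 1 (ln x).

(* Randomized real RAM.  Programs are finite syntax containing no real
   constants, so one program serves all inputs, sizes and accuracies.  The
   input is read-only; the working memory consists of one array of natural
   numbers and one array of exact reals, both indexed by natural numbers. *)

Inductive iexp :=
| INum of nat
| INpts
| IDim
| ILoad of iexp
| IAdd of iexp & iexp
| ISub of iexp & iexp
| IMul of iexp & iexp.

(* There is no rounding from reals to integers. *)
Inductive rexp :=
| REps
| RRho
| RDelta
| RPoint of iexp & iexp
| ROfInt of iexp
| RLoad of iexp
| RAdd of rexp & rexp
| RSub of rexp & rexp
| RMul of rexp & rexp
| RDiv of rexp & rexp
| RExp of rexp.

Inductive bexp :=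
| BILt of iexp & iexp
| BRLt of rexp & rexp
| BNot of bexp
| BAnd of bexp & bexp.

Inductive cmd :=
| CSkip
| CIStore of iexp & iexp
| CRStore of iexp & rexp
| CRand of iexp & iexp
| CSeq of cmd & cmd
| CIf of bexp & cmd & cmd
| CWhile of bexp & cmd.

Section Semantics.
Variable R : realType.

Record input := Input {
  npts : nat;
  dim : nat;
  epsilon : R;
  rho : R;
  delta : R;
  points : 'I_npts -> 'rV[R]_dim
}.

Record store := Store { imem : nat -> nat; rmem : nat -> R }.

Definition iupd (s : store) (a v : nat) : store :=
  Store [eta imem s with a |-> v] (rmem s).

Definition rupd (s : store) (a : nat) (v : R) : store :=
  Store (imem s) [eta rmem s with a |-> v].

Definition init_store : store := Store (fun=> 0%N) (fun=> 0).

(* Out-of-range indices read as 0. *)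
Definition read_point (I : input) (i j : nat) : R :=
  if insub i is Some i' then
    if insub j is Some j' then @points I i' ord0 j' else 0
  else 0.

Variable I : input.

Fixpoint ieval (s : store) (e : iexp) : nat :=
  match e with
  | INum m => m
  | INpts => npts I
  | IDim => dim I
  | ILoad a => imem s (ieval s a)
  | IAdd e1 e2 => (ieval s e1 + ieval s e2)%N
  | ISub e1 e2 => (ieval s e1 - ieval s e2)%N
  | IMul e1 e2 => (ieval s e1 * ieval s e2)%N
  end.

Fixpoint reval (s : store) (e : rexp) : R :=
  match e with
  | REps => epsilon I
  | RRho => rho I
  | RDelta => delta I
  | RPoint e1 e2 => read_point I (ieval s e1) (ieval s e2)
  | ROfInt e1 => (ieval s e1)%:R
  | RLoad a => rmem s (ieval s a)
  | RAdd e1 e2 => reval s e1 + reval s e2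
  | RSub e1 e2 => reval s e1 - reval s e2
  | RMul e1 e2 => reval s e1 * reval s e2
  | RDiv e1 e2 => reval s e1 / reval s e2
  | RExp e1 => expR (reval s e1)
  end.

Fixpoint beval (s : store) (b : bexp) : bool :=
  match b with
  | BILt e1 e2 => (ieval s e1 < ieval s e2)%N
  | BRLt e1 e2 => reval s e1 < reval s e2
  | BNot b1 => ~~ beval s b1
  | BAnd b1 b2 => beval s b1 && beval s b2
  end.

(* A configuration is a stack of pending commands together with a store; it
   has halted when the stack is empty. *)
Definition config := (seq cmd * store)%type.

Definition halted (c : config) : bool := nilp c.1.

(* The equally likely successors of a configuration.  Only [CRand a e] has
   several: it stores at [a] a uniform element of {0, ..., k-1}, where k is the
   value of [e] (k = 0 being treated as k = 1).  Each step counts as one unit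
   of time: expressions belong to the fixed program, so evaluating one takes
   a bounded number of elementary operations. *)
Definition step (c : config) : seq config :=
  let: (k, s) := c in
  match k with
  | [::] => [::]
  | CSkip :: k' => [:: (k', s)]
  | CIStore a e :: k' => [:: (k', iupd s (ieval s a) (ieval s e))]
  | CRStore a e :: k' => [:: (k', rupd s (ieval s a) (reval s e))]
  | CRand a e :: k' =>
      [seq (k', iupd s (ieval s a) v) | v <- iota 0 (maxn 1 (ieval s e))]
  | CSeq c1 c2 :: k' => [:: (c1 :: c2 :: k', s)]
  | CIf b c1 c2 :: k' => [:: ((if beval s b then c1 else c2) :: k', s)]
  | CWhile b c1 :: k' =>
      [:: (if beval s b then c1 :: CWhile b c1 :: k' else k', s)]
  end.

(* Worst case over all random choices. *)
Fixpoint halts_within (t : nat) (c : config) : bool :=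
  halted c || (if t is t'.+1 then all (halts_within t') (step c) else false).

(* Probability of halting within [t] steps in a store satisfying [E]. *)
Fixpoint prob_within (t : nat) (E : store -> Prop) (c : config) : R :=
  if halted c then (`[< E c.2 >])%:R
  else if t is t'.+1 then
    (\sum_(c' <- step c) prob_within t' E c') / (size (step c))%:R
  else 0.

End Semantics.

Definition start (R : realType) (prog : cmd) : config R :=
  ([:: prog], init_store R).

Definition runs_in (R : realType) (prog : cmd) (I : input R) (t : nat) : Prop :=
  halts_within I t (start R prog).

(* The output point is left in the first d cells of the real memory. *)
Definition output (R : realType) (d : nat) (s : store R) : 'rV[R]_d :=
  \row_(j < d) rmem s j.

Definition output_prob (R : realType) (prog : cmd) (I : input R) (t : nat)
    (E : 'rV[R]_(dim I) -> Prop) : R :=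
  prob_within I t (fun s => E (output (dim I) s)) (start R prog).

(* [C] and [c] are the constants hidden by the outer O and by the O in the
   exponent. *)
Definition time_bound (R : realType) (C c : R) (n d : nat)
    (eps rho delta : R) : R :=
  let L := logp (1 / (eps * rho)) in
  let l := logp (1 / delta) in
  C * (n%:R * d%:R
       + L `^ (c * (1 / eps ^+ 2) * L ^+ 3) * l
       + Num.min (n%:R * d%:R * l) (d%:R / (eps ^+ 2 * rho ^+ 2) * l ^+ 2)).

(* Main.v *)
Require Import Defs.
From mathcomp Require Import all_boot all_order all_algebra.
From mathcomp Require Import all_classical all_reals all_analysis.
From mathcomp Require Import ring lra zify.
Set Implicit Arguments.
Unset Strict Implicit.
Unset Printing Implicit Defensive.
Import Order.TTheory GRing.Theory Num.Theory.
Import numFieldNormedType.Exports.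
Local Open Scope ring_scope.

(* The algorithm repeats log(1/delta) rounds.  A round draws a sample S of
   O(1/(eps rho)^2) points; in the reproducing kernel Hilbert space of the
   Gaussian kernel the mean of S is close to that of P, so the two densities are
   uniformly close.  By Jensen's inequality a mean-shift step from any x does not
   decrease the density of S, and Maurey's argument replaces the resulting
   barycenter by the average of k = O(eps^-1 log(1/rho)) points of S, at the cost
   of an exponent 1 + 1/k on the density.  It therefore suffices to try all
   |S|^k tuples; to avoid paying for the dimension each time, this is done after a
   random sign-and-bucket projection (CountSketch), which can be applied in time
   |S| d, and whose number of buckets is large enough for Chebyshev's inequality
   to control all distances between sample points and candidates at once.  The
   winner is evaluated on a fresh sample of O(log(1/delta)/(eps rho)^2) points,
   where Hoeffding's argument applies, and the best verified point is returned.
   Every probabilistic estimate is a supermartingale evaluated along the run. *)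

(** * Mean shift and sparse candidates *)


(** The loss is counted in exponents: passing from a density G to G^(1+g) costs the factor exp(-g
    ln(1/G)), so for G of order rho it is enough that g is of order eps / log(1/rho), which fixes
    the tuple size k. The same calculus covers both Maurey's rounding and the distortion of
    distances by the sketch. The sketch has to be right for all |S|^(k+1) pairs of a sample point
    and a candidate, with only a second moment available; hence the number of buckets exceeds the
    number of pairs. This is affordable because the bucket count enters only the part of the cost
    that is free of d. A round is guaranteed to find a good point only with probability 3/4 and
    cannot certify itself; the fresh verification sample makes the rounds comparable. Both sample
    sizes are capped at n, where the sample is the whole set and nothing is random; this yields the
    minimum in the running time. The machine has neither logarithms nor rounding, so the integer
    parameters are found by counting or doubling. *)

Section SoftMean.
Variable R : realType.
Implicit Types (s d k : nat) (D : nat -> R) (g : R).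

Definition smean s D : R := s%:R^-1 * \sum_(i < s) expR (- D i).

Definition gibbs s D (i : nat) : R :=
  expR (- D i) / \sum_(i < s) expR (- D i).

Lemma partition_gt0 s D : (0 < s)%N -> 0 < \sum_(i < s) expR (- D i).
Proof.
case: s => // s _; rewrite big_ord_recl ltr_pwDl ?expR_gt0 //.
by apply: sumr_ge0 => i _; rewrite expR_ge0.
Qed.

Lemma smean_gt0 s D : (0 < s)%N -> 0 < smean s D.
Proof. by move=> s0; rewrite mulr_gt0 ?invr_gt0 ?ltr0n // partition_gt0. Qed.

Lemma gibbs_ge0 s D i : 0 <= gibbs s D i.
Proof.
by rewrite divr_ge0 ?expR_ge0 //; apply: sumr_ge0 => j _; rewrite expR_ge0.
Qed.

Lemma gibbs_sum s D : (0 < s)%N -> \sum_(i < s) gibbs s D i = 1.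
Proof.
by move=> s0; rewrite -mulr_suml mulfV // gt_eqF // partition_gt0.
Qed.

(* Jensen's inequality for the weights [gibbs s D]. *)
Lemma smean_shift s D D' : (0 < s)%N ->
  smean s D * expR (\sum_(i < s) gibbs s D i * (D i - D' i)) <= smean s D'.
Proof.
move=> s0; rewrite /smean -mulrA ler_pM2l ?invr_gt0 ?ltr0n //.
have w0 := gibbs_ge0 s D; have w1 := gibbs_sum D s0.
have Z0 := partition_gt0 D s0; set Z := \sum_(i < s) expR (- D i) in Z0 *.
have wE i : expR (- D i) = Z * gibbs s D i by rewrite mulrC divfK ?gt_eqF.
move: (gibbs s D) w0 w1 wE => w w0 w1 wE.
set c := \sum_(i < s) _ * _.
(* Tangent line of the exponential at the weighted mean [c]; the linear terms cancel after summation
   against the weights. *)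
have E (i : 'I_s) : Z * expR c * (w i * (1 + (D i - D' i - c))) <= expR (- D' i).
  have -> : expR (- D' i) = Z * expR c * (w i * expR (D i - D' i - c)).
    rewrite mulrACA -wE mulrA -mulrA -!expRD; congr expR; ring.
  by rewrite !ler_wpM2l ?expR_ge1Dx // mulr_ge0 ?expR_ge0 // ltW.
apply: le_trans (ler_sum _ (fun i _ => E i)).
rewrite -mulr_sumr -[leLHS]mulr1 ler_pM2l ?mulr_gt0 ?expR_gt0 //.
under eq_bigr do rewrite mulrDr mulr1 mulrBr.
by rewrite big_split /= sumrB -mulr_suml w1 mul1r subrr addr0.
Qed.

(** Two uses of [smean_shift]. Comparison with the zero function bounds the Gibbs mean of [D] by
    [- ln (smean s D)]; comparison with [D'] loses at most g times that mean, which turns into the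
    exponent 1 + g. *)
Lemma smean_gibbs s D D' g : (0 < s)%N -> 0 <= g ->
  \sum_(i < s) gibbs s D i * D' i <= (1 + g) * \sum_(i < s) gibbs s D i * D i ->
  (1 + g) * ln (smean s D) <= ln (smean s D').
Proof.
move=> s0 g0 h.
have ln_shift D1 : ln (smean s D) + \sum_(i < s) gibbs s D i * (D i - D1 i)
    <= ln (smean s D1).
  rewrite -[X in _ + X]expRK -lnM ?posrE ?expR_gt0 ?smean_gt0 //.
  rewrite ler_ln ?posrE ?smean_gt0 ?smean_shift //.
  by apply: mulr_gt0; rewrite ?expR_gt0 ?smean_gt0.
have := ln_shift D'; have := ln_shift (fun=> 0).
have -> : smean s (fun=> 0) = 1.
  rewrite /smean; under eq_bigr do rewrite oppr0 expR0.
  by rewrite sumr_const card_ord mulVf // pnatr_eq0 -lt0n.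
rewrite ln1.
under eq_bigr do rewrite subr0.
under [X in _ + X <= ln (smean s D') -> _]eq_bigr do rewrite mulrBr.
rewrite sumrB; nra.
Qed.

End SoftMean.

Section Maurey.
Variable R : realType.
Implicit Types (s d k : nat) (p : nat -> nat -> R) (x y : nat -> R).

Definition sqd d x y : R := \sum_(j < d) (x j - y j) ^+ 2.

Definition kde d s p x : R := smean s (fun i => sqd d (p i) x).

Lemma sqd_ge0 d x y : 0 <= sqd d x y.
Proof. by apply: sumr_ge0 => j _; rewrite sqr_ge0. Qed.

Lemma exists_le_avg s (w f : nat -> R) (b : R) :
  (forall i, 0 <= w i) -> \sum_(i < s) w i = 1 ->
  \sum_(i < s) w i * f i <= b -> exists2 i, (i < s)%N & f i <= b.
Proof.
move=> w0 w1 h; apply: contrapT => /forall2NP nh.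
have hb (i : 'I_s) : b < f i.
  by case: (nh i) => [|/negP]; rewrite ?ltn_ord // -ltNge.
have /eqP : \sum_(i < s) w i * (f i - b) = 0.
  apply: le_anti; apply/andP; split.
    under eq_bigr do rewrite mulrBr.
    by rewrite sumrB -mulr_suml w1 mul1r subr_le0.
  by apply: sumr_ge0 => i _; rewrite mulr_ge0 // subr_ge0 ltW.
rewrite psumr_eq0; last by move=> i _; rewrite mulr_ge0 // subr_ge0 ltW.
move=> /allP z; suff: \sum_(i < s) w i = 0 :> R by rewrite w1 => /eqP; rewrite oner_eq0.
apply: big1 => i _; have := z i (mem_index_enum _).
by rewrite mulf_eq0 subr_eq0 (gt_eqF (hb i)) orbF => /eqP.
Qed.

Section Barycenter.
Variables (d s : nat) (p : nat -> nat -> R) (w : nat -> R).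
Hypotheses (w_ge0 : forall i, 0 <= w i) (w_sum : \sum_(i < s) w i = 1).

Definition bary (j : nat) : R := \sum_(i < s) w i * p i j.

Lemma huygens x : \sum_(i < s) w i * sqd d (p i) x =
  \sum_(i < s) w i * sqd d (p i) bary + sqd d bary x.
Proof.
rewrite /sqd.
under eq_bigr do rewrite mulr_sumr.
under [X in _ = X + _]eq_bigr do rewrite mulr_sumr.
rewrite exchange_big [X in _ = X + _]exchange_big -big_split /=.
apply: eq_bigr => j _.
have -> : (bary j - x j) ^+ 2 = \sum_(i < s) w i * (bary j - x j) ^+ 2.
  by rewrite -mulr_suml w_sum mul1r.
apply/eqP; rewrite -big_split /= -subr_eq0 -sumrB.
rewrite (eq_bigr (fun i : 'I_s => (w i * p i j - w i * bary j) * (2 * (bary j - x j)))).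
  by rewrite -mulr_suml sumrB -mulr_suml w_sum mul1r /bary subrr mul0r.
by move=> i _; ring.
Qed.

(** Maurey's lemma without probability: if the next point is drawn with weights [w], its deviation
    has mean zero, so the squared norm of the running sum grows by V on average, and some point does
    no worse. Sums are used instead of averages so that the induction adds exactly V. *)
Lemma maurey_greedy k : exists2 t : nat -> nat, (forall l, (t l < s)%N) &
  \sum_(j < d) (\sum_(l < k) (p (t l) j - bary j)) ^+ 2 <=
    k%:R * \sum_(i < s) w i * sqd d (p i) bary.
Proof.
set V := \sum_(i < s) _.
elim: k => [|k [t ts ht]].
  have [|i ilt _] := @exists_le_avg s w (fun=> 0) 0 w_ge0 w_sum.
    by rewrite big1 // => i _; rewrite mulr0.
  exists (fun=> i) => //; rewrite mul0r big1 // => j _.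
  by rewrite big_ord0 expr0n.
pose u j := \sum_(l < k) (p (t l) j - bary j).
pose f i := \sum_(j < d) (u j + (p i j - bary j)) ^+ 2.
have [|i ilt fi] := @exists_le_avg s w f ((k%:R * V) + V) w_ge0 w_sum.
  have -> : \sum_(i < s) w i * f i = \sum_(j < d) u j ^+ 2 + V.
    rewrite /V /f /sqd.
    under eq_bigr do rewrite mulr_sumr.
    under [X in _ = _ + X]eq_bigr do rewrite mulr_sumr.
    rewrite exchange_big [X in _ = _ + X]exchange_big -big_split /=.
    apply: eq_bigr => j _.
    have -> : u j ^+ 2 = \sum_(i < s) w i * u j ^+ 2.
      by rewrite -mulr_suml w_sum mul1r.
    apply/eqP; rewrite -big_split /= -subr_eq0 -sumrB.
    rewrite (eq_bigr (fun i : 'I_s => (w i * p i j - w i * bary j) * (2 * u j))).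
      by rewrite -mulr_suml sumrB -mulr_suml w_sum mul1r /bary subrr mul0r.
    by move=> i _; ring.
  by rewrite lerD2r.
exists (fun l => if (l < k)%N then t l else i) => [l|]; first by case: ifP.
rewrite -natr1 mulrDl mul1r (le_trans _ fi) // le_eqVlt; apply/orP; left.
apply/eqP/eq_bigr => j _; rewrite big_ord_recr /= ltnn; congr ((_ + _) ^+ 2).
by apply: eq_bigr => l _; rewrite ltn_ord.
Qed.

End Barycenter.

Definition avgpt k p (t : nat -> nat) (j : nat) : R :=
  k%:R^-1 * \sum_(l < k) p (t l) j.

(* The barycenter of the Gibbs weights at x is a mean-shift step from x, hence at
   least as good as x; a greedy choice of k points approximates it. *)
Lemma maurey d s k p x : (0 < s)%N -> (0 < k)%N ->
  exists2 t : nat -> nat, (forall l, (t l < s)%N) &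
    (1 + k%:R^-1) * ln (kde d s p x) <= ln (kde d s p (avgpt k p t)).
Proof.
move=> s0 k0; pose w := gibbs s (fun i => sqd d (p i) x).
have w0 i : 0 <= w i by exact: gibbs_ge0.
have w1 : \sum_(i < s) w i = 1 by exact: gibbs_sum.
have [t ts ht] := maurey_greedy d p w0 w1 k; exists t => //.
have k0' : 0 < k%:R :> R by rewrite ltr0n.
apply: smean_gibbs => //.
rewrite -/w (huygens d p w1 x) (huygens d p w1 (avgpt k p t)).
set V := \sum_(i < s) _ in ht *; have := sqd_ge0 d (bary s p w) x.
(* By [huygens] the left side is V plus this distance, hence at most (1 + 1/k) V, while the right
   side is (1 + 1/k) times a quantity that is at least V. *)
suff : sqd d (bary s p w) (avgpt k p t) <= k%:R^-1 * V.
  move=> h1 h2; rewrite mulrDl mul1r mulrDr.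
  have := mulr_ge0 (ltW k0') h2 ; have : 0 <= k%:R^-1 * sqd d (bary s p w) x.
    by rewrite mulr_ge0 // invr_ge0 ltW.
  by move: h1 h2; lra.
have -> : sqd d (bary s p w) (avgpt k p t) =
    k%:R^-1 ^+ 2 * \sum_(j < d) (\sum_(l < k) (p (t l) j - bary s p w j)) ^+ 2.
  rewrite mulr_sumr; apply: eq_bigr => j _.
  rewrite sumrB sumr_const card_ord -mulr_natl /avgpt.
  by field; rewrite gt_eqF.
rewrite expr2 -mulrA ler_pM2l ?invr_gt0 // ler_pdivrMl //.
Qed.

End Maurey.

(** * Discrepancy of a random sample *)

Section PositiveDefinite.
Variable R : realType.
Implicit Types (d : nat) (x y : nat -> R).

Definition gker d x y : R := expR (- sqd d x y).

Lemma gkerC d x y : gker d x y = gker d y x.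
Proof. by congr expR; congr (- _); apply: eq_bigr => j _; ring. Qed.

Lemma gkerxx d x : gker d x x = 1.
Proof.
rewrite /gker /sqd big1 ?oppr0 ?expR0 // => j _.
by rewrite subrr expr0n.
Qed.

Lemma gker_gt0 d x y : 0 < gker d x y.
Proof. exact: expR_gt0. Qed.

Lemma gker_le1 d x y : gker d x y <= 1.
Proof. by rewrite -[leRHS]expR0 ler_expR oppr_le0 sqd_ge0. Qed.

Section Family.
Variables (I : Type) (r : seq I) (d : nat) (pt : I -> nat -> R).

Let dot a b : R := \sum_(j < d) pt a j * pt b j.

(** Entrywise powers of a Gram matrix: one factor of the inner product is expanded into coordinates,
    which are absorbed into the coefficients [c]. For m = 0 the form is the square of a sum. *)
Lemma dotX_psd m (c : I -> R) :
  0 <= \sum_(a <- r) \sum_(b <- r) c a * c b * dot a b ^+ m.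
Proof.
elim: m c => [|m IH] c.
  under eq_bigr do under eq_bigr do rewrite expr0 mulr1.
  under eq_bigr do rewrite -mulr_sumr.
  by rewrite -mulr_suml -expr2 sqr_ge0.
rewrite (eq_bigr (fun a => \sum_(j < d) \sum_(b <- r)
    (c a * pt a j) * (c b * pt b j) * dot a b ^+ m)).
  by rewrite exchange_big /=; apply: sumr_ge0.
move=> a _; rewrite exchange_big /=; apply: eq_bigr => b _.
rewrite exprSr /dot mulrA mulr_sumr; apply: eq_bigr => j _; ring.
Qed.

(** The exponential series has nonnegative coefficients, so each partial sum is a nonnegative
    combination of the forms in [dotX_psd]; the limit keeps the sign. *)
Lemma exp_dot_psd (c : I -> R) :
  0 <= \sum_(a <- r) \sum_(b <- r) c a * c b * expR (2 * dot a b).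
Proof.
pose u N := \sum_(a <- r) \sum_(b <- r) c a * c b * series (exp_coeff (2 * dot a b)) N.
have u_ge0 N : 0 <= u N.
  rewrite /u /series /=.
  rewrite (eq_bigr (fun a => \sum_(0 <= m < N) \sum_(b <- r)
     (2 ^+ m / m`!%:R) * (c a * c b * dot a b ^+ m))).
    rewrite exchange_big /=; apply: sumr_ge0 => m _.
    under eq_bigr do rewrite -mulr_sumr.
    by rewrite -mulr_sumr mulr_ge0 ?dotX_psd // divr_ge0 ?ler0n //.
  move=> a _; rewrite exchange_big /=; apply: eq_bigr => b _.
  rewrite mulr_sumr; apply: eq_bigr => m _.
  by rewrite exp_coeffE exprMn; ring.
have cu : (u @ \oo --> \sum_(a <- r) \sum_(b <- r) c a * c b * expR (2 * dot a b))%classic.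
  apply: (cvg_big add_continuous) => a _.
  apply: (cvg_big add_continuous) => b _.
  by apply: cvgM; [exact: cvg_cst | exact: is_cvg_series_exp_coeff].
rewrite -(cvg_lim _ cu) //; apply: limr_ge; first by apply/cvg_ex; eexists; exact: cu.
by near=> N; exact: u_ge0.
Unshelve. all: by end_near.
Qed.

(** The kernel factors as exp(-|a|^2) exp(-|b|^2) exp(2 a.b), and the first two factors are absorbed
    into the coefficients. *)
Lemma gker_psd (c : I -> R) :
  0 <= \sum_(a <- r) \sum_(b <- r) c a * c b * gker d (pt a) (pt b).
Proof.
have := exp_dot_psd (fun a => c a * expR (- dot a a)).
congr (0 <= _); apply: eq_bigr => a _; apply: eq_bigr => b _.
rewrite mulrACA -!mulrA -!expRD; congr (_ * (_ * expR _)).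
rewrite /sqd /dot -sumrN mulr_sumr -!sumrN -!big_split /=.
by apply: eq_bigr => j _; ring.
Qed.

End Family.

(** Finite combinations of point evaluations stand in for the vectors of the reproducing kernel
    Hilbert space: the inner product of F and G is F applied to the map sending a to [G (gker d a)],
    so the space itself need not be built. *)
Definition finite_functional (T : Type) (F : (T -> R) -> R) : Prop :=
  exists r : seq (R * T), forall f, F f = \sum_(a <- r) a.1 * f a.2.

Lemma finite_functional_eval T (x : T) : finite_functional (fun f => f x).
Proof. by exists [:: (1, x)] => f; rewrite big_seq1 mul1r. Qed.

Lemma finite_functionalD T (F1 F2 : (T -> R) -> R) :
  finite_functional F1 -> finite_functional F2 ->
  finite_functional (fun f => F1 f + F2 f).
Proof.
by move=> [r1 h1] [r2 h2]; exists (r1 ++ r2) => f; rewrite big_cat h1 h2.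
Qed.

Lemma finite_functionalZ T (c : R) (F : (T -> R) -> R) :
  finite_functional F -> finite_functional (fun f => c * F f).
Proof.
move=> [r h]; exists [seq (c * a.1, a.2) | a <- r] => f.
by rewrite big_map h mulr_sumr; apply: eq_bigr => a _ /=; rewrite mulrA.
Qed.

Lemma finite_functional_sum T s (F : nat -> (T -> R) -> R) :
  (forall i, finite_functional (F i)) ->
  finite_functional (fun f => \sum_(i < s) F i f).
Proof.
move=> h; elim: s => [|s [r IH]].
  by exists [::] => f; rewrite big_nil big_ord0.
case: (h s) => r' IH'; exists (r ++ r') => f.
by rewrite big_cat big_ord_recr IH IH'.
Qed.

(** The expression is the squared Hilbert space norm of [F]. *)
Lemma psd_functional d (F : ((nat -> R) -> R) -> R) :
  finite_functional F -> 0 <= F (fun a => F (gker d a)).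
Proof.
move=> [r h]; rewrite h; have := gker_psd r d snd fst; congr (0 <= _).
apply: eq_bigr => a _; rewrite h mulr_sumr.
by apply: eq_bigr => b _; rewrite mulrA.
Qed.

End PositiveDefinite.

(* The discrepancy of a sample is the squared norm, in the reproducing kernel
   Hilbert space of the Gaussian kernel, of the sum of the centered feature
   vectors of the sample points. *)
Section Discrepancy.
Variables (R : realType) (d n : nat) (P : nat -> nat -> R).
Hypothesis n_gt0 : (0 < n)%N.
Implicit Types (idx : nat -> nat).

Let n0 : n%:R != 0 :> R.
Proof. by rewrite pnatr_eq0 -lt0n. Qed.

Definition centered (u : nat) (f : (nat -> R) -> R) : R :=
  f (P u) - n%:R^-1 * \sum_(a < n) f (P a).

Definition cker (u v : nat) : R :=
  centered u (fun a => centered v (gker d a)).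

Definition disc s idx : R :=
  \sum_(l < s) \sum_(l' < s) cker (idx l) (idx l').

Lemma centeredD u f g :
  centered u (fun a => f a + g a) = centered u f + centered u g.
Proof. by rewrite /centered big_split /=; ring. Qed.

Lemma centeredZ u c f : centered u (fun a => c * f a) = c * centered u f.
Proof. by rewrite /centered -mulr_sumr; ring. Qed.

Lemma centered_sum u s (f : 'I_s -> (nat -> R) -> R) :
  centered u (fun a => \sum_(i < s) f i a) = \sum_(i < s) centered u (f i).
Proof.
by rewrite /centered sumrB -mulr_sumr exchange_big.
Qed.

Lemma finite_functional_centered u : finite_functional (centered u).
Proof.
have h := finite_functionalD (finite_functional_eval R (P u))
  (finite_functionalZ (- n%:R^-1) (finite_functional_sum n
    (fun a => finite_functional_eval R (P a)))).
by case: h => r h; exists r => f; rewrite -h /centered mulNr.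
Qed.

(** Cauchy-Schwarz: with F0 the sum of the centered functionals and c its value at the kernel of x,
    positivity of F0 - c (evaluation at x) reads [disc] - c^2 >= 0, because the feature vector of x
    is a unit vector. The difference of the two densities is c / s. *)
Lemma disc_sup s idx x : (0 < s)%N ->
  (kde d s (fun l => P (idx l)) x - kde d n P x) ^+ 2 <= disc s idx / s%:R ^+ 2.
Proof.
move=> s0; have s0' : s%:R != 0 :> R by rewrite pnatr_eq0 -lt0n.
pose F0 f := \sum_(l < s) centered (idx l) f.
pose c := F0 (gker d x).
have finF : finite_functional (fun f => F0 f + (- c) * f x).
  apply: finite_functionalD.
    exact: finite_functional_sum (fun l => finite_functional_centered (idx l)).
  exact: finite_functionalZ (finite_functional_eval R x).
have := psd_functional d finF; rewrite gkerxx.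
have -> : F0 (fun a => F0 (gker d a) + (- c) * gker d a x) = disc s idx - c * c.
  rewrite /F0; under eq_bigr do rewrite centeredD centeredZ centered_sum.
  rewrite big_split /= -mulr_sumr mulNr; congr (_ - c * _).
  rewrite /c /F0; apply: eq_bigr => l _.
  by rewrite /centered; congr (_ - _ * _); [exact: gkerC | apply: eq_bigr => a _; exact: gkerC].
rewrite -/c => h.
have -> : kde d s (fun l => P (idx l)) x - kde d n P x = c / s%:R.
  rewrite /c /F0 /centered sumrB sumr_const card_ord -(mulr_natl (_^-1 * _)).
  have -> : kde d n P x = n%:R^-1 * \sum_(a < n) gker d x (P a).
    by congr (_ * _); apply: eq_bigr => a _; rewrite gkerC.
  have -> : kde d s (fun l => P (idx l)) x = s%:R^-1 * \sum_(l < s) gker d x (P (idx l)).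
    by congr (_ * _); apply: eq_bigr => a _; rewrite gkerC.
  by field; rewrite s0' n0.
rewrite exprMn exprVn ler_pM2r; first by move: h; rewrite expr2; lra.
by rewrite invr_gt0 exprn_gt0 // ltr0n.
Qed.

Lemma disc_ge0 s idx : (0 < s)%N -> 0 <= disc s idx.
Proof.
move=> s0; have := le_trans (sqr_ge0 _) (disc_sup idx (fun=> 0) s0).
by rewrite pmulr_lge0 // invr_gt0 exprn_gt0 // ltr0n.
Qed.

Lemma sum_centered f : \sum_(u < n) centered u f = 0.
Proof.
rewrite /centered sumrB sumr_const card_ord -(mulr_natl (_^-1 * _)) mulrA mulfV //.
by rewrite mul1r subrr.
Qed.

Lemma sum_cker u : \sum_(v < n) cker u v = 0.
Proof.
rewrite /cker -centered_sum.
under [X in centered u X]eq_fun do rewrite sum_centered.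
by rewrite /centered big1 // mulr0 subrr.
Qed.

Lemma ckerC u v : cker u v = cker v u.
Proof.
have flip x : gker d x = gker d ^~ x by apply/funext => y; exact: gkerC.
transitivity (centered u (fun a => gker d a (P v) +
    (- n%:R^-1) * \sum_(b < n) gker d a (P b))).
  by congr centered; apply/funext => a; rewrite /centered mulNr.
rewrite centeredD centeredZ centered_sum /cker -flip [RHS]/centered mulNr.
by congr (_ - _ * _); apply: eq_bigr => b _; rewrite -flip.
Qed.

(** The sum equals n - S / n: the variance of a random unit feature vector is at most 1. *)
Lemma sum_cker_diag : \sum_(v < n) cker v v <= n%:R.
Proof.
pose S := \sum_(u < n) \sum_(v < n) gker d (P u) (P v).
have S0 : 0 <= S.
  by apply: sumr_ge0 => u _; apply: sumr_ge0 => v _; exact/ltW/gker_gt0.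
have E (v : 'I_n) : cker v v = 1 - n%:R^-1 * (\sum_(a < n) gker d (P v) (P a))
    - n%:R^-1 * (\sum_(a < n) gker d (P a) (P v)) + n%:R^-1 * (n%:R^-1 * S).
  rewrite /cker /centered gkerxx sumrB -mulr_sumr; rewrite -/S; ring.
under eq_bigr do rewrite E.
rewrite big_split /= !sumrB -!mulr_sumr !sumr_const card_ord.
rewrite [X in _ - _ - _ * X + _]exchange_big /= -/S.
rewrite -(mulr_natl S) mulKf //.
have := mulr_ge0 (_ : 0 <= n%:R^-1) S0; rewrite invr_ge0 ler0n => /(_ isT).
by lra.
Qed.

Lemma disc_recr s idx : disc s.+1 idx =
  disc s idx + 2 * \sum_(l < s) cker (idx l) (idx s) + cker (idx s) (idx s).
Proof.
rewrite /disc big_ord_recr /=; under eq_bigr do rewrite big_ord_recr /=.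
rewrite big_split big_ord_recr /=.
have -> : \sum_(i < s) cker (idx s) (idx i) = \sum_(i < s) cker (idx i) (idx s).
  by apply: eq_bigr => i _; exact: ckerC.
by ring.
Qed.

Lemma eq_disc s idx idx' : (forall l, (l < s)%N -> idx l = idx' l) ->
  disc s idx = disc s idx'.
Proof.
by move=> h; apply: eq_bigr => l _; apply: eq_bigr => l' _; rewrite !h.
Qed.

(** The cross term averages to zero because the feature vectors are centered, and the diagonal term
    to at most 1. Here [idx' v] extends the first [s] indices by the new draw [v]. *)
Lemma avg_disc s idx (idx' : nat -> nat -> nat) :
  (forall v l, (l < s)%N -> idx' v l = idx l) -> (forall v, idx' v s = v) ->
  n%:R^-1 * \sum_(v < n) disc s.+1 (idx' v) <= disc s idx + 1.
Proof.
move=> h1 h2; rewrite ler_pdivrMl ?ltr0n //.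
have E (v : 'I_n) : disc s.+1 (idx' v) =
    disc s idx + (2 * \sum_(l < s) cker (idx l) v + cker v v).
  rewrite disc_recr h2 (eq_disc (h1 v)) -[LHS]addrA; congr (_ + (_ * _ + _)).
  by apply: eq_bigr => l _; rewrite h1.
under eq_bigr do rewrite E.
rewrite big_split big_split /= sumr_const card_ord -mulr_sumr exchange_big /=.
rewrite [X in 2 * X]big1 => [|l _]; last exact: sum_cker.
by have := sum_cker_diag; rewrite -mulr_natl; lra.
Qed.

End Discrepancy.

(** * Sketching, tail bounds and the quality of a candidate *)

Section SketchStep.
Variables (R : realType) (M : nat).
Hypothesis M_gt0 : (0 < M)%N.
Implicit Types (V : nat -> R) (N r v : R).

Definition sqn V : R := \sum_(h < M) V h ^+ 2.

(* A supermartingale along the coordinates of the sketched vector: [N] is the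
   squared norm of the coordinates already processed, [r] that of the others. *)
Definition sketch_pot V N r : R :=
  (sqn V - N) ^+ 2 + 4 / M%:R * (sqn V * r) + 2 / M%:R * r ^+ 2.

Lemma sqn_bump V (h : nat) (c : R) : (h < M)%N ->
  sqn (fun h' => V h' + (h' == h)%:R * c) = sqn V + 2 * c * V h + c ^+ 2.
Proof.
move=> hM; rewrite /sqn (bigD1 (Ordinal hM)) //=.
rewrite [\sum_(h0 < M) V h0 ^+ 2](bigD1 (Ordinal hM)) //= eqxx mul1r.
rewrite (eq_bigr (fun i : 'I_M => V i ^+ 2)); first by ring.
by move=> i; rewrite -val_eqE /= => /negbTE ->; rewrite mul0r addr0.
Qed.

(** Adding v with a random sign to bucket h changes [sqn V - N] by twice the signed product of v and
    V_h. The sign kills the odd terms; the mean of 4 v^2 V_h^2 over the buckets is 4 v^2 sqn V / M,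
    which is what the second term of the potential gives up. The remaining terms add up to -2 v^4 /
    M. *)
Lemma sketch_pot_step V N r v (V' : nat -> nat -> nat -> R) :
  (forall h b h', (h' < M)%N ->
     V' h b h' = V h' + (h' == h)%:R * (((b + b)%N%:R - 1) * v)) ->
  M%:R^-1 * \sum_(h < M) (2^-1 * \sum_(b < 2)
     sketch_pot (V' h b) (N + v ^+ 2) (r - v ^+ 2)) <= sketch_pot V N r.
Proof.
move=> V'E.
have M0 : M%:R != 0 :> R by rewrite pnatr_eq0 -lt0n.
have E (h : 'I_M) : 2^-1 * \sum_(b < 2) sketch_pot (V' h b) (N + v ^+ 2) (r - v ^+ 2) =
    4 * v ^+ 2 * V h ^+ 2 + (sketch_pot V N r - 4 / M%:R * v ^+ 2 * sqn V
      - 2 / M%:R * v ^+ 4).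
  rewrite big_ord_recl big_ord1 /=.
  have S b : sqn (V' h b) =
      sqn V + 2 * (((b + b)%N%:R - 1) * v) * V h + (((b + b)%N%:R - 1) * v) ^+ 2.
    by rewrite -sqn_bump //; apply: eq_bigr => i _; rewrite V'E.
  by rewrite /sketch_pot !S /= (_ : bump 0 0 = 1%N) // add0n addn1; field.
under eq_bigr do rewrite E.
rewrite big_split /= -mulr_sumr -/(sqn V) sumr_const card_ord -[(_ - _) *+ M]mulr_natl.
rewrite mulrDr mulKf //.
have : 0 <= 2 / M%:R * v ^+ 4 :> R.
  by rewrite mulr_ge0 ?divr_ge0 // -[4%N]/(2 * 2)%N exprM sqr_ge0.
by lra.
Qed.

End SketchStep.

(** * An exponential moment bound for one bounded draw *)

Section Chernoff.
Variable R : realType.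

(** From exp(-u/2) >= 1 - u/2, since (1 + u + u^2)(1 - u/2)^2 = 1 + u^2 (1 - 3u + u^2) / 4 is at
    least 1 for u <= 1/3. *)
Lemma expR_le_quad (u : R) : u <= 3^-1 -> expR u <= 1 + u + u ^+ 2.
Proof.
move=> u3; have h := expR_ge1Dx (- (u / 2)).
have p0 : 0 < 1 - u / 2 by lra.
have -> : expR u = (expR (- (u / 2)) ^+ 2)^-1.
  by rewrite -expRM_natl -expRN; congr expR; rewrite mulrN opprK; field.
have sq : (1 - u / 2) ^+ 2 <= expR (- (u / 2)) ^+ 2.
  by rewrite ler_pXn2r ?nnegrE ?expR_ge0 // ltW.
rewrite -[leLHS]mul1r ler_pdivrMr ?exprn_gt0 ?expR_gt0 //.
have q0 : 0 <= 1 + u + u ^+ 2 by nra.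
apply: le_trans (ler_wpM2l q0 sq); nra.
Qed.

(** The quadratic bound on exp applies because |f - mu| <= 1 and |lam| <= 1/3; the linear term
    averages to zero and the variance is estimated crudely by 1. *)
Lemma mgf_step n (f : nat -> R) (mu lam : R) : (0 < n)%N ->
  (forall i, 0 <= f i <= 1) -> mu = n%:R^-1 * \sum_(i < n) f i ->
  - 3^-1 <= lam <= 3^-1 ->
  n%:R^-1 * \sum_(i < n) expR (lam * (f i - mu)) <= expR (lam ^+ 2).
Proof.
move=> n0 f01 muE /andP[l1 l2].
have n0' : n%:R != 0 :> R by rewrite pnatr_eq0 -lt0n.
have S : \sum_(i < n) f i = n%:R * mu by rewrite muE mulVKf.
have mu01 : 0 <= mu <= 1.
  rewrite muE mulr_ge0 ?invr_ge0 ?sumr_ge0 //=; last first.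
    by move=> i _; case/andP: (f01 i).
  rewrite ler_pdivrMl ?ltr0n // mulr1 -[X in _ <= X%:R]card_ord -sumr_const.
  by apply: ler_sum => i _; case/andP: (f01 i).
apply: (@le_trans _ _ (1 + lam ^+ 2)); last exact: expR_ge1Dx.
rewrite ler_pdivrMl ?ltr0n //.
have E (i : 'I_n) : expR (lam * (f i - mu)) <= lam * (f i - mu) + (1 + lam ^+ 2).
  have := f01 i; move: (f i) => y /andP[y0 y1]; case/andP: mu01 => m0 m1.
  have b1 : lam * (y - mu) <= 3^-1 by nra.
  have : (y - mu) ^+ 2 <= 1 by nra.
  have := sqr_ge0 lam; have := expR_le_quad b1; rewrite exprMn; nra.
apply: le_trans (ler_sum _ (fun i _ => E i)) _.
rewrite big_split /= -mulr_sumr sumrB S !sumr_const card_ord.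
by rewrite -(mulr_natl mu) subrr mulr0 add0r -[X in X <= _]mulr_natl.
Qed.

End Chernoff.

(** * Tuples of sample indices as base-s numbers *)

Section Enumeration.

(** A tuple of k indices is encoded by the base-s digits of a number below s^k, so that the
    exhaustive search is a single counting loop. *)
Definition digit (s tau l : nat) : nat := ((tau %/ s ^ l) %% s)%N.

Lemma digitS s tau l : digit s tau l.+1 = digit s (tau %/ s) l.
Proof. by rewrite /digit expnS divnMA. Qed.

Lemma digit_surj s k (t : nat -> nat) : (forall l, (t l < s)%N) ->
  exists2 tau, (tau < s ^ k)%N & forall l, (l < k)%N -> digit s tau l = t l.
Proof.
elim: k t => [|k IH] t ts; first by exists 0%N.
have s0 : (0 < s)%N by exact: leq_ltn_trans (leq0n _) (ts 0%N).
have [tau lt_tau h] := IH (fun l => t l.+1) (fun l => ts l.+1).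
exists (tau * s + t 0)%N.
  rewrite expnS; have := ts 0%N; nia.
case=> [_|l lk]; first by rewrite /digit expn0 divn1 modnMDl modn_small.
by rewrite digitS divnMDl // divn_small // addn0 h.
Qed.

Definition mult s k tau (i : nat) : nat := (\sum_(l < k) (digit s tau l == i))%N.

Lemma sum_mult (R : realType) s k tau (f : nat -> R) : (0 < s)%N ->
  \sum_(i < s) (mult s k tau i)%:R * f i = \sum_(l < k) f (digit s tau l).
Proof.
move=> s0.
rewrite (eq_bigr (fun i : 'I_s => \sum_(l < k) (digit s tau l == i)%:R * f i)).
  rewrite exchange_big /=; apply: eq_bigr => l _.
  have ds : (digit s tau l < s)%N by rewrite ltn_mod.
  rewrite (bigD1 (Ordinal ds)) //= eqxx mul1r big1 ?addr0 // => i.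
  by rewrite -val_eqE /= eq_sym => /negbTE ->; rewrite mul0r.
by move=> i _; rewrite /mult natr_sum mulr_suml.
Qed.

End Enumeration.

(** * Density lost by sparsification, sketching and sampling *)

Section Quality.
Variable R : realType.

Definition candidate s k (p : nat -> nat -> R) tau (j : nat) : R :=
  (\sum_(i < s) (mult s k tau i)%:R * p i j) / k%:R.

Lemma candidateE s k p tau : (0 < s)%N ->
  candidate s k p tau = avgpt k p (digit s tau).
Proof.
by move=> s0; apply/funext => j; rewrite /candidate (sum_mult k tau (p ^~ j) s0) mulrC.
Qed.

(** Stretching all distances by 1 + g costs the same exponent as a sparse mean-shift step, so the
    two kinds of error multiply. *)
Lemma smean_le_scaled s (D D' : nat -> R) (g : R) : (0 < s)%N -> 0 <= g ->
  (forall i, (i < s)%N -> D' i <= (1 + g) * D i) ->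
  (1 + g) * ln (smean s D) <= ln (smean s D').
Proof.
move=> s0 g0 h; apply: smean_gibbs => //.
rewrite mulr_sumr; apply: ler_sum => i _; rewrite mulrCA.
by rewrite ler_wpM2l ?gibbs_ge0 // h.
Qed.

Lemma smean_le1 s (D : nat -> R) : (0 < s)%N -> (forall i, 0 <= D i) -> smean s D <= 1.
Proof.
move=> s0 D0; rewrite ler_pdivrMl ?ltr0n // mulr1.
rewrite -[X in _ <= X%:R]card_ord -sumr_const ler_sum // => i _.
by rewrite -[leRHS]expR0 ler_expR oppr_le0.
Qed.

Lemma stretch (g D D' : R) : 0 < g -> 0 <= D -> D' - D <= g / 2 * D ->
  D' <= (1 + g) * D.
Proof.
move=> g0 D0; have : 0 <= g * D by rewrite mulr_ge0 // ltW.
by rewrite mulrDl mul1r; lra.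
Qed.

(** This direction asks for a relative error of g/2 instead of g: (1 + g)(1 - g/2) = 1 + g (1 - g) /
    2 >= 1. *)
Lemma shrink (g D D' : R) : 0 < g -> g <= 1 -> 0 <= D ->
  - (g / 2 * D) <= D' - D -> D <= (1 + g) * D'.
Proof.
move=> g0 g1 D0 h.
have h1 : (1 + g) * (D - g / 2 * D) <= (1 + g) * D'.
  by apply: ler_wpM2l; [lra | move: h; lra].
apply: le_trans h1.
have -> : (1 + g) * (D - g / 2 * D) = D + g * (1 - g) / 2 * D by field.
by rewrite lerDl !mulr_ge0 ?invr_ge0 ?subr_ge0 // ltW.
Qed.

(** Three factors 1 + 1/k: Maurey's tuple for [x], its passage to the sketch, and the passage of the
    sketch winner back to the original points. Between the last two, the winner beats Maurey's tuple
    inside the sketch. *)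
Lemma best_candidate d M s k (p q : nat -> nat -> R) (tau : nat) x :
  (0 < s)%N -> (0 < k)%N -> (tau < s ^ k)%N ->
  (forall t i, (t < s ^ k)%N -> (i < s)%N ->
    `|sqd M (q i) (candidate s k q t) - sqd d (p i) (candidate s k p t)| <=
      (2 * k%:R)^-1 * sqd d (p i) (candidate s k p t)) ->
  (forall t, (t < s ^ k)%N ->
    kde M s q (candidate s k q t) <= kde M s q (candidate s k q tau)) ->
  (1 + k%:R^-1) ^+ 3 * ln (kde d s p x) <= ln (kde d s p (candidate s k p tau)).
Proof.
move=> s0 k0 ltau dist best.
have k1 : 1 <= k%:R :> R by rewrite ler1n.
have g1 : k%:R^-1 <= 1 :> R by rewrite invf_le1 // (lt_le_trans ltr01).
have g0 : 0 < k%:R^-1 :> R by rewrite invr_gt0 (lt_le_trans ltr01).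
have [t0 t0s ht0] := maurey d p x s0 k0.
have [t lt_t tE] := digit_surj k t0s.
rewrite (_ : avgpt k p t0 = candidate s k p t) in ht0; last first.
  rewrite candidateE //; apply/funext => j; congr (_ * _).
  by apply: eq_bigr => l _; rewrite tE.
have halfE : (2 * k%:R)^-1 = k%:R^-1 / 2 :> R by rewrite invfM mulrC.
have h1 : (1 + k%:R^-1) * ln (kde d s p (candidate s k p t)) <=
    ln (kde M s q (candidate s k q t)).
  apply: smean_le_scaled => // i is_.
  have := dist t i lt_t is_; rewrite halfE ler_norml => /andP[_ hu].
  by apply: stretch g0 (sqd_ge0 _ _ _) hu.
have h2 : (1 + k%:R^-1) * ln (kde M s q (candidate s k q tau)) <=
    ln (kde d s p (candidate s k p tau)).
  apply: smean_le_scaled => // i is_.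
  have := dist tau i ltau is_; rewrite halfE; have := sqd_ge0 d (p i) (candidate s k p tau).
  by rewrite ler_norml => D0 /andP[hl _]; exact: shrink.
have h3 : ln (kde M s q (candidate s k q t)) <= ln (kde M s q (candidate s k q tau)).
  by rewrite ler_ln ?posrE ?smean_gt0 // best.
set c := 1 + k%:R^-1 in ht0 h1 h2 *.
have c0 : 0 <= c by rewrite addr_ge0 // ltW.
rewrite exprS expr2 -!mulrA; apply: le_trans h2; apply: (ler_wpM2l c0).
by apply: le_trans h3; apply: le_trans h1; exact: (ler_wpM2l c0).
Qed.

(** The error budget. The sample density at x is at least rho/2 >= 2^-(a+1), and ln 2 <= 1, so its
    negative logarithm is at most a + 1. With k = 64 E (a+1) and (1+g)^3 - 1 <= 7g, the exponent
    costs a factor 1 - 7 eps / 64. The two passages between sample and full set cost eps/16 each,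
    and 7/64 + 2/16 = 15/64 < 1/4. *)
Lemma candidate_quality (d n s k a E : nat) (P p : nat -> nat -> R) (eps rho : R) x y :
  (0 < n)%N -> (0 < s)%N -> 0 < eps < 1 -> 0 < rho <= 1 ->
  1 <= E%:R * eps -> 1 <= 2 ^+ a * rho -> k = (64 * E * a.+1)%N ->
  rho <= kde d n P x ->
  (forall z, (kde d s p z - kde d n P z) ^+ 2 <= (eps * rho / 16) ^+ 2) ->
  (1 + k%:R^-1) ^+ 3 * ln (kde d s p x) <= ln (kde d s p y) ->
  (1 - eps / 4) * kde d n P x <= kde d n P y.
Proof.
move=> n0 s0 /andP[e0 e1] /andP[r0 r1] hE ha kE hx close hln.
have er : 0 <= eps * rho / 16 by rewrite divr_ge0 // mulr_ge0 // ltW.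
have {}close z : `|kde d s p z - kde d n P z| <= eps * rho / 16.
  by rewrite -[leRHS]ger0_norm // -ler_sqr ?nnegrE ?normr_ge0 // !real_normK ?num_real.
have := close x; have := close y; rewrite !ler_norml => /andP[_ cy] /andP[cx _].
set Gx := kde d n P x in hx cx *; set Sx := kde d s p x in hln cx.
set Sy := kde d s p y in hln cy; set Gy := kde d n P y in cy *.
have er' : eps * rho <= rho by rewrite ler_piMl ?ltW.
have cx' : Gx - eps * rho / 16 <= Sx by move: cx; lra.
have E0 : 0 < E%:R :> R by rewrite -(pmulr_lgt0 _ e0) (lt_le_trans ltr01).
have Sx0 : 0 < Sx by exact: smean_gt0.
have Sy0 : 0 < Sy by exact: smean_gt0.
have Sx1 : Sx <= 1 by apply: smean_le1 => // i; exact: sqd_ge0.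
have Sxr : rho / 2 <= Sx.
  apply: le_trans cx'; apply: (@le_trans _ _ (rho - rho / 16)); first lra.
  by move: hx er'; lra.
have ln2 : ln 2 <= 1 :> R.
  by rewrite -[leRHS]expRK ler_ln ?posrE ?expR_gt0 // (le_trans _ (expR_ge1Dx _)).
have u_le : - ln Sx <= a.+1%:R.
  have h : 1 <= 2 ^+ a.+1 * Sx.
    apply: le_trans ha _; rewrite exprS -mulrA mulrCA ler_pM2l ?exprn_gt0 //; lra.
  have : ln 1 <= ln (2 ^+ a.+1 * Sx).
    by rewrite ler_ln ?posrE // mulr_gt0 ?exprn_gt0.
  rewrite ln1 lnM ?posrE ?exprn_gt0 // lnXn // -[ln 2 *+ _]mulr_natl.
  have : a.+1%:R * ln 2 <= a.+1%:R * 1 :> R by rewrite ler_wpM2l.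
  by lra.
have u0 : 0 <= - ln Sx by rewrite oppr_ge0 ln_le0.
have kE' : k%:R = 64 * E%:R * a.+1%:R :> R by rewrite kE !natrM.
have gu : k%:R^-1 * - ln Sx <= eps / 64.
  rewrite ler_pdivrMl; last by rewrite kE' !mulr_gt0.
  have -> : k%:R * (eps / 64) = E%:R * eps * a.+1%:R by rewrite kE'; field.
  by apply: le_trans u_le _; rewrite ler_peMl.
have k1 : 1 <= k%:R :> R.
  by rewrite ler1n -(ltr0n R) kE' !mulr_gt0.
have g1 : k%:R^-1 <= 1 :> R by rewrite invf_le1 // (lt_le_trans ltr01).
have g0 : 0 <= k%:R^-1 :> R by rewrite invr_ge0.
have hl : ln Sx - 7 * eps / 64 <= ln Sy.
  apply: le_trans hln; move: k%:R^-1 g0 g1 gu => g g0 g1 gu.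
  have -> : (1 + g) ^+ 3 * ln Sx = ln Sx - (3 + 3 * g + g ^+ 2) * (g * - ln Sx) by ring.
  have gu0 : 0 <= g * - ln Sx by rewrite mulr_ge0.
  have c7 : 3 + 3 * g + g ^+ 2 <= 7.
    have : g ^+ 2 <= 1 by rewrite expr_le1.
    by move: g1; lra.
  have := ler_wpM2r gu0 c7.
  by move: gu; lra.
have last : Sx * (1 - 7 * eps / 64) <= Sy.
  rewrite -[leRHS]lnK // -[X in X * _]lnK //.
  apply: le_trans (_ : expR (ln Sx) * expR (- (7 * eps / 64)) <= _).
    by rewrite ler_pM2l ?expR_gt0 // expR_ge1Dx.
  by rewrite -expRD ler_expR.
apply: le_trans (_ : Sx * (1 - 7 * eps / 64) - eps * Gx / 16 <= _); last first.
  have : eps * rho <= eps * Gx by rewrite ler_pM2l.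
  by move: last cy; lra.
have h1 : Gx - eps * Gx / 16 <= Sx.
  have : eps * rho <= eps * Gx by rewrite ler_pM2l.
  by move: cx; lra.
have h2 : (Gx - eps * Gx / 16) * (1 - 7 * eps / 64) <= Sx * (1 - 7 * eps / 64).
  by rewrite ler_wpM2r //; move: e1; lra.
have h3 : 0 <= Gx * eps ^+ 2 by rewrite mulr_ge0 ?sqr_ge0 // (le_trans (ltW r0)).
have h4 : 0 <= Gx * eps by rewrite mulr_ge0 // ?(ltW e0) // (le_trans (ltW r0)).
apply: le_trans (lerB h2 (lexx _)).
have -> : (Gx - eps * Gx / 16) * (1 - 7 * eps / 64) - eps * Gx / 16
   = Gx - 15 / 64 * (Gx * eps) + 7 / 1024 * (Gx * eps ^+ 2) by field.
have -> : (1 - eps / 4) * Gx = Gx - (Gx * eps) / 4 by field.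
by move: h3 h4; lra.
Qed.

End Quality.

(** * A logic of expected values for randomized programs *)

Section Logic.
Variables (R : realType) (I : input R).
Implicit Types (s : store R) (c : cmd) (k : seq cmd) (t : nat)
  (f g : store R -> R) (Q : store R -> Prop) (b : R).

Fixpoint expect t f (c : config R) : R :=
  if halted c then f c.2
  else if t is t'.+1 then
    (\sum_(c' <- step I c) expect t' f c') / (size (step I c))%:R
  else 0.

Lemma prob_within_expect t (E : store R -> Prop) (c : config R) :
  prob_within I t E c = expect t (fun s => (`[< E s >])%:R) c.
Proof.
elim: t c => [|t IH] c //=; case: ifP => // _.
by congr (_ / _); apply: eq_bigr => c' _.
Qed.

Lemma step_size (c : config R) : ~~ halted c -> (0 < size (step I c))%N.
Proof.
case: c => [[|[||||||]] s] //= *; rewrite size_map size_iota.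
by rewrite leq_max.
Qed.

Lemma eq_sum_all T (p : pred T) (r : seq T) (F G : T -> R) :
  (forall x, p x -> F x = G x) -> all p r ->
  \sum_(x <- r) F x = \sum_(x <- r) G x.
Proof.
move=> FG; elim: r => [|x r IH] /=; first by rewrite !big_nil.
by case/andP=> px /IH h; rewrite !big_cons FG // h.
Qed.

(** Halting on every branch is essential: runs cut off at time [t] count as 0 and would lose their
    share of [be]. *)
Lemma expect_affine t f (al be : R) (c : config R) : halts_within I t c ->
  expect t (fun s => al * f s + be) c = al * expect t f c + be.
Proof.
elim: t c => [|t IH] c /=; first by rewrite orbF => ->.
case: ifP => //= nh h.
have sz : (size (step I c))%:R != 0 :> R by rewrite pnatr_eq0 -lt0n step_size ?nh.
rewrite (eq_sum_all IH h) big_split big_const_seq count_predT iter_addr addr0 /=.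
by rewrite -mulr_sumr mulrDl mulrA -[be *+ _]mulr_natr mulfK.
Qed.

Definition bounded t f b (c : config R) : Prop :=
  halts_within I t c /\ expect t f c <= b.

Lemma bounded_mono t t' f b b' (c : config R) : (t <= t')%N -> b <= b' ->
  bounded t f b c -> bounded t' f b' c.
Proof.
move=> tt bb [hc ec]; suff [h e] : halts_within I t' c /\ expect t' f c = expect t f c.
  by split=> //; rewrite e; exact: le_trans bb.
elim: t t' c tt hc {ec} => [|t IH] [|t'] c //=.
- by rewrite orbF => _ ->.
- move=> tt; case: ifP => //= nh h; split.
    by apply: sub_all h => c' /(IH t' _ tt) [].
  by congr (_ / _); apply: eq_sum_all h => c' /(IH t' _ tt) [].
Qed.

(* [c] run from [s] takes at most [t] steps, always ends in [Q], and the expected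
   final value of [g] is at most [b]; stated against every continuation [k]. *)
Definition triple c s t Q g b : Prop := forall k t2 f,
  (forall s', Q s' -> bounded t2 f (g s') (k, s')) ->
  bounded (t + t2) f b (c :: k, s).

(** The postcondition holds on every random branch; quantification over [b] lets any bound
    established so far be carried across the command. *)
Definition sure c s t Q : Prop := forall b, triple c s t Q (fun=> b) b.

Lemma triple_weaken c s t t' Q Q' g g' b b' : triple c s t Q g b ->
  (t <= t')%N -> b <= b' -> (forall s', Q s' -> Q' s' /\ g' s' <= g s') ->
  triple c s t' Q' g' b'.
Proof.
move=> h tt bb QQ k t2 f H.
have : bounded (t + t2) f b (c :: k, s).
  by apply: h => s' /QQ [Q's gg]; apply: bounded_mono (H _ Q's).
by apply: bounded_mono => //; rewrite leq_add2r.
Qed.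

Lemma sure_weaken c s t t' Q Q' : sure c s t Q ->
  (t <= t')%N -> (forall s', Q s' -> Q' s') -> sure c s t' Q'.
Proof.
move=> h tt QQ b; apply: triple_weaken (h b) _ _ _ => // s' /QQ; by split.
Qed.

Lemma triple_time t c s t' Q g b : (t <= t')%N -> triple c s t Q g b -> triple c s t' Q g b.
Proof. by move=> tt h; apply: triple_weaken h tt _ _. Qed.

Lemma sure_time t c s t' Q : (t <= t')%N -> sure c s t Q -> sure c s t' Q.
Proof. by move=> tt h; apply: sure_weaken h tt _. Qed.

(** The continuation function [f] is arbitrary, so the hypothesis can be used for [f] pulled back
    along the affine map. This is how failure events are weighted and earlier debts kept as additive
    constants. *)
Lemma triple_affine c s t Q g b (al be : R) : 0 < al -> triple c s t Q g b ->
  triple c s t Q (fun s' => al * g s' + be) (al * b + be).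
Proof.
move=> al0 h k t2 f H; pose f' s := al^-1 * f s + - (al^-1 * be).
have [|hh he] := h k t2 f'.
  move=> s' /H [h1 h2]; split=> //; rewrite expect_affine //.
  by rewrite -mulrN -mulrDr ler_pdivrMl // lerBlDr.
split=> //; move: he; rewrite expect_affine // -mulrN -mulrDr ler_pdivrMl //.
by rewrite lerBlDr.
Qed.

(** Applied to x (f - be), which is at most 0 and hence at most [g], the hypothesis gives x
    (expectation of f - be) <= b for every x > 0, and so the expectation of [f] is at most [be]. *)
Lemma triple_const c s t Q g b (be : R) : (forall s', Q s' -> 0 <= g s') ->
  triple c s t Q g b -> triple c s t Q (fun=> be) be.
Proof.
move=> g0 h k t2 f H.
have hc (x : R) : 0 < x -> halts_within I (t + t2) (c :: k, s) /\
    x * (expect (t + t2) f (c :: k, s) - be) <= b.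
  move=> x0; pose f' s := x * f s + - (x * be).
  have [|hh he] := h k t2 f'.
    move=> s' Qs; have [h1 h2] := H _ Qs; split=> //; rewrite expect_affine //.
    by rewrite -mulrN -mulrDr (le_trans _ (g0 _ Qs)) // pmulr_rle0 // subr_le0 h2.
  by split=> //; move: he; rewrite expect_affine // -mulrN -mulrDr.
split; first by have [] := hc 1 ltr01.
rewrite leNgt; apply/negP => lt; set D := expect _ _ _ - be in hc *.
have D0 : 0 < D by rewrite subr_gt0.
(* For this x the left side equals |b| + 1, which exceeds b. *)
have [] := hc ((`|b| + 1) / D); first by rewrite divr_gt0 // ltr_wpDl.
by move=> _; rewrite divfK ?gt_eqF //; have := ler_norm b; lra.
Qed.

Lemma triple_det c (c' : seq cmd) s s' t Q g b :
  (forall k, step I (c :: k, s) = [:: (c' ++ k, s')]) ->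
  (forall k t2 f, (forall s'', Q s'' -> bounded t2 f (g s'') (k, s'')) ->
     bounded (t + t2) f b (c' ++ k, s')) ->
  triple c s t.+1 Q g b.
Proof.
move=> hs h k t2 f H; have [h1 h2] := h k t2 f H; rewrite addSn.
split.
  by rewrite -[halts_within _ _ _]/(all (halts_within I (t + t2)) (step I (c :: k, s)))
    hs /= h1.
rewrite -[expect _ _ _]/((\sum_(c0 <- step I (c :: k, s)) expect (t + t2) f c0) /
  (size (step I (c :: k, s)))%:R) hs big_seq1 divr1; exact: h2.
Qed.

Lemma triple_skip s Q g b : Q s -> g s <= b -> triple CSkip s 1 Q g b.
Proof.
move=> Qs gb; apply: (triple_det (c' := [::]) (s' := s)) => // k t2 f H.
by apply: bounded_mono (H _ Qs).
Qed.

Lemma triple_istore a e s Q g b :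
  Q (iupd s (ieval I s a) (ieval I s e)) ->
  g (iupd s (ieval I s a) (ieval I s e)) <= b -> triple (CIStore a e) s 1 Q g b.
Proof.
move=> Qs gb.
apply: (triple_det (c' := [::]) (s' := iupd s (ieval I s a) (ieval I s e))) => // k t2 f H.
by apply: bounded_mono (H _ Qs).
Qed.

Lemma triple_rstore a e s Q g b :
  Q (rupd s (ieval I s a) (reval I s e)) ->
  g (rupd s (ieval I s a) (reval I s e)) <= b -> triple (CRStore a e) s 1 Q g b.
Proof.
move=> Qs gb.
apply: (triple_det (c' := [::]) (s' := rupd s (ieval I s a) (reval I s e))) => // k t2 f H.
by apply: bounded_mono (H _ Qs).
Qed.

Lemma sure_istore a e s (Q : store R -> Prop) :
  Q (iupd s (ieval I s a) (ieval I s e)) -> sure (CIStore a e) s 1 Q.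
Proof. by move=> h b; exact: triple_istore. Qed.

Lemma sure_rstore a e s (Q : store R -> Prop) :
  Q (rupd s (ieval I s a) (reval I s e)) -> sure (CRStore a e) s 1 Q.
Proof. by move=> h b; exact: triple_rstore. Qed.

Lemma triple_rand a e s n Q g b : (0 < n)%N -> ieval I s e = n ->
  (forall v, (v < n)%N -> Q (iupd s (ieval I s a) v)) ->
  n%:R^-1 * \sum_(v < n) g (iupd s (ieval I s a) v) <= b ->
  triple (CRand a e) s 1 Q g b.
Proof.
move=> n0 en Qs gb k t2 f H.
have N : maxn 1 n = n by apply/maxn_idPr.
have W v : (v < n)%N ->
    bounded t2 f (g (iupd s (ieval I s a) v)) (k, iupd s (ieval I s a) v).
  by move=> vn; exact/H/Qs.
split; rewrite add1n /= en N.
  rewrite all_map; apply/allP => v; rewrite mem_iota add0n /= => vn.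
  by case: (W v vn).
rewrite size_map size_iota mulrC; apply: le_trans gb.
rewrite ler_wpM2l ?invr_ge0 ?ler0n // big_map -[n in iota 0 n]subn0 -/(index_iota 0 n).
rewrite big_mkord; apply: ler_sum => v _; by case: (W v (ltn_ord v)).
Qed.

Lemma triple_seq c1 c2 s t1 t2 Q1 g1 Q g b :
  triple c1 s t1 Q1 g1 b ->
  (forall s', Q1 s' -> triple c2 s' t2 Q g (g1 s')) ->
  triple (CSeq c1 c2) s (t1 + t2).+1 Q g b.
Proof.
move=> h1 h2; apply: (triple_det (c' := [:: c1; c2]) (s' := s)) => // k t3 f H.
by rewrite -addnA /=; apply: h1 => s' /h2; apply.
Qed.

Lemma sure_seq c1 c2 s t1 t2 Q1 Q :
  sure c1 s t1 Q1 -> (forall s', Q1 s' -> sure c2 s' t2 Q) ->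
  sure (CSeq c1 c2) s (t1 + t2).+1 Q.
Proof. by move=> h1 h2 b; apply: triple_seq (h1 b) _ => s' /h2; apply. Qed.

Lemma triple_if e c1 c2 s t Q g b :
  triple (if beval I s e then c1 else c2) s t Q g b ->
  triple (CIf e c1 c2) s t.+1 Q g b.
Proof.
move=> h; apply: (triple_det (c' := [:: if beval I s e then c1 else c2]) (s' := s)) => //.
Qed.

Lemma sure_if e c1 c2 s t (Q : store R -> Prop) :
  sure (if beval I s e then c1 else c2) s t Q -> sure (CIf e c1 c2) s t.+1 Q.
Proof. by move=> h b; exact: triple_if. Qed.

Lemma sure_while e c s t N (J : nat -> store R -> Prop) :
  (forall i s', (i <= N)%N -> J i s' -> beval I s' e ->
     (i < N)%N /\ sure c s' t (J i.+1)) ->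
  J 0%N s ->
  sure (CWhile e c) s (N * t.+1).+1
    (fun s' => exists j, [/\ (j <= N)%N, J j s' & ~~ beval I s' e]).
Proof.
move=> body J0 b.
suff W m i s' : (i + m = N)%N -> J i s' ->
    triple (CWhile e c) s' (m * t.+1).+1
      (fun s' => exists j, [/\ (j <= N)%N, J j s' & ~~ beval I s' e]) (fun=> b) b.
  by apply: (W N 0%N).
elim: m i s' => [|m IH] i s' iN Ji.
  have iN' : (i <= N)%N by lia.
  case e0 : (beval I s' e); first by have [] := body i s' iN' Ji e0; lia.
  apply: (triple_det (c' := [::]) (s' := s')) => [k|k t2 f H]; first by rewrite /= e0.
  by apply: bounded_mono (H s' _) => //; exists i; rewrite e0.
have iN' : (i <= N)%N by lia.
case e0 : (beval I s' e); last first.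
  apply: (triple_det (c' := [::]) (s' := s')) => [k|k t2 f H]; first by rewrite /= e0.
  apply: bounded_mono (H s' _) => //; first exact: leq_addl.
  by exists i; rewrite e0.
apply: (triple_det (c' := [:: c; CWhile e c]) (s' := s')) => [k|k t2 f H].
  by rewrite /= e0.
have [_ hb] := body i s' iN' Ji e0.
rewrite mulSn addSn -addnS -addnA; apply: (hb b) => s1 J1.
by apply: (IH i.+1) => //; lia.
Qed.

Definition CFor r e c : cmd :=
  CSeq (CIStore (INum r) (INum 0))
    (CWhile (BILt (ILoad (INum r)) e)
      (CSeq c (CIStore (INum r) (IAdd (ILoad (INum r)) (INum 1))))).

(** [G i] is a potential after i iterations, which the body must not increase in expectation. The
    obligations are stated after the counter update, because the counter is itself a memory cell. *)
Lemma triple_for r e c s t N (J : nat -> store R -> Prop) (G : nat -> store R -> R) :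
  (forall i s', (i <= N)%N -> J i s' -> imem s' r = i /\ ieval I s' e = N) ->
  (forall i s', (i < N)%N -> J i s' ->
     triple c s' t (fun s1 => imem s1 r = i /\ J i.+1 (iupd s1 r i.+1))
       (fun s1 => G i.+1 (iupd s1 r i.+1)) (G i s')) ->
  J 0%N (iupd s r 0) ->
  triple (CFor r e c) s (N * (t + 3) + 3) (J N) (G N) (G 0%N (iupd s r 0)).
Proof.
move=> hr body J0.
have -> : (N * (t + 3) + 3 = (1 + (N * (t + 3)).+1).+1)%N by lia.
apply: (triple_seq (Q1 := fun s' => s' = iupd s r 0) (g1 := G 0%N)).
  by apply: triple_istore.
move=> _ ->; move: J0; set s0 := iupd s r 0; move: s0 => s0 J0.
suff W m i s' : (i + m = N)%N -> J i s' ->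
    triple (CWhile (BILt (ILoad (INum r)) e)
        (CSeq c (CIStore (INum r) (IAdd (ILoad (INum r)) (INum 1)))))
      s' (m * (t + 3)).+1 (J N) (G N) (G i s').
  by apply: (W N 0%N).
elim: m i s' => [|m IH] i s' iN Ji.
  have iN' : i = N by lia.
  have [h1 h2] : imem s' r = i /\ ieval I s' e = N by apply: hr => //; lia.
  apply: (triple_det (c' := [::]) (s' := s')) => [k|k t2 f H].
    by rewrite /= h1 h2 iN' ltnn.
  by rewrite iN' in Ji *; exact: bounded_mono (H s' Ji).
have [h1 h2] : imem s' r = i /\ ieval I s' e = N by apply: hr => //; lia.
have lt : (i < N)%N by lia.
apply: (triple_det (c' := [:: CSeq c (CIStore (INum r) (IAdd (ILoad (INum r)) (INum 1)));
    CWhile (BILt (ILoad (INum r)) e)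
      (CSeq c (CIStore (INum r) (IAdd (ILoad (INum r)) (INum 1))))]) (s' := s'))
  => [k|k t2 f H]; first by rewrite /= h1 h2 lt.
rewrite (_ : (m.+1 * (t + 3) + t2 = (t + 1).+1 + ((m * (t + 3)).+1 + t2))%N); last by lia.
have := triple_seq (body i s' lt Ji) _; apply=> [s1 [r1 J1]|s1 J1].
  apply: triple_istore; rewrite /= r1 addn1; first exact: J1.
  exact: lexx.
by apply: (IH i.+1) => //; lia.
Qed.

Lemma sure_for r e c s t N (J : nat -> store R -> Prop) :
  (forall i s', (i <= N)%N -> J i s' -> imem s' r = i /\ ieval I s' e = N) ->
  (forall i s', (i < N)%N -> J i s' ->
     sure c s' t (fun s1 => imem s1 r = i /\ J i.+1 (iupd s1 r i.+1))) ->
  J 0%N (iupd s r 0) ->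
  sure (CFor r e c) s (N * (t + 3) + 3) (J N).
Proof.
move=> hr body J0 b; apply: (triple_for (G := fun _ _ => b) hr) => // i s' iN Ji.
exact: body.
Qed.

End Logic.

(** * The program and its correctness *)

(** Reduces lookups in updated memory by deciding equality of addresses arithmetically. *)
Ltac cells := repeat match goal with
  | |- context [@eq_op _ ?a ?b] =>
    first [ rewrite (_ : (a == b) = true); [|by apply/eqP; lia]
          | rewrite (_ : (a == b) = false); [|by apply/eqP; lia] ]
  end; cbv iota.

(** * Loop-free code, accumulation loops, memory layout and tuple decoding *)

Section Blocks.
Variables (R : realType) (I : input R).
Implicit Types (s : store R) (c : cmd) (PI PR : pred nat) (t N r : nat).

(** Deterministic loop-free commands, which are executed symbolically by [run] instead of by one
    rule per assignment. *)
Fixpoint straight c : bool :=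
  match c with
  | CSkip | CIStore _ _ | CRStore _ _ => true
  | CSeq c1 c2 | CIf _ c1 c2 => straight c1 && straight c2
  | _ => false
  end.

Fixpoint run c s : store R :=
  match c with
  | CIStore a e => iupd s (ieval I s a) (ieval I s e)
  | CRStore a e => rupd s (ieval I s a) (reval I s e)
  | CSeq c1 c2 => run c2 (run c1 s)
  | CIf e c1 c2 => if beval I s e then run c1 s else run c2 s
  | _ => s
  end.

Fixpoint cost c : nat :=
  match c with
  | CSeq c1 c2 => (cost c1 + cost c2).+1
  | CIf e c1 c2 => (maxn (cost c1) (cost c2)).+1
  | _ => 1
  end.

Lemma sure_straight c s (Q : store R -> Prop) :
  straight c -> Q (run c s) -> sure I c s (cost c) Q.
Proof.
elim: c s Q => //= [s Q _ Qs b|a e s Q _|a e s Q _|c1 IH1 c2 IH2 s Q|e c1 IH1 c2 IH2 s Q].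
- exact: triple_skip.
- exact: sure_istore.
- exact: sure_rstore.
- case/andP=> s1 s2 Qs; apply: (sure_seq (Q1 := fun s' => s' = run c1 s)).
    exact: IH1.
  by move=> _ ->; exact: IH2.
- case/andP=> s1 s2 Qs; apply: sure_if; case: ifP Qs => _ Qs.
    by apply: sure_weaken (IH1 _ _ s1 Qs) _ _ => //; exact: leq_maxl.
  by apply: sure_weaken (IH2 _ _ s2 Qs) _ _ => //; exact: leq_maxr.
Qed.

(* [PI] and [PR] are the cells of the two memories that may have changed. *)
Definition keep PI PR s s' : Prop :=
  (forall a, ~~ PI a -> imem s' a = imem s a) /\
  (forall a, ~~ PR a -> rmem s' a = rmem s a).

Lemma keep_refl PI PR s : keep PI PR s s.
Proof. by []. Qed.

Lemma keep_trans PI PR s1 s2 s3 : keep PI PR s1 s2 -> keep PI PR s2 s3 ->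
  keep PI PR s1 s3.
Proof. by move=> [a b] [c d]; split=> x hx; rewrite ?c ?a // ?d ?b. Qed.

Lemma keep_sub PI PR PI' PR' s1 s2 : (forall a, PI a -> PI' a) ->
  (forall a, PR a -> PR' a) -> keep PI PR s1 s2 -> keep PI' PR' s1 s2.
Proof.
move=> hI hR [a b]; split=> x hx.
  by apply: a; apply: contra hx; exact: hI.
by apply: b; apply: contra hx; exact: hR.
Qed.

Lemma keep_iupd PI PR s s' a v : PI a -> keep PI PR s s' -> keep PI PR s (iupd s' a v).
Proof.
move=> Pa [h1 h2]; split=> // x hx /=; case: eqP => [xa|_]; last exact: h1.
by rewrite xa Pa in hx.
Qed.

Lemma keep_rupd PI PR s s' a v : PR a -> keep PI PR s s' -> keep PI PR s (rupd s' a v).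
Proof.
move=> Pa [h1 h2]; split=> // x hx /=; case: eqP => [xa|_]; last exact: h2.
by rewrite xa Pa in hx.
Qed.

Lemma sure_sum r e acc c s t N PI PR (f : nat -> R) :
  PI r -> PR acc ->
  (forall s', keep PI PR s s' -> ieval I s' e = N) ->
  (forall i s', (i < N)%N -> keep PI PR s s' -> imem s' r = i ->
     sure I c s' t (fun s1 => [/\ rmem s1 acc = rmem s' acc + f i,
       imem s1 r = i & keep PI PR s s1])) ->
  sure I (CFor r e c) s (N * (t + 3) + 3) (fun s' =>
    rmem s' acc = rmem s acc + \sum_(i < N) f i /\ keep PI PR s s').
Proof.
move=> Pr Pa he body.
apply: sure_weaken (sure_for (N := N) (t := t) (J := fun i s' =>
  [/\ imem s' r = i, rmem s' acc = rmem s acc + \sum_(l < i) f l & keep PI PR s s'])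
  _ _ _) _ _ => //.
- by move=> i s' _ [h1 h2 h3]; split => //; exact: he.
- move=> i s' iN [h1 h2 h3]; apply: sure_weaken (body i s' iN h3 h1) _ _ => // s1 [k1 k2 k3].
  split=> //; split; first by rewrite /= eqxx.
    by rewrite /= k1 h2 big_ord_recr addrA.
  exact: keep_iupd.
- split; first by rewrite /= eqxx.
    by rewrite big_ord0 addr0.
  exact/keep_iupd/keep_refl.
- by move=> s' [].
Qed.

Lemma sure_fill r e c s t N PI PR (adr : nat -> nat) (f : nat -> R) :
  PI r -> (forall i, (i < N)%N -> PR (adr i)) ->
  (forall i j, (i < N)%N -> (j < N)%N -> adr i = adr j -> i = j) ->
  (forall s', keep PI PR s s' -> ieval I s' e = N) ->
  (forall i s', (i < N)%N -> keep PI PR s s' -> imem s' r = i ->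
     sure I c s' t (fun s1 => [/\ rmem s1 (adr i) = f i, imem s1 r = i,
       forall j, (j < N)%N -> j != i -> rmem s1 (adr j) = rmem s' (adr j)
       & keep PI PR s s1])) ->
  sure I (CFor r e c) s (N * (t + 3) + 3) (fun s' =>
    (forall i, (i < N)%N -> rmem s' (adr i) = f i) /\ keep PI PR s s').
Proof.
move=> Pr Pa inj he body.
apply: sure_weaken (sure_for (N := N) (t := t) (J := fun i s' =>
  [/\ imem s' r = i, forall l, (l < i)%N -> rmem s' (adr l) = f l & keep PI PR s s'])
  _ _ _) _ _ => //.
- by move=> i s' _ [h1 h2 h3]; split => //; exact: he.
- move=> i s' iN [h1 h2 h3]; apply: sure_weaken (body i s' iN h3 h1) _ _ => // s1 [k1 k2 k3 k4].
  split=> //; split; first by rewrite /= eqxx.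
    move=> l; rewrite ltnS leq_eqVlt => /orP[/eqP->|li] //.
    by rewrite /= k3 ?h2 //; lia.
  exact: keep_iupd.
- split=> //; first by rewrite /= eqxx.
  exact/keep_iupd/keep_refl.
- by move=> s' [].
Qed.

(* Integer memory: cells below 32 are registers; from 32 on, even cells hold the
   multiplicities [cnt] of a tuple of sample points and odd cells the indices
   [idx] of the sample.  Real memory: the first [dim I] cells hold the output;
   from there on the offsets are interleaved modulo 3 into scalars [sc], the
   candidate point [y] and the sketch [q].  Register use: 0 to 3 hold the least
   E, A with E eps >= 1, A eps rho >= 1 and the least a, r with 2^a rho >= 1,
   2^r delta >= 1; 4 the tuple size; 5 the sample size; 6 the number of tuples;
   7 the number of buckets; 8 the size of a verification sample; 11 the best
   tuple.  Scalar 0 is the best verified estimate. *)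
Definition reg r : iexp := ILoad (INum r).
Definition cnt_at (e : iexp) : iexp := IAdd (INum 32) (IMul (INum 2) e).
Definition idx_at (e : iexp) : iexp := IAdd (INum 33) (IMul (INum 2) e).
Definition sc_at (c : nat) : iexp := IAdd IDim (INum (3 * c)).
Definition y_at (e : iexp) : iexp := IAdd IDim (IAdd (INum 1) (IMul (INum 3) e)).
Definition q_at (e : iexp) : iexp := IAdd IDim (IAdd (INum 2) (IMul (INum 3) e)).
Definition sc (c : nat) : rexp := RLoad (sc_at c).

Definition cnt_cell (a : nat) : bool := (32 <= a)%N && ~~ odd a.
Definition idx_cell (a : nat) : bool := (32 <= a)%N && odd a.
Definition regs_from (lv a : nat) : bool := (lv <= a)%N && (a < 32)%N.
Definition sc_from (lv a : nat) : bool :=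
  [&& (Defs.dim I + 3 * lv <= a)%N & ((a - Defs.dim I) %% 3 == 0)%N].
Definition y_cell (a : nat) : bool := (Defs.dim I <= a)%N && ((a - Defs.dim I) %% 3 == 1)%N.
Definition q_cell (a : nat) : bool := (Defs.dim I <= a)%N && ((a - Defs.dim I) %% 3 == 2)%N.
Definition out_cell (a : nat) : bool := (a < Defs.dim I)%N.

Definition zero_counts : cmd :=
  CFor 20 (reg 5) (CIStore (cnt_at (reg 20)) (INum 0)).

(** Division by the sample size through repeated subtraction, since expressions have no quotient:
    register 23 collects the quotient, and what remains in 21 is the digit whose count is increased.
    The up to T subtractions are absorbed by the factor T in the number of buckets. *)
Definition peel_digit : cmd :=
  CSeq (CIStore (INum 23) (INum 0))
  (CSeq (CWhile (BNot (BILt (reg 21) (reg 5)))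
           (CSeq (CIStore (INum 21) (ISub (reg 21) (reg 5)))
                 (CIStore (INum 23) (IAdd (reg 23) (INum 1)))))
  (CSeq (CIStore (cnt_at (reg 21)) (IAdd (ILoad (cnt_at (reg 21))) (INum 1)))
        (CIStore (INum 21) (reg 23)))).

Definition decode (xr : nat) : cmd :=
  CSeq zero_counts
  (CSeq (CIStore (INum 21) (reg xr)) (CFor 22 (reg 4) peel_digit)).

Section Decode.
Variables (sz k T : nat).
Hypothesis sz_gt0 : (0 < sz)%N.

Lemma sure_peel s (x : nat) : (x <= T)%N -> imem s 5 = sz -> imem s 21 = x ->
  sure I peel_digit s (4 * T + 10) (fun s' =>
    [/\ imem s' 21 = (x %/ sz)%N,
       forall i, imem s' (32 + 2 * i) = (imem s (32 + 2 * i) + (x %% sz == i))%N,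
       (forall a, [&& a != 21, a != 23 & ~~ cnt_cell a]%N -> imem s' a = imem s a)
     & rmem s' = rmem s]).
Proof.
move=> xT hs hx.
pose J i s' := [/\ (i * sz <= x)%N, imem s' 21 = (x - i * sz)%N, imem s' 23 = i,
  (forall a, [&& a != 21 & a != 23]%N -> imem s' a = imem s a) & rmem s' = rmem s].
apply: (@sure_time _ _ ((1 + ((T * 4).+1 + 3).+1).+1)%N); first lia.
apply: (sure_seq (Q1 := J 0%N)).
  apply: sure_istore; split=> //=; rewrite ?hx ?subn0 // => a /andP[_ h].
  by rewrite (negbTE h).
move=> s1 J1; apply: sure_seq.
  apply: (sure_while (N := T) (J := J)) J1 => i s' iT [h1 h2 h3 h4 h5] /=.
  rewrite h2 h4 // hs -leqNgt => le.
  have le' : (i.+1 * sz <= x)%N by rewrite mulSn; lia.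
  split; first by nia.
  apply: (sure_straight (c := CSeq _ _)) => //=; rewrite h2 h3 h4 // hs; split=> //=.
  - by rewrite mulSn; lia.
  - by rewrite addn1.
  - move=> a /andP[/negbTE n1 /negbTE n2]; rewrite n1 n2; apply: h4.
    by rewrite n1 n2.
move=> s2 [j [jT [h1 h2 h3 h4 h5]]] /=.
rewrite negbK h2 h4 // hs => lt.
have [xq xm] : (x %/ sz = j /\ x %% sz = x - j * sz)%N.
  have e : x = (j * sz + (x - j * sz))%N by lia.
  split; first by rewrite e divnMDl // divn_small // addn0.
  by rewrite {1}e modnMDl modn_small.
apply: (sure_straight (c := CSeq _ _)) => //=; rewrite h2; split=> //=.
- by rewrite h3.
- move=> i; rewrite xm -(h4 (32 + 2 * i)%N); last by lia.
  by case: (x - j * sz =P i)%N => [e|ne]; cells; rewrite ?e ?addn0.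
- move=> a /and3P[a1 a2 a3]; rewrite (negbTE a1) ifF; first by rewrite h4 // a1.
  by move: a3; rewrite /cnt_cell; lia.
Qed.

End Decode.
End Blocks.

Definition dec_cell (a : nat) : bool := regs_from 20 a || cnt_cell a.

Ltac celllia := rewrite /dec_cell /cnt_cell /idx_cell /regs_from /sc_from
  /y_cell /q_cell /out_cell; cbn [ieval sc_at y_at q_at idx_at cnt_at reg];
  cbv beta; lia.

(** * Decoding a tuple and evaluating its candidate in the sketch *)

Section Search.
Variables (R : realType) (I : input R).
Implicit Types (s : store R) (PI PR : pred nat).

Definition cntf s (i : nat) : nat := imem s (32 + 2 * i).
Definition idxf s (i : nat) : nat := imem s (33 + 2 * i).
Definition scv s (c : nat) : R := rmem s (Defs.dim I + 3 * c).
Definition yf s (j : nat) : R := rmem s (Defs.dim I + (1 + 3 * j)).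
Definition qf (M : nat) s (i h : nat) : R := rmem s (Defs.dim I + (2 + 3 * (i * M + h))).

Variables (sz k T M : nat).
Hypotheses (sz_gt0 : (0 < sz)%N) (k_gt0 : (0 < k)%N).

Lemma sure_zero_counts s : imem s 5 = sz ->
  sure I zero_counts s (sz * 4 + 3) (fun s' =>
    (forall i, (i < sz)%N -> cntf s' i = 0%N) /\ keep dec_cell pred0 s s').
Proof.
move=> h5.
apply: sure_weaken (sure_for (N := sz) (t := 1) (J := fun i s' =>
  [/\ imem s' 20 = i, forall l, (l < i)%N -> cntf s' l = 0%N & keep dec_cell pred0 s s'])
  _ _ _) _ _ => //.
- by move=> i s' _ [h1 h2 [h3 _]]; split => //=; rewrite h3.
- move=> i s' iN [h1 h2 h3]; apply: sure_istore; split=> /=; first by cells.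
  split=> //=.
    move=> l li; rewrite /cntf /= h1; case: (eqVneq l i) => [->|ne]; cells => //.
    by apply: h2; lia.
  by do 2! apply: keep_iupd => //; rewrite h1 /dec_cell /cnt_cell /regs_from; lia.
- by split=> //; exact/keep_iupd/keep_refl.
- by move=> s' [].
Qed.

Lemma sure_decode xr s tau : (xr < 20)%N -> (tau <= T)%N ->
  imem s 4 = k -> imem s 5 = sz -> imem s xr = tau ->
  sure I (decode xr) s (4 * sz + k * (4 * T + 13) + 20) (fun s' =>
    (forall i, (i < sz)%N -> cntf s' i = mult sz k tau i) /\ keep dec_cell pred0 s s').
Proof.
move=> xr20 tT h4 h5 hx.
apply: (@sure_time _ _ ((sz * 4 + 3) + (1 + (k * ((4 * T + 10) + 3) + 3)).+1).+1); first lia.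
apply: sure_seq (sure_zero_counts h5) _ => s1 [z1 k1].
apply: (sure_seq (Q1 := fun s2 => [/\ imem s2 21 = tau,
   forall i, (i < sz)%N -> cntf s2 i = 0%N & keep dec_cell pred0 s s2])).
  apply: sure_istore; split => /=.
  - by rewrite k1.1 ?hx // /dec_cell /cnt_cell /regs_from; lia.
  - by move=> i isz; rewrite /cntf /=; cells; exact: z1.
  - by apply: keep_iupd.
move=> s2 [t2 z2 k2].
apply: sure_weaken (sure_for (N := k) (t := 4 * T + 10) (J := fun l s' =>
  [/\ imem s' 22 = l, imem s' 21 = (tau %/ sz ^ l)%N,
     forall i, (i < sz)%N -> cntf s' i = (\sum_(l' < l) (digit sz tau l' == i))%N
   & keep dec_cell pred0 s s'])
  _ _ _) _ _ => //.
- by move=> i s' _ [e1 e2 e3 [e4 _]]; split => //=; rewrite e4.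
- move=> l s' lk [e1 e2 e3 e4].
  apply: sure_weaken (sure_peel (T := T) sz_gt0 _ _ e2) _ _ => //.
  + by apply: leq_trans tT; exact: leq_div.
  + by rewrite e4.1.
  move=> s3 [p1 p2 p3 p4]; split; first by rewrite p3.
  split=> //=.
  + by rewrite p1 expnSr divnMA.
  + move=> i isz; rewrite /cntf /=; cells.
    by rewrite big_ord_recr /= p2 -/(cntf s' i) e3 //.
  + apply: keep_iupd => //; apply: keep_trans e4 _; split=> a; last by rewrite p4.
    by move=> h; apply: p3; move: h; rewrite /dec_cell /cnt_cell /regs_from; lia.
- split=> //=; first by rewrite t2 expn0 divn1.
    by move=> i isz; rewrite big_ord0 /cntf /=; cells; exact: z2.
  by apply: keep_iupd.
- by move=> s' [].
Qed.


Definition q_cell_at (e1 e2 : iexp) : rexp :=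
  RLoad (q_at (IAdd (IMul e1 (reg 7)) e2)).

Definition eval_coord : cmd :=
  CSeq (CRStore (sc_at 4) (ROfInt (INum 0)))
  (CSeq (CFor 22 (reg 5) (CRStore (sc_at 4) (RAdd (sc 4)
      (RMul (ROfInt (ILoad (cnt_at (reg 22)))) (q_cell_at (reg 22) (reg 21))))))
  (CSeq (CRStore (sc_at 5) (RSub (q_cell_at (reg 20) (reg 21))
      (RDiv (sc 4) (ROfInt (reg 4)))))
    (CRStore (sc_at 3) (RAdd (sc 3) (RMul (sc 5) (sc 5)))))).

Definition eval_term : cmd :=
  CSeq (CRStore (sc_at 3) (ROfInt (INum 0)))
  (CSeq (CFor 21 (reg 7) eval_coord)
    (CRStore (sc_at 2) (RAdd (sc 2) (RExp (RSub (ROfInt (INum 0)) (sc 3)))))).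

Definition eval_cand : cmd :=
  CSeq (CRStore (sc_at 2) (ROfInt (INum 0))) (CFor 20 (reg 5) eval_term).

Definition sketch_score s (tau : nat) : R :=
  \sum_(i < sz) expR (- sqd M (qf M s i) (candidate sz k (qf M s) tau)).

Section Eval.
Variable tau : nat.

Let ready s := [/\ imem s 4 = k, imem s 5 = sz, imem s 7 = M &
  forall i, (i < sz)%N -> cntf s i = mult sz k tau i].

Let ready_keep lv c s s' : (20 <= lv)%N -> ready s ->
  keep (regs_from lv) (sc_from I c) s s' -> ready s'.
Proof.
move=> lv20 [h4 h5 h7 hc] [k1 _].
split; try by rewrite k1 //; celllia.
by move=> i isz; rewrite /cntf k1 -?hc //; celllia.
Qed.

Let qf_keep lv c s s' : keep (regs_from lv) (sc_from I c) s s' -> qf M s' = qf M s.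
Proof.
by move=> [_ h]; do 2 apply/funext => ?; rewrite /qf h //; celllia.
Qed.

Lemma sure_eval_coord s i h : ready s -> imem s 20 = i -> imem s 21 = h ->
  sure I eval_coord s (4 * sz + 10) (fun s' =>
    [/\ rmem s' (Defs.dim I + 3 * 3) = scv s 3 +
         (qf M s i h - candidate sz k (qf M s) tau h) ^+ 2
     & keep (regs_from 22) (sc_from I 3) s s']).
Proof.
move=> rs hi hh; have [h4 h5 h7 hc] := rs.
apply: (@sure_time _ _ (1 + ((sz * (1 + 3) + 3) + 3).+1).+1); first lia.
apply: (sure_seq (Q1 := fun s1 => rmem s1 (Defs.dim I + 3 * 4) = 0 /\ keep (regs_from 22) (sc_from I 4) s s1)).
  apply: sure_rstore; split => /=; first by cells.
  by apply: keep_rupd; [celllia | exact: keep_refl].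
move=> s1 [z1 k1].
apply: (sure_seq (sure_sum (N := sz) (PI := regs_from 22) (PR := sc_from I 4)
  (acc := (Defs.dim I + 3 * 4)%N)
  (f := fun i' => (mult sz k tau i')%:R * qf M s i' h) _ _ _ _)).
- by celllia.
- by celllia.
- by move=> s' k'; rewrite /= k'.1 ?k1.1 // celllia.
- move=> i' s' isz k' r22; apply: sure_rstore.
  have kk := keep_trans k1 k'.
  have [_ _ g7 gc] := ready_keep (isT : (20 <= 22)%N) rs kk.
  rewrite /= r22 g7; split; last by apply: keep_rupd => //; celllia.
    cells; rewrite -(qf_keep kk) /qf -/(cntf s' i') gc // kk.1 ?hh //; celllia.
  by [].
move=> s2 [a2 k2]; have kk := keep_trans k1 k2.
have [g4 g5 g7 gc] := ready_keep (isT : (20 <= 22)%N) rs kk.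
have gi : imem s2 20 = i by rewrite kk.1.
have gh : imem s2 21 = h by rewrite kk.1.
apply: (sure_straight (c := CSeq _ _)) => //=; rewrite gi gh g7 g4.
split.
  cells; rewrite a2 z1 add0r -/(qf M s2 i h) (qf_keep kk) expr2; congr (_ + _).
  by rewrite /scv kk.2 //; celllia.
do 2 (apply: keep_rupd; first celllia).
by apply: keep_sub kk => a //; celllia.
Qed.

Lemma sure_eval_term s i : ready s -> imem s 20 = i ->
  sure I eval_term s (M * (4 * sz + 13) + 10) (fun s' =>
    [/\ rmem s' (Defs.dim I + 3 * 2) = scv s 2 +
         expR (- sqd M (qf M s i) (candidate sz k (qf M s) tau))
     & keep (regs_from 21) (sc_from I 2) s s']).
Proof.
move=> rs hi; have [h4 h5 h7 hc] := rs.
apply: (@sure_time _ _ (1 + ((M * ((4 * sz + 10) + 3) + 3) + 1).+1).+1); first lia.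
apply: (sure_seq (Q1 := fun s1 => rmem s1 (Defs.dim I + 3 * 3) = 0 /\ keep (regs_from 21) (sc_from I 3) s s1)).
  apply: sure_rstore; split => /=; first by cells.
  by apply: keep_rupd; [celllia | exact: keep_refl].
move=> s1 [z1 k1].
apply: (sure_seq (sure_sum (N := M) (PI := regs_from 21) (PR := sc_from I 3)
  (acc := (Defs.dim I + 3 * 3)%N)
  (f := fun h => (qf M s i h - candidate sz k (qf M s) tau h) ^+ 2) _ _ _ _)).
- by celllia.
- by celllia.
- by move=> s' k'; rewrite /= k'.1 ?k1.1 // celllia.
- move=> h s' hM k' r21; have kk := keep_trans k1 k'.
  have rs' := ready_keep (isT : (20 <= 21)%N) rs kk.
  have gi : imem s' 20 = i by rewrite kk.1.
  apply: sure_weaken (sure_eval_coord rs' gi r21) _ _ => // s3 [e3 k3]; split.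
  + by rewrite e3 (qf_keep kk).
  + by rewrite k3.1.
  + by apply: keep_trans k' _; apply: keep_sub k3 => a //; celllia.
move=> s2 [a2 k2]; have kk := keep_trans k1 k2.
apply: sure_rstore; split => /=.
  cells; rewrite a2 z1 !add0r; congr (_ + _).
  by rewrite /scv kk.2 //; celllia.
apply: keep_rupd; first celllia.
by apply: keep_sub kk => a //; celllia.
Qed.

Lemma sure_eval_cand s : ready s ->
  sure I eval_cand s (sz * (M * (4 * sz + 13) + 13) + 10) (fun s' =>
    [/\ scv s' 2 = sketch_score s tau & keep (regs_from 20) (sc_from I 2) s s']).
Proof.
move=> rs; have [h4 h5 h7 hc] := rs.
apply: (@sure_time _ _ (1 + (sz * ((M * (4 * sz + 13) + 10) + 3) + 3)).+1); first lia.
apply: (sure_seq (Q1 := fun s1 => rmem s1 (Defs.dim I + 3 * 2) = 0 /\ keep (regs_from 20) (sc_from I 2) s s1)).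
  apply: sure_rstore; split => /=; first by cells.
  by apply: keep_rupd; [celllia | exact: keep_refl].
move=> s1 [z1 k1].
apply: sure_weaken (sure_sum (N := sz) (PI := regs_from 20) (PR := sc_from I 2)
  (acc := (Defs.dim I + 3 * 2)%N)
  (f := fun i => expR (- sqd M (qf M s i) (candidate sz k (qf M s) tau))) _ _ _ _) _ _ => //.
- by celllia.
- by move=> s' k'; rewrite /= k'.1 ?k1.1 // celllia.
- move=> i s' isz k' r20; have kk := keep_trans k1 k'.
  have rs' := ready_keep (isT : (20 <= 20)%N) rs kk.
  apply: sure_weaken (sure_eval_term rs' r20) _ _ => // s3 [e3 k3]; split.
  + by rewrite e3 (qf_keep kk).
  + by rewrite k3.1.
  + by apply: keep_trans k' _; apply: keep_sub k3 => a //; celllia.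
move=> s2 [a2 k2]; split; last exact: keep_trans k1 k2.
by rewrite /scv a2 z1 add0r.
Qed.

End Eval.
End Search.

(** * Exhaustive search over tuples and construction of the winning point *)

Section Candidate.
Variables (R : realType) (I : input R).
Implicit Types (s : store R) (PI PR : pred nat).
Variables (sz k T M : nat).
Hypotheses (sz_gt0 : (0 < sz)%N) (k_gt0 : (0 < k)%N) (T_gt0 : (0 < T)%N).

Definition search_step : cmd :=
  CSeq (decode 12) (CSeq eval_cand
    (CIf (BRLt (sc 1) (sc 2))
      (CSeq (CRStore (sc_at 1) (sc 2)) (CIStore (INum 11) (reg 12))) CSkip)).

(** The initial record -1 lies below every score, so tuple 0 is always accepted and register 11 ends
    up naming a tuple that was tried. *)
Definition search_best : cmd :=
  CSeq (CRStore (sc_at 1) (RSub (ROfInt (INum 0)) (ROfInt (INum 1))))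
  (CSeq (CIStore (INum 11) (INum 0)) (CFor 12 (reg 6) search_step)).

Definition search_cell (a : nat) : bool := regs_from 11 a || cnt_cell a.

Let sized s := [/\ imem s 4 = k, imem s 5 = sz, imem s 6 = T & imem s 7 = M].

Let sized_keep s s' : sized s -> keep search_cell (sc_from I 1) s s' -> sized s'.
Proof.
by move=> [h4 h5 h6 h7] [k1 _]; split; rewrite k1.
Qed.

Let qf_keep s s' : keep search_cell (sc_from I 1) s s' -> qf I M s' = qf I M s.
Proof.
by move=> [_ h]; do 2 apply/funext => ?; rewrite /qf h //; celllia.
Qed.

Definition decode_time := (4 * sz + k * (4 * T + 13) + 20)%N.
Definition search_time :=
  (T * (decode_time + sz * (M * (4 * sz + 13) + 13) + 30) + 20)%N.

Let score s := sketch_score I sz k M s.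

Lemma sure_search_step s i : sized s -> (i < T)%N -> imem s 12 = i ->
  sure I search_step s (decode_time + sz * (M * (4 * sz + 13) + 13) + 20) (fun s' =>
    [/\ imem s' 12 = i, keep search_cell (sc_from I 1) s s'
     & if scv I s 1 < score s i then imem s' 11 = i /\ scv I s' 1 = score s i
       else imem s' 11 = imem s 11 /\ scv I s' 1 = scv I s 1]).
Proof.
move=> zs iT r12; have [h4 h5 h6 h7] := zs.
apply: (@sure_time _ _ (decode_time + ((sz * (M * (4 * sz + 13) + 13) + 10) + 4).+1).+1); first lia.
have d12 := sure_decode (I := I) sz_gt0 k_gt0 (isT : (12 < 20)%N) (ltnW iT) h4 h5 r12.
apply: sure_seq d12 _ => s1 [c1 k1].
have k1' : keep search_cell (sc_from I 1) s s1.
  by apply: keep_sub k1 => a //; rewrite /search_cell; celllia.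
have [g4 g5 g6 g7] := sized_keep zs k1'.
apply: sure_seq (sure_eval_cand (tau := i) (M := M) sz_gt0 k_gt0 _) _ => // s2 [e2 k2].
have k2' : keep search_cell (sc_from I 1) s s2.
  apply: keep_trans k1' _.
  by apply: keep_sub k2 => a //; rewrite /search_cell; celllia.
have es : sketch_score I sz k M s1 i = score s i.
  by rewrite /score /sketch_score (qf_keep k1').
have e1 : scv I s2 1 = scv I s 1.
  by rewrite /scv k2.2 ?k1.2 //; celllia.
have r12' : imem s2 12 = i by rewrite k2.1 ?k1.1.
apply: (sure_straight (c := CIf _ _ _)) => //=.
rewrite -/(scv I s2 1) -/(scv I s2 2) e1 e2 es; case: ifP => lt.
  split=> //=.
    by apply: keep_iupd => //; apply: keep_rupd => //; celllia.
  by split=> //; rewrite /scv /=; cells; rewrite -es -e2.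
by split=> //; split=> //; rewrite k2.1 ?k1.1.
Qed.

Lemma sure_search_best s : sized s ->
  sure I search_best s search_time (fun s' =>
    [/\ (imem s' 11 < T)%N,
       forall tau, (tau < T)%N -> score s tau <= score s (imem s' 11)
     & keep search_cell (sc_from I 1) s s']).
Proof.
move=> zs; set body := (decode_time + sz * (M * (4 * sz + 13) + 13) + 20)%N.
apply: (@sure_time _ _ (1 + (1 + (T * (body + 3) + 3)).+1).+1).
  by rewrite /search_time /body; lia.
have score_ge0 tau : 0 <= score s tau.
  by apply: sumr_ge0 => j _; exact: expR_ge0.
pose K s' := keep search_cell (sc_from I 1) s s'.
apply: (sure_seq (Q1 := fun s1 => scv I s1 1 = -1 /\ K s1)).
  apply: sure_rstore; split; first by rewrite /scv /=; cells; rewrite sub0r.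
  by apply: keep_rupd; [celllia | exact: keep_refl].
move=> s1 [v1 k1].
apply: (sure_seq (Q1 := fun s2 => scv I s2 1 = -1 /\ K s2)).
  by apply: sure_istore; split => //; exact: keep_iupd.
move=> s2 [v2 k2].
apply: sure_weaken (sure_for (N := T) (t := body) (J := fun i s' =>
  [/\ imem s' 12 = i, K s', (forall tau, (tau < i)%N -> score s tau <= scv I s' 1)
    & if i == 0%N then scv I s' 1 = -1
      else (imem s' 11 < i)%N /\ scv I s' 1 = score s (imem s' 11)])
  _ _ _) _ _ => //.
- by move=> i s' _ [e1 e2 _ _]; split => //=; have [_ _ ->] := sized_keep zs e2.
- move=> i s' iT [e1 e2 e3 e4].
  have es : score s' = score s.
    by apply/funext => tau; rewrite /score /sketch_score (qf_keep e2).
  apply: sure_weaken (sure_search_step (sized_keep zs e2) iT e1) _ _ => // s3 [p1 p2 p3].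
  split=> //; split=> //; first by apply: keep_iupd => //; exact: keep_trans e2 p2.
    rewrite -[scv _ _ _]/(scv I s3 1) => tau; rewrite ltnS leq_eqVlt.
    move: p3; rewrite es; case: ifP => [lt [_ ->]|/negbT ge [_ ->]] /orP[/eqP->|ti] //.
      by apply: le_trans (ltW lt); exact: e3.
    by rewrite leNgt.
    exact: e3.
  change ((imem s3 11 < i.+1)%N /\ scv I s3 1 = score s (imem s3 11)).
  move: p3; rewrite es; case: ifP => [lt [-> ->] //|/negbT ge [-> ->]].
  move: e4; case: eqP => [i0 v1'|_ [h1 h2]]; last by split=> //; exact: ltnW.
  by move: ge; rewrite v1' -leNgt => ge; have := le_trans (score_ge0 i) ge; lra.
- by split=> //; exact: keep_iupd.
- move=> s' [e1 e2 e3]; rewrite ifF; last by apply/negbTE; rewrite -lt0n.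
  by move=> [h1 h2]; split=> // tau /e3; rewrite h2.
Qed.

Definition samp s (i j : nat) : R := read_point I (idxf s i) j.

Definition cand_coord : cmd :=
  CSeq (CRStore (sc_at 3) (ROfInt (INum 0)))
  (CSeq (CFor 13 (reg 5) (CRStore (sc_at 3) (RAdd (sc 3)
      (RMul (ROfInt (ILoad (cnt_at (reg 13))))
        (RPoint (ILoad (idx_at (reg 13))) (reg 12))))))
    (CRStore (y_at (reg 12)) (RDiv (sc 3) (ROfInt (reg 4))))).

Definition make_cand : cmd := CSeq (decode 11) (CFor 12 IDim cand_coord).

Definition cand_cell (a : nat) : bool := sc_from I 2 a || y_cell I a.

Lemma sure_make_cand s tau : sized s -> imem s 11 = tau -> (tau < T)%N ->
  sure I make_cand s (decode_time + Defs.dim I * (4 * sz + 13) + 10) (fun s' =>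
    (forall j, (j < Defs.dim I)%N -> yf I s' j = candidate sz k (samp s) tau j) /\
    keep (fun a => regs_from 12 a || cnt_cell a) cand_cell s s').
Proof.
move=> [h4 h5 h6 h7] r11 tT.
apply: (@sure_time _ _ (decode_time + (Defs.dim I * ((1 + ((sz * (1 + 3) + 3) + 1).+1).+1 + 3) + 3)).+1); first lia.
have d11 := sure_decode (I := I) sz_gt0 k_gt0 (isT : (11 < 20)%N) (ltnW tT) h4 h5 r11.
apply: sure_seq d11 _ => s1 [c1 k1].
set PI := (fun a => regs_from 12 a || cnt_cell a).
have sub1 a : dec_cell a -> PI a by rewrite /PI; celllia.
have k1' : keep PI cand_cell s s1 by apply: keep_sub k1.
set PI1 := regs_from 12.
apply: sure_weaken (sure_fill (N := Defs.dim I) (PI := PI1) (PR := cand_cell)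
  (adr := fun j => (Defs.dim I + (1 + 3 * j))%N)
  (f := candidate sz k (samp s) tau) _ _ _ _ _) _ _ => //.
- by move=> i _; rewrite /cand_cell; celllia.
- by move=> i j _ _; lia.
- move=> j s' jd kk r12.
  have g4 : imem s' 4 = k by rewrite kk.1 ?k1.1.
  have g5 : imem s' 5 = sz by rewrite kk.1 ?k1.1.
  have gc i : (i < sz)%N -> imem s' (32 + 2 * i) = mult sz k tau i.
    by move=> isz; rewrite kk.1 -?c1 // /PI1; celllia.
  have gx i : imem s' (33 + 2 * i) = idxf s i.
    by rewrite kk.1 ?k1.1 // /PI1; celllia.
  apply: (sure_seq (Q1 := fun s2 => rmem s2 (Defs.dim I + 3 * 3) = 0 /\ keep (regs_from 13) (sc_from I 2) s' s2)).
    apply: sure_rstore; split => /=; first by cells.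
    by apply: keep_rupd; [celllia | exact: keep_refl].
  move=> s2 [z2 k2].
  apply: (sure_seq (sure_sum (N := sz) (PI := regs_from 13) (PR := sc_from I 2)
    (acc := (Defs.dim I + 3 * 3)%N)
    (f := fun i => (mult sz k tau i)%:R * samp s i j) _ _ _ _)).
  + by celllia.
  + by celllia.
  + by move=> s3 k3; rewrite /= k3.1 ?k2.1 // celllia.
  + move=> i s3 isz k3 r13; have k23 := keep_trans k2 k3.
    apply: sure_rstore; rewrite /= r13; split.
    * cells; rewrite !k23.1 ?gc ?gx ?r12 //; celllia.
    * by [].
    * by apply: keep_rupd => //; celllia.
  move=> s3 [a3 k3]; have k23 := keep_trans k2 k3.
  have r12' : imem s3 12 = j by rewrite k23.1.
  apply: sure_rstore; rewrite /= r12'; split.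
  + by cells; rewrite a3 z2 add0r k23.1 // g4.
  + by [].
  + move=> i _ ne; cells; rewrite k23.2 //; celllia.
  + apply: keep_rupd; first by rewrite /cand_cell; celllia.
    apply: keep_trans kk _; apply: keep_sub k23 => a; rewrite /PI1 /cand_cell; celllia.
move=> s' [e ke]; split=> //.
apply: keep_trans k1' _; apply: keep_sub ke => a //; rewrite /PI1 /PI; celllia.
Qed.

End Candidate.

(** * Drawing the sample *)

Section Sampling.
Variables (R : realType) (I : input R).
Implicit Types (s : store R) (PI PR : pred nat).
Variable (sz : nat).
Let n := npts I.
Let d := Defs.dim I.
Hypotheses (n_gt0 : (0 < n)%N) (sz_le : (sz <= n)%N).

(** A sample of size n is not drawn but taken to be the whole set, each point once; then the sample
    density is exact. *)
Definition draw_index : cmd :=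
  CIf (BILt (reg 5) INpts) (CRand (idx_at (reg 12)) INpts)
    (CIStore (idx_at (reg 12)) (reg 12)).

Definition draw_sample : cmd := CFor 12 (reg 5) draw_index.

Definition sample_cell (a : nat) : bool := regs_from 12 a || idx_cell a.

(** In the exhaustive case exactness follows from [idxf s i = i], and the value 0 records that
    nothing is to be paid. *)
Definition sample_disc s : R :=
  if (sz < n)%N then disc d n (read_point I) sz (idxf s) else 0.

Lemma triple_draw_sample s : imem s 5 = sz ->
  triple I draw_sample s (sz * 5 + 3) (fun s' =>
    [/\ forall i, (i < sz)%N -> (idxf s' i < n)%N,
       sz = n -> forall i, (i < sz)%N -> idxf s' i = i
     & keep sample_cell pred0 s s']) sample_disc sz%:R.
Proof.
move=> h5.
(* Each draw still missing is charged 1, the growth allowed by [avg_disc]. *)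
pose G i s' : R := if (sz < n)%N then
  disc d n (read_point I) i (idxf s') + (sz%:R - i%:R) else 0.
pose J i s' := [/\ imem s' 12 = i, forall l, (l < i)%N -> (idxf s' l < n)%N,
  sz = n -> forall l, (l < i)%N -> idxf s' l = l & keep sample_cell pred0 s s'].
have idx_upd s' i v l : idxf (iupd (iupd s' (33 + 2 * i) v) 12 i.+1) l =
    if l == i then v else idxf s' l.
  by rewrite /idxf /=; case: (eqVneq l i) => [->|ne]; cells.
have JS s' i v : (i < sz)%N -> J i s' -> (v < n)%N -> (sz = n -> v = i) ->
    J i.+1 (iupd (iupd s' (33 + 2 * i) v) 12 i.+1).
  move=> isz [e1 e2 e3 e4] vn vi; split.
  - by [].
  - move=> l; rewrite idx_upd ltnS leq_eqVlt; case: eqP => //= _; exact: e2.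
  - move=> e l; rewrite idx_upd ltnS leq_eqVlt; case: eqP => [-> _|_ /=]; [exact: vi|exact: e3].
  - by do 2! apply: keep_iupd => //; rewrite /sample_cell; celllia.
apply: triple_weaken (triple_for (N := sz) (t := 2) (J := J) (G := G) _ _ _) _ _ _ => //.
- by move=> i s' _ [e1 e2 e3 [e4 _]]; split => //=; rewrite e4.
- move=> i s' isz Ji; have [e1 e2 e3 [e4 _]] := Ji.
  have g5 : imem s' 5 = sz by rewrite e4.
  apply: triple_if; rewrite /= g5 -/n; case: ltnP => szn.
    apply: (triple_rand (n := n)) => //.
      move=> v vn; rewrite /= e1; split; first by cells.
      by apply: JS => // e; move: szn; rewrite e ltnn.
    rewrite /= e1 /G szn.
    have -> : sz%:R - i.+1%:R = sz%:R - i%:R - 1 :> R by rewrite -natr1; ring.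
    rewrite big_split /= sumr_const card_ord mulrDr -[(_ - _) *+ _]mulr_natl mulKf; last by rewrite pnatr_eq0 -lt0n.
    have := @avg_disc _ d n (read_point I) n_gt0 i (idxf s')
      (fun v => idxf (iupd (iupd s' (33 + 2 * i) v) 12 i.+1)).
    move=> h; apply: le_trans (lerD (h _ _) (lexx _)) _.
    + by move=> v l li; rewrite idx_upd ltn_eqF.
    + by move=> v; rewrite idx_upd eqxx.
    by lra.
  have e : sz = n by apply/eqP; rewrite eqn_leq sz_le.
  apply: triple_istore; rewrite /= e1; last by rewrite /G e ltnn.
  by split; [cells | apply: JS => //; rewrite -e].
- split=> //; exact/keep_iupd/keep_refl.
- by rewrite /G; case: ifP => // _; rewrite /disc ?big_ord0 ?add0r ?subr0 ?lexx ?ler0n.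
- move=> s' [e1 e2 e3 e4]; split=> //.
  by rewrite /G /sample_disc; case: ifP => // _; rewrite subrr addr0.
Qed.

End Sampling.

(** * The random projection and its faithfulness *)

Section Sketch.
Variables (R : realType) (I : input R).
Implicit Types (s : store R) (PI PR : pred nat).
Let d := Defs.dim I.
Variables (sz k T M : nat).
Hypotheses (sz_gt0 : (0 < sz)%N) (k_gt0 : (0 < k)%N) (T_gt0 : (0 < T)%N).
(** Chebyshev with a union bound: a squared norm N is estimated with second moment at most 2 N^2 /
    M, and the tolerance is N / (2k), so a pair fails with probability at most 8 k^2 / M. Over T sz
    pairs this totals 1/8. *)
Hypothesis M_def : M = (64 * T * sz * k * k)%N.

Let M_gt0 : (0 < M)%N.
Proof. by rewrite M_def !muln_gt0 sz_gt0 k_gt0 T_gt0. Qed.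

Definition zero_sketch : cmd :=
  CFor 12 (IMul (reg 5) (reg 7)) (CRStore (q_at (reg 12)) (ROfInt (INum 0))).

Definition bump_cell : cmd :=
  CRStore (q_at (IAdd (IMul (reg 15) (reg 7)) (reg 13)))
    (RAdd (q_cell_at (reg 15) (reg 13))
       (RMul (RSub (ROfInt (IAdd (reg 14) (reg 14))) (ROfInt (INum 1)))
          (RPoint (ILoad (idx_at (reg 15))) (reg 12)))).

(** One bucket and one sign per coordinate, shared by all sample points: the sketch is a linear map,
    so the candidate formed from sketched points is the sketch of the candidate. The draws are
    consumed at once and never stored. *)
Definition sketch_coord : cmd :=
  CSeq (CRand (INum 13) (reg 7))
  (CSeq (CRand (INum 14) (INum 2)) (CFor 15 (reg 5) bump_cell)).

Definition sketch : cmd := CSeq zero_sketch (CFor 12 IDim sketch_coord).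

Lemma sure_zero_sketch s : imem s 5 = sz -> imem s 7 = M ->
  sure I zero_sketch s (sz * M * 4 + 3) (fun s' =>
    (forall i h, (i < sz)%N -> (h < M)%N -> qf I M s' i h = 0) /\
    keep (regs_from 12) (q_cell I) s s').
Proof.
move=> h5 h7.
apply: sure_weaken (sure_fill (N := sz * M) (t := 1) (PI := regs_from 12) (PR := q_cell I)
  (adr := fun u => (d + (2 + 3 * u))%N) (f := fun=> 0) _ _ _ _ _) _ _ => //.
- by move=> u _; rewrite /d; celllia.
- by move=> u v _ _; lia.
- by move=> s' k'; rewrite /= !k'.1 // h5 h7.
- move=> u s' _ k' r12; apply: sure_rstore; rewrite /= r12 -/d; split => //.
  + by cells.
  + by move=> v _ ne; cells.
  + by apply: keep_rupd => //; rewrite /d; celllia.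
- move=> s' [z ks]; split=> // i h isz hM; apply: z; nia.
Qed.

Lemma sure_bump s j h b : imem s 5 = sz -> imem s 7 = M -> imem s 12 = j ->
  imem s 13 = h -> imem s 14 = b -> (h < M)%N ->
  sure I (CFor 15 (reg 5) bump_cell) s (sz * 4 + 3) (fun s' =>
    (forall i h', (i < sz)%N -> (h' < M)%N -> qf I M s' i h' =
       qf I M s i h' + (h' == h)%:R * (((b + b)%N%:R - 1) * samp I s i j)) /\
    keep (regs_from 15) (q_cell I) s s').
Proof.
move=> h5 h7 h12 h13 h14 hM.
pose J i0 s' := [/\ imem s' 15 = i0,
  forall i h', (i < sz)%N -> (h' < M)%N -> qf I M s' i h' =
    qf I M s i h' + ((i < i0)%N && (h' == h))%:R * (((b + b)%N%:R - 1) * samp I s i j)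
  & keep (regs_from 15) (q_cell I) s s'].
apply: sure_weaken (sure_for (N := sz) (t := 1) (J := J) _ _ _) _ _ => //.
- by move=> i0 s' _ [e1 e2 e3]; split=> //=; rewrite e3.1.
- move=> i0 s' i0sz [e1 e2 e3]; apply: sure_rstore.
  rewrite /= e1 !e3.1 // ?h7 ?h12 ?h13 ?h14; try celllia.
  rewrite -/(samp I s i0 j) -/(qf I M s' i0 h) e2 // ltnn mul0r addr0.
  split=> //; split=> //; last first.
    by apply: keep_iupd => //; apply: keep_rupd => //; celllia.
  move=> i h' isz hM'; rewrite /qf /= -/d.
  have [e|ne] := eqVneq (i * M + h')%N (i0 * M + h)%N.
    have ii : i = i0.
      have := congr1 (divn ^~ M) e; rewrite /= !divnMDl // !divn_small // !addn0 //.
    have hh : h' = h by move: e; rewrite ii; lia.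
    by rewrite ii hh !eqxx ltnSn mul1r.
  rewrite (_ : (_ == _) = false); last by apply/negP => /eqP; lia.
  rewrite -/(qf I M s' i h') e2 //; congr (_ + _%:R * _).
  case: (eqVneq h' h) => [hh|]; last by rewrite !andbF.
  rewrite !andbT [in RHS]ltnS [in RHS]leq_eqVlt; case: (eqVneq i i0) => // ii.
  by move: ne; rewrite ii hh eqxx.
- split=> //; last exact/keep_iupd/keep_refl.
  by move=> i h' _ _; rewrite ltn0 mul0r addr0.
- move=> s' [e1 e2 e3]; split=> // i h' isz hM'.
  by rewrite e2 // isz.
Qed.

Let diffv (x : nat -> nat -> R) (a : 'I_T * 'I_sz) (j : nat) : R :=
  x a.2 j - candidate sz k x a.1 j.

Lemma diffv_linear (x x' y : nat -> nat -> R) (c : R) a j h :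
  (forall i, (i < sz)%N -> x' i h = x i h + c * y i j) ->
  diffv x' a h = diffv x a h + c * diffv y a j.
Proof.
move=> e; rewrite /diffv e // /candidate.
under eq_bigr do rewrite e // mulrDr mulrCA.
by rewrite big_split /= -mulr_sumr; ring.
Qed.

Let pnorm (p : nat -> nat -> R) a (j : nat) : R := \sum_(l < j) diffv p a l ^+ 2.

Lemma avg_sum (A : finType) (w : A -> R) (X : nat -> nat -> A -> R) :
  M%:R^-1 * \sum_(h < M) (2^-1 * \sum_(b < 2) \sum_(a : A) w a * X h b a) =
  \sum_(a : A) w a * (M%:R^-1 * \sum_(h < M) (2^-1 * \sum_(b < 2) X h b a)).
Proof.
rewrite mulr_sumr; under eq_bigr do rewrite exchange_big mulrA mulr_sumr /=.
rewrite exchange_big; apply: eq_bigr => a _ /=.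
rewrite !mulr_sumr; apply: eq_bigr => h _.
by rewrite -mulr_sumr; ring.
Qed.

(** Chebyshev weight: a squared norm off by at least N / (2k) contributes at least 1. For N = 0 the
    convention for division by zero makes the weight vanish; such pairs are covered by the invariant
    that a zero vector keeps a zero sketch. *)
Let weight (p : nat -> nat -> R) a : R := (2 * k%:R) ^+ 2 / pnorm p a d ^+ 2.

Let pot p (j : nat) (q : nat -> nat -> R) : R :=
  \sum_(a : 'I_T * 'I_sz) weight p a *
    sketch_pot M (diffv q a) (pnorm p a j) (pnorm p a d - pnorm p a j).

Let bumped (p : nat -> nat -> R) j (q : nat -> nat -> R) (h b : nat) (i h' : nat) : R :=
  q i h' + (h' == h)%:R * (((b + b)%N%:R - 1) * p i j).

Lemma pot_step p j q :
  M%:R^-1 * \sum_(h < M) (2^-1 * \sum_(b < 2) pot p j.+1 (bumped p j q h b)) <=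
  pot p j q.
Proof.
rewrite /pot (avg_sum (weight p) (fun h b a => sketch_pot M
  (diffv (bumped p j q h b) a) (pnorm p a j.+1) (pnorm p a d - pnorm p a j.+1))).
apply: ler_sum => a _; apply: ler_wpM2l.
  by rewrite divr_ge0 ?sqr_ge0.
have -> : pnorm p a j.+1 = pnorm p a j + diffv p a j ^+ 2.
  by rewrite /pnorm big_ord_recr.
rewrite opprD addrA; apply: (@sketch_pot_step _ M M_gt0 (diffv q a) _ _ (diffv p a j)
  (fun h b => diffv (bumped p j q h b) a)) => h b h' _.
rewrite (@diffv_linear q (bumped p j q h b) p ((h' == h)%:R * ((b + b)%N%:R - 1)) a j h').
  by rewrite -mulrA.
by move=> i _; rewrite /bumped mulrA.
Qed.

Lemma eq_pot p j q q' :
  (forall i h, (i < sz)%N -> (h < M)%N -> q i h = q' i h) -> pot p j q = pot p j q'.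
Proof.
move=> e; apply: eq_bigr => a _; congr (_ * _).
suff S : sqn M (diffv q a) = sqn M (diffv q' a) by rewrite /sketch_pot S.
apply: eq_bigr => h _; congr (_ ^+ 2); rewrite /diffv e //; congr (_ - _ / _).
by apply: eq_bigr => i _; rewrite e.
Qed.

Definition faithful_sketch s : Prop := forall t i, (t < T)%N -> (i < sz)%N ->
  `|sqd M (qf I M s i) (candidate sz k (qf I M s) t)
    - sqd d (samp I s i) (candidate sz k (samp I s) t)| <=
  (2 * k%:R)^-1 * sqd d (samp I s i) (candidate sz k (samp I s) t).

Let k2 : 0 < 2 * k%:R :> R.
Proof. by rewrite mulr_gt0 // ltr0n. Qed.

Lemma pot0 p q : (forall i h, (i < sz)%N -> (h < M)%N -> q i h = 0) ->
  pot p 0 q <= 8^-1.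
Proof.
move=> q0.
rewrite (@eq_pot p 0 q (fun _ _ => 0)) //.
have E a : weight p a * sketch_pot M (diffv (fun _ _ => 0) a) (pnorm p a 0)
    (pnorm p a d - pnorm p a 0) <= (8 * k%:R ^+ 2) / M%:R.
  have -> : pnorm p a 0 = 0 by rewrite /pnorm big_ord0.
  have z h : diffv (fun _ _ => 0) a h = 0.
    rewrite /diffv /candidate big1 => [|i _]; last by rewrite mulr0.
    by rewrite mul0r subr0.
  have -> : sketch_pot M (diffv (fun _ _ => 0) a) 0 (pnorm p a d - 0) =
      2 / M%:R * pnorm p a d ^+ 2.
    rewrite /sketch_pot /sqn big1 => [|h _]; last by rewrite z expr0n.
    by rewrite !subr0 expr0n /=; ring.
  rewrite /weight; have [->|n0] := eqVneq (pnorm p a d) 0.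
    by rewrite expr0n /= mulr0 mulr0 divr_ge0 // mulr_ge0 // sqr_ge0.
  rewrite le_eqVlt; apply/orP; left; apply/eqP; field.
  by rewrite pnatr_eq0 -lt0n M_gt0 n0.
apply: le_trans (ler_sum _ (fun a _ => E a)) _.
rewrite sumr_const card_prod !card_ord -[_ *+ _]mulr_natl natrM M_def !natrM.
rewrite le_eqVlt; apply/orP; left; apply/eqP; field.
by rewrite !pnatr_eq0 -!lt0n sz_gt0 k_gt0 T_gt0.
Qed.

(** Once all coordinates are processed, the potential of a pair is its weight times the squared
    error; all terms are nonnegative and a violated pair alone contributes 1. *)
Lemma unfaithful_le_pot s :
  (forall a, pnorm (samp I s) a d = 0 -> forall h, (h < M)%N -> diffv (qf I M s) a h = 0) ->
  (`[< ~ faithful_sketch s >])%:R <= pot (samp I s) d (qf I M s).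
Proof.
move=> null; set p := samp I s; set q := qf I M s.
have term_ge0 a : 0 <= weight p a *
    sketch_pot M (diffv q a) (pnorm p a d) (pnorm p a d - pnorm p a d).
  rewrite mulr_ge0 ?divr_ge0 ?sqr_ge0 // /sketch_pot subrr mulr0 mulr0 expr0n mulr0 !addr0.
  exact: sqr_ge0.
case: asboolP => [nf|_]; last by apply: sumr_ge0 => a _.
have [t [i [tT [isz lt]]]] : exists t i, (t < T)%N /\ (i < sz)%N /\
    (2 * k%:R)^-1 * sqd d (p i) (candidate sz k p t) <
    `|sqd M (q i) (candidate sz k q t) - sqd d (p i) (candidate sz k p t)|.
  apply: contrapT => h; apply: nf => t i tT isz; rewrite leNgt; apply/negP => lt.
  by apply: h; exists t, i.
pose a : 'I_T * 'I_sz := (Ordinal tT, Ordinal isz).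
rewrite /pot (bigD1 a) //= -[leLHS]addr0; apply: lerD; last exact: sumr_ge0.
rewrite /weight /sketch_pot subrr mulr0 mulr0 expr0n mulr0 !addr0.
move: lt; rewrite -[sqd d _ _]/(pnorm p a d) -[sqd M _ _]/(sqn M (diffv q a)) => lt.
have N0 : 0 <= pnorm p a d by exact: sqd_ge0.
have Npos : 0 < pnorm p a d.
  rewrite lt_def N0 andbT; apply/eqP => z; move: lt; rewrite z mulr0 subr0.
  rewrite /sqn big1 ?normr0 ?ltxx // => h _; rewrite null // expr0n //.
set X := sqn _ _ - _ in lt *.
have : 1 <= 2 * k%:R * `|X| / pnorm p a d.
  by rewrite ler_pdivlMr // mul1r -ler_pdivrMl // ltW.
move=> /(exprn_ege1 2); congr (_ <= _).
by rewrite -[X ^+ 2]real_normK ?num_real // !exprMn exprVn; ring.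
Qed.

Lemma triple_sketch_coord s j : imem s 5 = sz -> imem s 7 = M -> imem s 12 = j ->
  triple I sketch_coord s (sz * 4 + 7) (fun s' =>
    (exists h b, forall i h', (i < sz)%N -> (h' < M)%N ->
      qf I M s' i h' = bumped (samp I s) j (qf I M s) h b i h') /\
    keep (regs_from 13) (q_cell I) s s')
   (fun s' => pot (samp I s) j.+1 (qf I M s'))
   (pot (samp I s) j (qf I M s)).
Proof.
move=> h5 h7 h12; set p := samp I s; set q := qf I M s.
pose g h b := pot p j.+1 (bumped p j q h b).
apply: (@triple_time _ _ (1 + (1 + (sz * 4 + 3)).+1).+1); first lia.
apply: (triple_seq (Q1 := fun s1 => exists2 h, (h < M)%N & s1 = iupd s 13 h)
  (g1 := fun s1 => 2^-1 * \sum_(b < 2) g (imem s1 13) b)).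
  apply: (triple_rand (n := M)) => //; first by move=> h hM; exists h.
  by rewrite /=; exact: pot_step.
move=> _ [h hM ->].
apply: (triple_seq (Q1 := fun s1 => exists b, s1 = iupd (iupd s 13 h) 14 b)
  (g1 := fun s1 => g h (imem s1 14))).
  by apply: (triple_rand (n := 2)) => //= b _; exists b.
move=> _ [b ->]; set s1 := iupd _ 14 b.
have b15 := @sure_bump s1 j h b h5 h7 h12 erefl erefl hM.
have ps1 i : samp I s1 i j = p i j.
  by rewrite /p /samp /idxf /=; cells.
have Q s' : (forall i h', (i < sz)%N -> (h' < M)%N -> qf I M s' i h' =
    qf I M s1 i h' + (h' == h)%:R * (((b + b)%N%:R - 1) * samp I s1 i j)) ->
    forall i h', (i < sz)%N -> (h' < M)%N -> qf I M s' i h' = bumped p j q h b i h'.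
  by move=> e i h' isz hM'; rewrite e // ps1.
apply: triple_weaken (b15 (g h b)) _ _ _ => // s' [/Q e ks]; split.
  split; first by exists h, b.
  apply: (@keep_trans _ _ _ _ s1); first by do 2! apply: keep_iupd => //.
  by apply: keep_sub ks => a //; celllia.
by rewrite /g (eq_pot p j.+1 e).
Qed.

Definition sketch_time := (sz * M * 4 + d * (sz * 4 + 10) + 10)%N.

Lemma triple_sketch s : imem s 5 = sz -> imem s 7 = M ->
  triple I sketch s sketch_time (fun s' => keep (regs_from 12) (q_cell I) s s')
    (fun s' => (`[< ~ faithful_sketch s' >])%:R) 8^-1.
Proof.
move=> h5 h7; set p := samp I s.
apply: (@triple_time _ _ ((sz * M * 4 + 3) + (d * ((sz * 4 + 7) + 3) + 3)).+1).
  by rewrite /sketch_time; lia.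
have zs := sure_zero_sketch h5 h7.
apply: (triple_seq (zs 8^-1)) => s1 [z1 k1].
have samp_keep s' : keep (regs_from 12) (q_cell I) s s' -> samp I s' = p.
  move=> [k' _]; apply/funext => i; rewrite /p /samp /idxf k' //; celllia.
pose J j s' := [/\ imem s' 12 = j, keep (regs_from 12) (q_cell I) s s' &
  forall a, pnorm p a d = 0 -> forall h, (h < M)%N -> diffv (qf I M s') a h = 0].
apply: triple_weaken (triple_for (N := d) (t := sz * 4 + 7) (J := J)
  (G := fun j s' => pot p j (qf I M s')) _ _ _) _ _ _ => //.
- by move=> j s' _ [e1 e2 e3].
- move=> j s' jd [e1 e2 e3].
  have g5 : imem s' 5 = sz by rewrite e2.1.
  have g7 : imem s' 7 = M by rewrite e2.1.
  have := triple_sketch_coord g5 g7 e1; rewrite (samp_keep _ e2) => hs.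
  apply: triple_weaken hs _ _ _ => // s3 [[h [b e]] k3]; split=> //.
  split; first by rewrite k3.1.
  split=> //.
    apply: keep_iupd => //; apply: keep_trans e2 _.
    by apply: keep_sub k3 => a //; celllia.
  move=> a N0 h' hM; rewrite -[qf _ _ _]/(qf I M s3).
  rewrite (@diffv_linear (qf I M s') (qf I M s3) p ((h' == h)%:R * ((b + b)%N%:R - 1)) a j h').
    rewrite e3 // add0r.
    have -> : diffv p a j = 0; last by rewrite mulr0.
    move/eqP: N0; rewrite psumr_eq0; last by move=> l _; exact: sqr_ge0.
    move=> /allP /(_ (Ordinal jd) (mem_index_enum _)) /=.
    by rewrite sqrf_eq0 => /eqP.
  by move=> i isz; rewrite e // /bumped mulrA.
- split=> //; first exact: keep_iupd.
  move=> a _ h hM; rewrite -[qf _ _ _]/(qf I M s1) /diffv z1 // /candidate big1.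
    by rewrite mul0r subr0.
  by move=> i _; rewrite z1 // mulr0.
- by apply: pot0 => i h isz hM; exact: z1.
- move=> s' [e1 e2 e3]; split=> //; have es := samp_keep _ e2.
  by rewrite -es; apply: unfaithful_le_pot; rewrite es.
Qed.

End Sketch.

(** * Estimating the density of a fixed point from fresh draws *)

Section Verify.
Variables (R : realType) (I : input R).
Implicit Types (s : store R) (PI PR : pred nat).
Let d := Defs.dim I.
Let n := npts I.
Variable m : nat.
Hypotheses (n_gt0 : (0 < n)%N) (m_gt0 : (0 < m)%N) (m_le : (m <= n)%N).

Definition verify_coord : cmd :=
  CSeq (CRStore (sc_at 4) (RSub (RPoint (reg 13) (reg 14)) (RLoad (y_at (reg 14)))))
    (CRStore (sc_at 3) (RAdd (sc 3) (RMul (sc 4) (sc 4)))).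

Definition verify_add : cmd :=
  CSeq (CRStore (sc_at 3) (ROfInt (INum 0)))
  (CSeq (CFor 14 IDim verify_coord)
    (CRStore (sc_at 2) (RAdd (sc 2) (RExp (RSub (ROfInt (INum 0)) (sc 3)))))).

Definition verify_draw : cmd :=
  CIf (BILt (reg 8) INpts) (CRand (INum 13) INpts) (CIStore (INum 13) (reg 12)).

Definition verify : cmd :=
  CSeq (CRStore (sc_at 2) (ROfInt (INum 0)))
  (CSeq (CFor 12 (reg 8) (CSeq verify_draw verify_add))
    (CRStore (sc_at 2) (RDiv (sc 2) (ROfInt (reg 8))))).

Lemma sure_verify_add s v : imem s 13 = v ->
  sure I verify_add s (d * 6 + 7) (fun s' =>
    scv I s' 2 = scv I s 2 + gker d (read_point I v) (yf I s) /\
    keep (regs_from 14) (sc_from I 2) s s').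
Proof.
move=> h13; apply: (@sure_time _ _ (1 + ((d * (3 + 3) + 3) + 1).+1).+1); first lia.
apply: (sure_seq (Q1 := fun s1 => rmem s1 (d + 3 * 3) = 0 /\ keep (regs_from 14) (sc_from I 3) s s1)).
  apply: sure_rstore; split => /=; first by rewrite -/d; cells.
  by apply: keep_rupd; [rewrite /d; celllia | exact: keep_refl].
move=> s1 [z1 k1].
apply: (sure_seq (sure_sum (N := d) (PI := regs_from 14) (PR := sc_from I 3)
  (acc := (d + 3 * 3)%N)
  (f := fun j => (read_point I v j - yf I s j) ^+ 2) _ _ _ _)).
- by celllia.
- by rewrite /d; celllia.
- by [].
- move=> j s' jd k' r14; have kk := keep_trans k1 k'.
  have ey : rmem s' (d + (1 + 3 * j)) = yf I s j.
    by rewrite kk.2 // /d; celllia.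
  apply: (sure_straight (c := CSeq _ _)) => //=; rewrite -/d r14 ey kk.1 // h13.
  split=> //; first by cells; rewrite expr2.
  by do 2 (apply: keep_rupd; first by rewrite /d; celllia).
move=> s2 [a2 k2]; have kk := keep_trans k1 k2.
apply: sure_rstore; rewrite /= -/d; split => /=.
  rewrite /scv /= -/d; cells; rewrite a2 z1 !add0r kk.2 //.
  by rewrite /d; celllia.
apply: keep_rupd; first by rewrite /d; celllia.
by apply: keep_sub kk => a //; celllia.
Qed.

Variable y : nat -> R.
Let f (v : nat) : R := gker d (read_point I v) y.
Let mu : R := kde d n (read_point I) y.

Let yf_keep s s' : keep (regs_from 12) (sc_from I 2) s s' -> yf I s' = yf I s.
Proof.
by move=> [_ h]; apply/funext => j; rewrite /yf h // /d; celllia.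
Qed.

Lemma sure_verify_exact s : m = n -> imem s 8 = m -> yf I s = y -> scv I s 2 = 0 ->
  sure I (CFor 12 (reg 8) (CSeq verify_draw verify_add)) s (m * (d * 6 + 13) + 3)
    (fun s' => scv I s' 2 = m%:R * mu /\ keep (regs_from 12) (sc_from I 2) s s').
Proof.
move=> mn h8 ys z.
apply: sure_weaken (sure_sum (N := m) (t := d * 6 + 10) (PI := regs_from 12)
  (PR := sc_from I 2) (acc := (d + 3 * 2)%N) (f := f) _ _ _ _) _ _ => //.
- by rewrite /d; celllia.
- by move=> s' k'; rewrite /= k'.1.
- move=> v s' vm k' r12.
  apply: (@sure_time _ _ (2 + (d * 6 + 7)).+1); first lia.
  apply: (sure_seq (Q1 := fun s1 => s1 = iupd s' 13 v)).
    by apply: sure_if; rewrite /= k'.1 // h8 mn ltnn; apply: sure_istore; rewrite /= r12.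
  move=> _ ->; apply: sure_weaken (@sure_verify_add (iupd s' 13 v) v erefl) _ _ => //.
  move=> s2 [e2 k2]; split.
  + by rewrite -[rmem s2 _]/(scv I s2 2) e2 -[yf I _]/(yf I s') (yf_keep k') ys.
  + by rewrite k2.1.
  + apply: (@keep_trans _ _ _ _ (iupd s' 13 v)); first exact: keep_iupd.
    by apply: keep_sub k2 => a //; celllia.
- by lia.
- move=> s' [e k']; split=> //; rewrite /scv -/d e -/(scv I s 2) z add0r.
  by rewrite mn /mu /kde /smean mulVKf // pnatr_eq0 -lt0n.
Qed.

Variable tol : R.
Hypotheses (tol_gt0 : 0 < tol) (tol_le : tol <= 3^-1 * 2).
(** The minimizer of m (lam^2 - lam tol), with minimum -m tol^2 / 4; the bound on [tol] gives lam <=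
    1/3, as [mgf_step] requires. *)
Let lam := tol / 2.

(** The exponential supermartingale of the partial sum S after i draws: each remaining draw is
    charged lam^2 in the exponent. It is used with both signs of [lam]. *)
Let tail (l : R) (i : nat) (S : R) : R :=
  expR (l * (S - i%:R * mu) + (m%:R - i%:R) * lam ^+ 2).

Let pot i S : R := expR (- (lam * (m%:R * tol))) * (tail lam i S + tail (- lam) i S).

Lemma tail_step l i S : l ^+ 2 = lam ^+ 2 ->
  n%:R^-1 * \sum_(v < n) tail l i.+1 (S + f v) <= tail l i S.
Proof.
move=> l2.
have lamb : - 3^-1 <= l <= 3^-1.
  rewrite -ler_norml -ler_sqr ?nnegrE ?invr_ge0 // real_normK ?num_real // l2.
  by rewrite ler_sqr ?nnegrE ?invr_ge0 // ?divr_ge0 ?(ltW tol_gt0) // ler_pdivrMr.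
have f01 v : 0 <= f v <= 1 by rewrite gker_le1 ltW ?gker_gt0.
have E (v : 'I_n) : tail l i.+1 (S + f v) =
    expR (l * (S - i%:R * mu) + (m%:R - i%:R) * lam ^+ 2 - l ^+ 2) * expR (l * (f v - mu)).
  by rewrite -expRD /tail l2 -natr1; congr expR; ring.
under eq_bigr do rewrite E.
rewrite -mulr_sumr mulrCA.
apply: le_trans (ler_wpM2l (expR_ge0 _) (mgf_step n_gt0 f01 (erefl mu) lamb)) _.
by rewrite -expRD subrK.
Qed.

Lemma pot_verify_step i S :
  n%:R^-1 * \sum_(v < n) pot i.+1 (S + f v) <= pot i S.
Proof.
rewrite /pot -mulr_sumr mulrCA; apply: ler_wpM2l; first exact: expR_ge0.
by rewrite big_split mulrDr lerD // tail_step // sqrrN.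
Qed.

Lemma triple_verify_random s : (m < n)%N -> imem s 8 = m -> yf I s = y -> scv I s 2 = 0 ->
  triple I (CFor 12 (reg 8) (CSeq verify_draw verify_add)) s (m * (d * 6 + 13) + 3)
    (fun s' => keep (regs_from 12) (sc_from I 2) s s')
    (fun s' => pot m (scv I s' 2)) (pot 0 0).
Proof.
move=> mn h8 ys z.
pose J i s' := imem s' 12 = i /\ keep (regs_from 12) (sc_from I 2) s s'.
apply: triple_weaken (triple_for (N := m) (t := d * 6 + 10) (J := J)
  (G := fun i s' => pot i (scv I s' 2)) _ _ _) _ _ _ => //.
- by move=> i s' _ [e1 e2]; split=> //=; rewrite e2.1.
- move=> i s' im [e1 e2].
  apply: (@triple_time _ _ (2 + (d * 6 + 7)).+1); first lia.
  apply: (triple_seq (Q1 := fun s1 => exists v, s1 = iupd s' 13 v)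
    (g1 := fun s1 => pot i.+1 (scv I s' 2 + f (imem s1 13)))).
    apply: triple_if; rewrite /= e2.1 // h8 -/n mn.
    apply: (triple_rand (n := n)) => //; first by move=> v _; exists v.
    exact: pot_verify_step.
  move=> _ [v ->].
  have va := @sure_verify_add (iupd s' 13 v) v erefl.
  apply: triple_weaken (va (pot i.+1 (scv I s' 2 + f v))) _ _ _ => // s2 [q2 k2].
  split; first split.
  + by rewrite k2.1.
  + split=> //; apply: keep_iupd => //.
    apply: (@keep_trans _ _ _ _ (iupd s' 13 v)); first exact: keep_iupd.
    by apply: keep_sub k2 => a //; celllia.
  + change (pot i.+1 (scv I s2 2) <= pot i.+1 (scv I s' 2 + f v)).
    rewrite q2 -[yf I _]/(yf I s') (yf_keep e2) ys; exact: lexx.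
- split=> //; exact: keep_iupd.
- by lia.
- by rewrite -[scv I _ 2]/(scv I s 2) z.
- by move=> s' [].
Qed.

Lemma pot_start : pot 0 0 = 2 * expR (- (m%:R * tol ^+ 2 / 4)).
Proof.
rewrite /pot /tail !mul0r !subr0 !mulr0 !add0r -[X in _ * X]mulr2n.
rewrite -[X in _ * X]mulr_natl mulrCA -expRD.
by congr (_ * expR _); rewrite /lam; field.
Qed.

Lemma deviation_le_pot (S : R) : m%:R * tol < `|S - m%:R * mu| -> 1 <= pot m S.
Proof.
rewrite /pot /tail subrr mul0r !addr0 mulrDr -!expRD.
have l0 : 0 < lam by rewrite divr_gt0.
have e1 x : 0 <= x -> 1 <= expR x by move=> x0; rewrite -expR0 ler_expR.
rewrite ltr_normr => /orP[h|h].
  rewrite -[leLHS]addr0 lerD ?expR_ge0 // e1 // addrC subr_ge0 ler_pM2l //; exact: ltW.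
rewrite -[leLHS]add0r lerD ?expR_ge0 // e1 // addrC mulNr -mulrN subr_ge0 ler_pM2l //.
exact: ltW.
Qed.

Definition verify_time := (m * (d * 6 + 13) + 10)%N.

Lemma triple_verify s : imem s 8 = m -> yf I s = y ->
  triple I verify s verify_time (fun s' => keep (regs_from 12) (sc_from I 2) s s')
    (fun s' => (tol < `|scv I s' 2 - mu|)%R%:R) (if (m < n)%N then 2 * expR (- (m%:R * tol ^+ 2 / 4)) else 0).
Proof.
move=> h8 ys; set b := if _ then _ else _; have m0 : 0 < m%:R :> R by rewrite ltr0n.
apply: (@triple_time _ _ (1 + ((m * (d * 6 + 13) + 3) + 1).+1).+1).
  by rewrite /verify_time; lia.
apply: (triple_seq (Q1 := fun s1 => scv I s1 2 = 0 /\ keep (regs_from 12) (sc_from I 2) s s1)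
  (g1 := fun=> b)).
  apply: triple_rstore => //; split; first by rewrite /scv /= -/d; cells.
  by apply: keep_rupd; [rewrite /d; celllia | exact: keep_refl].
move=> s1 [z1 k1].
have g8 : imem s1 8 = m by rewrite k1.1.
have y1 : yf I s1 = y by rewrite (yf_keep k1).
have fin (B : R) s2 : keep (regs_from 12) (sc_from I 2) s1 s2 ->
    (m%:R * tol < `|scv I s2 2 - m%:R * mu|)%R%:R <= B ->
    triple I (CRStore (sc_at 2) (RDiv (sc 2) (ROfInt (reg 8)))) s2 1
     (fun s' => keep (regs_from 12) (sc_from I 2) s s')
     (fun s' => (tol < `|scv I s' 2 - mu|)%R%:R) B.
  move=> k2 hB; have kk := keep_trans k1 k2.
  apply: triple_rstore; first by apply: keep_rupd => //; rewrite /d; celllia.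
  apply: le_trans hB; rewrite /scv /= -/d eqxx kk.1 // h8 -/(scv I s2 2).
  rewrite -(ltr_pM2l m0) -[X in _ < X * _](ger0_norm (ltW m0)) -normrM mulrBr.
  by rewrite [m%:R * (_ / _)]mulrC divfK ?gt_eqF.
case: (ltnP m n) => mn.
  apply: (triple_seq (triple_weaken (triple_verify_random mn g8 y1 z1) (leqnn _) _ (fun s' q => conj q (lexx _)))).
    by rewrite pot_start /b mn.
  move=> s2 k2; apply: fin => //; case: ltP => [|_]; first exact: deviation_le_pot.
  by rewrite mulr_ge0 ?expR_ge0 // addr_ge0 // expR_ge0.
have e : m = n by apply/eqP; rewrite eqn_leq m_le.
have ex := sure_verify_exact e g8 y1 z1.
apply: (triple_seq (ex b)) => s2 [e2 k2]; apply: fin => //.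
have mt0 : 0 <= m%:R * tol by rewrite mulr_ge0 // ltW.
by rewrite e2 subrr normr0 ltNge mt0 /b e ltnn.
Qed.

End Verify.

Section KeepBest.
Variables (R : realType) (I : input R).
Implicit Types (s : store R).
Let d := Defs.dim I.

Definition keep_best : cmd :=
  CIf (BRLt (sc 0) (sc 2))
    (CSeq (CRStore (sc_at 0) (sc 2))
       (CFor 12 IDim (CRStore (reg 12) (RLoad (y_at (reg 12)))))) CSkip.

Definition best_cell (a : nat) : bool := sc_from I 0 a || out_cell I a.

Lemma sure_keep_best s :
  sure I keep_best s (d * 4 + 6) (fun s' =>
    keep (regs_from 12) best_cell s s' /\
    if scv I s 0 < scv I s 2
    then scv I s' 0 = scv I s 2 /\ forall j, (j < d)%N -> rmem s' j = yf I s j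
    else scv I s' 0 = scv I s 0 /\ forall j, (j < d)%N -> rmem s' j = rmem s j).
Proof.
apply: (@sure_time _ _ ((1 + (d * (1 + 3) + 3)).+1).+1); first lia.
apply: sure_if; rewrite /= -/d -/(scv I s 0) -/(scv I s 2); case: ifP => lt; last first.
  move=> b; apply: (@triple_time _ _ 1); first lia.
  by apply: triple_skip.
apply: (sure_seq (Q1 := fun s1 => s1 = rupd s (d + 3 * 0) (scv I s 2))).
  by apply: sure_rstore.
move=> _ ->; set s1 := rupd _ _ _.
apply: sure_weaken (sure_fill (N := d) (t := 1) (PI := regs_from 12) (PR := out_cell I)
  (adr := id) (f := yf I s) (s := s1) _ _ _ _ _) _ _ => //.
- move=> j s' jd k' r12; apply: sure_rstore; rewrite /= r12 -/d; split=> //.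
  + rewrite eqxx k'.2; last by rewrite /out_cell -/d; lia.
    by rewrite /s1 /=; cells.
  + by move=> i _ ne; rewrite (negbTE ne).
  + exact: keep_rupd.
- move=> s' [e k']; split; last split=> //.
    apply: (@keep_trans _ _ _ _ s1).
      by apply: keep_rupd => //; rewrite /best_cell /d; celllia.
    by apply: keep_sub k' => a // h; rewrite /best_cell h orbT.
  rewrite /scv -/d k'.2; last by rewrite /out_cell -/d; lia.
  by rewrite /s1 /= eqxx.
Qed.

End KeepBest.

(** * One attempt: sample, sketch, search, candidate *)

Section Find.
Variables (R : realType) (I : input R).
Implicit Types (s : store R).
Variables (sz k T M : nat) (poor : (nat -> R) -> Prop).
Hypotheses (n_gt0 : (0 < npts I)%N) (sz_gt0 : (0 < sz)%N) (k_gt0 : (0 < k)%N).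
Hypotheses (T_gt0 : (0 < T)%N) (sz_le : (sz <= npts I)%N).
Hypothesis M_def : M = (64 * T * sz * k * k)%N.
Hypothesis faithful_good : forall s tau (y : nat -> R),
  (forall i, (i < sz)%N -> (idxf s i < npts I)%N) ->
  (sz = npts I -> forall i, (i < sz)%N -> idxf s i = i) ->
  sample_disc I sz s <= 8 * sz%:R -> faithful_sketch I sz k T M s ->
  (tau < T)%N ->
  (forall t, (t < T)%N -> sketch_score I sz k M s t <= sketch_score I sz k M s tau) ->
  (forall j, (j < Defs.dim I)%N -> y j = candidate sz k (samp I s) tau j) ->
  ~ poor y.

Definition find : cmd :=
  CSeq draw_sample (CSeq sketch (CSeq search_best make_cand)).

Definition search_make_time : nat :=
  search_time sz k T M + (decode_time sz k T + Defs.dim I * (4 * sz + 13) + 10) + 1.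

Definition find_time : nat :=
  (sz * 5 + 3) + (sketch_time I sz M + search_make_time) + 5.

Definition find_icell (x : nat) : bool := (11 <= x)%N.
Definition find_rcell (x : nat) : bool := [|| sc_from I 1 x, y_cell I x | q_cell I x].

(** The failure probability 1/4 consists of 1/8 for a discrepancy above 8 sz, by Markov's
    inequality, and 1/8 for an unfaithful sketch. *)
Lemma triple_find s :
  [/\ imem s 4 = k, imem s 5 = sz, imem s 6 = T & imem s 7 = M] ->
  triple I find s find_time (fun s' => keep find_icell find_rcell s s')
    (fun s' => (`[< poor (yf I s') >])%:R) 4^-1.
Proof.
move=> [h4 h5 h6 h7].
have s0 : 0 < sz%:R :> R by rewrite ltr0n.
have al0 : 0 < (8 * sz%:R)^-1 :> R by rewrite invr_gt0 mulr_gt0.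
apply: (@triple_time _ _ ((sz * 5 + 3) + (sketch_time I sz M + search_make_time).+1).+1).
  by rewrite /find_time; lia.
have ds := triple_affine (be := 8^-1) al0 (triple_draw_sample n_gt0 sz_le h5).
have b1 : (8 * sz%:R)^-1 * sz%:R + 8^-1 <= 4^-1 :> R.
  rewrite le_eqVlt; apply/orP; left; apply/eqP; field.
  by rewrite gt_eqF.
apply: triple_seq (triple_weaken ds (leqnn _) b1 (fun s' q => conj q (lexx _))) _.
move=> s1 [idx_lt idx_id k1].
have g5 : imem s1 5 = sz by rewrite k1.1.
have g7 : imem s1 7 = M by rewrite k1.1.
(* The realized discrepancy, scaled to be at least 1 in its bad event, is carried through the sketch
   as an additive constant. *)
set D := _ * sample_disc I sz s1.
have sk := triple_affine (be := D) ltr01 (triple_sketch (I := I) sz_gt0 k_gt0 T_gt0 M_def g5 g7).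
have b2 : 1 * 8^-1 + D <= D + 8^-1 by rewrite mul1r addrC.
apply: triple_seq (triple_weaken sk (leqnn _) b2 (fun s' q => conj q (lexx _))) _.
move=> s2 k2; rewrite mul1r.
have idx2 : idxf s2 = idxf s1.
  by apply/funext => i; rewrite /idxf k2.1 //; celllia.
have disc2 : sample_disc I sz s2 = sample_disc I sz s1 by rewrite /sample_disc idx2.
have g r : (r < 12)%N -> imem s2 r = imem s r.
  move=> r12; rewrite k2.1; last by celllia.
  by rewrite k1.1 // /sample_cell; celllia.
have zs2 : [/\ imem s2 4 = k, imem s2 5 = sz, imem s2 6 = T & imem s2 7 = M].
  by rewrite !g.
set b := _ + D.
have sb := sure_search_best (I := I) sz_gt0 k_gt0 T_gt0 zs2.
apply: (@triple_time _ _ (search_time sz k T M +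
  (decode_time sz k T + Defs.dim I * (4 * sz + 13) + 10)).+1).
  by rewrite /search_make_time; lia.
apply: (triple_seq (sb b)) => s3 [r11 best k3].
have g3 r : (r < 11)%N -> imem s3 r = imem s r.
  move=> lt; rewrite k3.1 ?g //; last by rewrite /search_cell; celllia.
  by apply: ltn_trans lt _.
have zs3 : [/\ imem s3 4 = k, imem s3 5 = sz, imem s3 6 = T & imem s3 7 = M].
  by rewrite !g3.
have mc := sure_make_cand (I := I) sz_gt0 k_gt0 T_gt0 zs3 (erefl _) r11.
have idx3 : idxf s3 = idxf s2.
  by apply/funext => i; rewrite /idxf k3.1 // /search_cell; celllia.
have samp3 : samp I s3 = samp I s2 by rewrite /samp idx3.
apply: triple_weaken (mc b) _ _ _ => // s4 [yE k4]; split.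
  split=> x hx.
    rewrite k4.1; last by move: hx; rewrite /find_icell; celllia.
    rewrite k3.1; last by move: hx; rewrite /find_icell /search_cell; celllia.
    rewrite k2.1; last by move: hx; rewrite /find_icell; celllia.
    by rewrite k1.1 //; move: hx; rewrite /find_icell /sample_cell; celllia.
  rewrite k4.2; last by move: hx; rewrite /find_rcell /cand_cell; celllia.
  rewrite k3.2; last by move: hx; rewrite /find_rcell; celllia.
  rewrite k2.2; last by move: hx; rewrite /find_rcell; celllia.
  by rewrite k1.2.
have disc0 : 0 <= sample_disc I sz s1.
  by rewrite /sample_disc; case: ifP => // _; exact: disc_ge0.
have D0 : 0 <= D by rewrite mulr_ge0 // ltW.
rewrite /b; case: (asboolP (~ faithful_sketch I sz k T M s2)) => [uf|/contrapT ff].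
  apply: (@le_trans _ _ 1); first by rewrite lern1 leq_b1.
  by rewrite lerDl.
rewrite add0r; case: (lerP (sample_disc I sz s1) (8 * sz%:R)) => hd; last first.
  apply: (@le_trans _ _ 1); first by rewrite lern1 leq_b1.
  by rewrite /D ler_pdivlMl ?mulr_gt0 // mulr1 ltW.
case: asboolP => // np; exfalso; move: np; apply: (faithful_good (s := s2) (tau := imem s3 11)) => //.
- by rewrite idx2.
- by rewrite idx2.
- by rewrite disc2.
- by move=> j jd; rewrite yE // samp3.
Qed.

End Find.

Lemma regs_from12 x : (x < 11)%N -> ~~ regs_from 12 x.
Proof. by celllia. Qed.

Lemma find_verify_frame (R : realType) (I : input R) (s s1 s2 : store R) :
  keep find_icell (find_rcell I) s s1 -> keep (regs_from 12) (sc_from I 2) s1 s2 ->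
  [/\ forall x, (x < 11)%N -> imem s2 x = imem s x,
      forall j, (j < Defs.dim I)%N -> rmem s2 j = rmem s j,
      scv I s2 0 = scv I s 0 & yf I s2 = yf I s1].
Proof.
move=> k1 k2; split.
- by move=> x x11; rewrite k2.1 ?regs_from12 // k1.1 // /find_icell -ltnNge.
- move=> j jd; rewrite k2.2; last by celllia.
  by rewrite k1.2 //; rewrite /find_rcell; celllia.
- rewrite /scv k2.2; last by celllia.
  by rewrite k1.2 // /find_rcell; celllia.
- by apply/funext => j; rewrite /yf k2.2 //; celllia.
Qed.

(** * A full round and the potential across rounds *)

Section Round.
Variables (R : realType) (I : input R).
Implicit Types (s : store R) (PI PR : pred nat).
Let d := Defs.dim I.
Let n := npts I.
Let pts := read_point I.
Let eps := epsilon I.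
Let rho := Defs.rho I.
Variables (E A a rr : nat).
Hypotheses (n_gt0 : (0 < n)%N) (d_gt0 : (0 < d)%N).
Hypotheses (eps01 : 0 < eps < 1) (rho01 : 0 < rho <= 1).
Hypotheses (hE : 1 <= E%:R * eps) (hA : 1 <= A%:R * (eps * rho))
  (ha : 1 <= 2 ^+ a * rho).

Definition tuple_size : nat := 64 * E * a.+1.
(** A discrepancy of 8 sz gives a squared uniform error of 8 / sz; for this to be at most (eps rho /
    16)^2 one needs sz >= 2048 / (eps rho)^2, and 2048 = 64 * 32. *)
Definition sample_size : nat := minn (64 * 32 * A * A) n.
Definition tuple_count : nat := sample_size ^ tuple_size.
Definition bucket_count : nat :=
  64 * tuple_count * sample_size * tuple_size * tuple_size.
(** With tolerance eps rho / 4 the exponent m tol^2 / 4 is at least 4 (rr + 1) once m = 256 A^2 (rr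
    + 1). *)
Definition verify_size : nat := minn (64 * 4 * A * A * rr.+1) n.

Let k := tuple_size.
Let sz := sample_size.
Let T := tuple_count.
Let M := bucket_count.
Let m := verify_size.

Definition ready s : Prop :=
  [/\ imem s 4 = k, imem s 5 = sz, imem s 6 = T, imem s 7 = M & imem s 8 = m].

Let e0 : 0 < eps. Proof. by case/andP: eps01. Qed.
Let r0 : 0 < rho. Proof. by case/andP: rho01. Qed.

Let E_gt0 : (0 < E)%N.
Proof. by rewrite lt0n; apply/eqP => z; move: hE; rewrite z mul0r ler10. Qed.

Let A_gt0 : (0 < A)%N.
Proof. by rewrite lt0n; apply/eqP => z; move: hA; rewrite z mul0r ler10. Qed.

Let k_gt0 : (0 < k)%N.
Proof. by rewrite /k /tuple_size !muln_gt0 E_gt0. Qed.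

Let sz_gt0 : (0 < sz)%N.
Proof. by rewrite leq_min !muln_gt0 A_gt0. Qed.

Let T_gt0 : (0 < T)%N.
Proof. by rewrite expn_gt0 sz_gt0. Qed.

Let sz_le : (sz <= n)%N. Proof. exact: geq_minr. Qed.

Let m_gt0 : (0 < m)%N.
Proof. by rewrite leq_min !muln_gt0 A_gt0. Qed.

Let m_le : (m <= n)%N. Proof. exact: geq_minr. Qed.

Lemma eq_kde_at N p (y y' : nat -> R) : (forall j, (j < d)%N -> y j = y' j) ->
  kde d N p y = kde d N p y'.
Proof.
move=> e; congr (_ * _); apply: eq_bigr => i _; congr (expR (- _)).
by apply: eq_bigr => j _; rewrite e.
Qed.

Lemma sample_close s z : (forall i, (i < sz)%N -> (idxf s i < n)%N) ->
  (sz = n -> forall i, (i < sz)%N -> idxf s i = i) ->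
  sample_disc I sz s <= 8 * sz%:R ->
  (kde d sz (samp I s) z - kde d n pts z) ^+ 2 <= (eps * rho / 16) ^+ 2.
Proof.
move=> idx_lt idx_id; rewrite /sample_disc -/n; case: ltnP => szn.
  move=> hd; have szA : sz = (64 * 32 * A * A)%N.
    by move: szn; rewrite /sz /sample_size /minn; case: ifP => //; rewrite ltnn.
  apply: le_trans (disc_sup d pts n_gt0 (idxf s) z sz_gt0) _.
  have s0 : 0 < sz%:R :> R by rewrite ltr0n.
  rewrite ler_pdivrMr ?exprn_gt0 //; apply: le_trans hd _.
  rewrite [sz%:R ^+ 2]expr2 mulrA ler_pM2r // szA !natrM.
  have -> : (eps * rho / 16) ^+ 2 * (64 * 32 * A%:R * A%:R) = 8 * (A%:R * (eps * rho)) ^+ 2.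
    by field.
  by rewrite -[leLHS]mulr1 ler_pM2l // exprn_ege1.
move=> _; have e : sz = n by apply/eqP; rewrite eqn_leq sz_le.
have -> : kde d sz (samp I s) z = kde d n pts z.
  transitivity (kde d sz pts z); last by congr kde.
  congr (_ * _); apply: eq_bigr => i _.
  by rewrite /samp idx_id.
by rewrite subrr expr0n sqr_ge0.
Qed.

Variable xs : nat -> R.
Let Gs := kde d n pts xs.

Definition poor (y : nat -> R) : Prop :=
  rho <= Gs /\ kde d n pts y < (1 - eps / 4) * Gs.

Lemma faithful_not_poor s tau (y : nat -> R) :
  (forall i, (i < sz)%N -> (idxf s i < n)%N) ->
  (sz = n -> forall i, (i < sz)%N -> idxf s i = i) ->
  sample_disc I sz s <= 8 * sz%:R -> faithful_sketch I sz k T M s ->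
  (tau < T)%N ->
  (forall t, (t < T)%N -> sketch_score I sz k M s t <= sketch_score I sz k M s tau) ->
  (forall j, (j < d)%N -> y j = candidate sz k (samp I s) tau j) ->
  ~ poor y.
Proof.
move=> idx_lt idx_id hd ff tT best yE [hr]; apply/negP; rewrite -leNgt.
rewrite (eq_kde_at _ _ yE).
apply: (candidate_quality (E := E) (k := k) (a := a) (p := samp I s) n_gt0 sz_gt0 eps01 rho01 hE ha (erefl _) hr).
  by move=> z; exact: sample_close.
apply: (best_candidate xs sz_gt0 k_gt0 tT ff) => t tT'.
by rewrite /kde /smean ler_pM2l ?best // invr_gt0 ltr0n.
Qed.

Definition round : cmd := CSeq find (CSeq verify keep_best).

(** The search loses eps/4 and the estimates err by [tol] once for the recorded value and once for
    the returned point: in total at most 3/4 of the allowed eps. *)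
Let tol := eps * rho / 4.
Let eta : R := if (m < n)%N then 2 * expR (- (m%:R * tol ^+ 2 / 4)) else 0.

Definition sound_best s : Prop := scv I s 0 <= kde d n pts (rmem s) + tol.
Definition reached s : Prop := rho <= Gs -> (1 - eps / 4) * Gs - tol <= scv I s 0.

(* With [r] rounds left: failure is certain once the recorded estimate is unsound,
   and otherwise each round misses a good point with probability at most 1/4 and
   verifies wrongly with probability at most [eta]. *)
Definition round_pot (r : nat) s : R :=
  (`[< ~ sound_best s >])%:R + (`[< ~ reached s >])%:R * 4^-1 ^+ r + 2 * r%:R * eta.

Definition round_time : nat := find_time I sz k T M + verify_time I m + d * 4 + 10.

Let tol_gt0 : 0 < tol.
Proof. by rewrite divr_gt0 // mulr_gt0 ?e0 ?r0. Qed.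

Lemma triple_round s r : ready s ->
  triple I round s round_time (fun s' => forall x, (x < 11)%N -> imem s' x = imem s x)
    (round_pot r) (round_pot r.+1 s).
Proof.
move=> [h4 h5 h6 h7 h8].
apply: (@triple_time _ _ (find_time I sz k T M + (verify_time I m + (d * 4 + 6)).+1).+1).
  by rewrite /round_time; lia.
pose u : R := 4^-1 ^+ r.
have u0 : 0 <= u by rewrite exprn_ge0 // invr_ge0.
have u1 : u <= 1 by rewrite exprn_ile1 ?invr_ge0 // invf_le1 ?ler1n.
pose ns : R := (`[< ~ sound_best s >])%:R; pose nr : R := (`[< ~ reached s >])%:R.
have ns01 : 0 <= ns <= 1 by rewrite ler0n lern1 leq_b1.
have nr01 : 0 <= nr <= 1 by rewrite ler0n lern1 leq_b1.
pose be := ns + 2 * eta + 2 * r%:R * eta.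
(* A poor candidate does harm only while no good value is recorded, and then costs u = 4^-r, the
   chance that the r later rounds also fail. *)
pose al := nr * u.
have ft : triple I find s (find_time I sz k T M) (fun s' => keep find_icell (find_rcell I) s s')
    (fun s' => al * (`[< poor (yf I s') >])%:R + be) (al * 4^-1 + be).
  have tf := triple_find (poor := poor) n_gt0 sz_gt0 k_gt0 T_gt0 sz_le (erefl M)
    faithful_not_poor (s := s) (And4 h4 h5 h6 h7).
  (* [triple_affine] needs a positive factor; for [al] = 0 only the constant survives, which is the
     purpose of [triple_const]. *)
  have [al0|al0] := eqVneq al 0.
    rewrite al0 mul0r add0r.
    apply: triple_weaken (triple_const (be := be) _ tf) _ _ _ => //.
    by move=> s' q; rewrite mul0r add0r.
  by apply: triple_affine => //; rewrite lt_def al0 mulr_ge0 //; case/andP: nr01.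
have b1 : al * 4^-1 + be <= round_pot r.+1 s.
  rewrite /round_pot /be /al -/ns -/nr exprSr -/u -[r.+1%:R]natr1.
  by rewrite le_eqVlt; apply/orP; left; apply/eqP; field.
apply: triple_seq (triple_weaken ft (leqnn _) b1 (fun s' q => conj q (lexx _))) _.
move=> s1 k1.
have g8 : imem s1 8 = m by rewrite k1.1.
have tol3 : tol <= 3^-1 * 2.
  rewrite /tol; case/andP: eps01 => _ e1; case/andP: rho01 => _ r1.
  have := ler_wpM2l (ltW e0) r1; rewrite mulr1; move: e1; lra.
set be1 := al * (`[< poor (yf I s1) >])%:R + (ns + 2 * r%:R * eta).
have vf := triple_affine (be := be1) (ltr0Sn R 1) (triple_verify n_gt0 m_gt0 m_le tol_gt0 tol3 g8 (erefl _)).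
have b2 : 2 * eta + be1 <= al * (`[< poor (yf I s1) >])%:R + be.
  by rewrite /be1 /be; lra.
apply: triple_seq (triple_weaken vf (leqnn _) b2 (fun s' q => conj q (lexx _))) _.
move=> s2 k2; set b := _ + be1.
have kb := @sure_keep_best R I s2.
have [frame out_same best_same y_same] := find_verify_frame k1 k2.
apply: triple_weaken (kb b) _ _ _ => // s3 [k3 upd]; split.
  by move=> x x11; rewrite k3.1 ?frame // regs_from12.
have poor_ge0 : 0 <= al * (`[< poor (yf I s1) >])%:R.
  by rewrite !mulr_ge0 //; case/andP: nr01.
have pot_le1 : (`[< ~ sound_best s3 >])%:R + (`[< ~ reached s3 >])%:R * u <= 2 :> R.
  have : (`[< ~ sound_best s3 >])%:R <= 1 :> R by rewrite lern1 leq_b1.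
  have : (`[< ~ reached s3 >])%:R * u <= 1 by rewrite mulr_ile1 // lern1 leq_b1.
  by lra.
rewrite /round_pot /b /be1 -/u.
(* A wrong verification may spoil [sound_best] and [reached] together; the factor 2 in front of
   [eta] pays for both. *)
have [bad|good] := ltrP tol `|scv I s2 2 - kde d n pts (yf I s1)|.
  have slack (w1 w2 w3 w4 : R) : w1 <= 2 -> 0 <= w2 -> 0 <= w3 ->
    w1 + w4 <= 2 * 1 + (w2 + (w3 + w4)) by lra.
  by apply: slack => //; case/andP: ns01.
rewrite mulr0 add0r.
move: good; rewrite ler_norml => /andP[gl gu].
have so : (`[< ~ sound_best s3 >])%:R <= ns.
  rewrite /ns; case: (asboolP (~ sound_best s)) => [_|/contrapT ok]; first by rewrite lern1 leq_b1.
  case: asboolP => // nok; exfalso; apply: nok; move: upd.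
  case: ifP => _ [v o]; rewrite /sound_best v.
    by rewrite (eq_kde_at _ _ o) y_same; move: gu; lra.
  rewrite best_same (@eq_kde_at _ _ _ (rmem s)) // => j jd.
  by rewrite o // out_same.
have best_ge : scv I s 0 <= scv I s3 0 /\ scv I s2 2 <= scv I s3 0.
  by move: upd; rewrite best_same; case: ltP => le [-> _]; split=> //; exact: ltW.
have re : (`[< ~ reached s3 >])%:R * u <= al * (`[< poor (yf I s1) >])%:R.
  case: (asboolP (~ reached s3)) => [nre|_]; last by rewrite mul0r.
  have nr1 : nr = 1.
    rewrite /nr; case: asboolP => // /contrapT ok; exfalso; apply: nre => hr.
    by apply: le_trans (ok hr) _; case: best_ge.
  rewrite /al nr1; case: asboolP => [_|np]; first by rewrite mul1r mulr1.
  exfalso; apply: nre => hr; case: best_ge => _; apply: le_trans.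
  have : (1 - eps / 4) * Gs <= kde d n pts (yf I s1).
    by rewrite leNgt; apply/negP => lt; apply: np.
  by move: gl; lra.
by rewrite [leRHS]addrA lerD2r addrC lerD.
Qed.

End Round.

(** * Computing the integer parameters *)

Section Setup.
Variables (R : realType) (I : input R).
Implicit Types (s : store R).

(** Counting up replaces rounding; the O(1/x) steps are dominated by the cost of the search. *)
Definition least (r : nat) (x : rexp) : cmd :=
  CSeq (CIStore (INum r) (INum 0))
    (CWhile (BRLt (RMul (ROfInt (reg r)) x) (ROfInt (INum 1)))
      (CIStore (INum r) (IAdd (reg r) (INum 1)))).

Lemma sure_least r x s (v : R) N : (forall s', reval I s' x = v) ->
  1 <= N%:R * v -> (forall j, (j < N)%N -> j%:R * v < 1) ->
  sure I (least r x) s (N * 2 + 5) (fun s' =>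
    imem s' r = N /\ keep (pred1 r) pred0 s s').
Proof.
move=> xv hN hlt; apply: (@sure_time _ _ (1 + (N * 2).+1).+1); first lia.
pose J i s' := imem s' r = i /\ keep (pred1 r) pred0 s s'.
apply: (sure_seq (Q1 := J 0%N)).
  apply: sure_istore; split; first by rewrite /= eqxx.
  by apply: keep_iupd => /=.
move=> s1 J1; apply: sure_weaken (sure_while (N := N) (t := 1) (J := J) _ J1) _ _ => //.
  move=> i s' iN [e1 e2] /=; rewrite e1 xv => lt.
  have iN' : (i < N)%N.
    by rewrite ltn_neqAle iN andbT; apply/eqP => z; move: lt; rewrite z ltNge hN.
  split=> //; apply: sure_istore; split; first by rewrite /= eqxx e1 addn1.
  by apply: keep_iupd => //=.
move=> s' [j [jN [e1 e2]]]; rewrite /= e1 xv -leNgt => ge; split=> //.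
by apply/eqP; rewrite eqn_leq jN leqNgt; apply/negP => /hlt; rewrite ltNge ge.
Qed.

(** Replaces a logarithm: register 12 runs through the powers of two while [r] counts them. *)
Definition doublings (r : nat) (x : rexp) : cmd :=
  CSeq (CIStore (INum r) (INum 0))
  (CSeq (CIStore (INum 12) (INum 1))
    (CWhile (BRLt (RMul (ROfInt (reg 12)) x) (ROfInt (INum 1)))
      (CSeq (CIStore (INum 12) (IAdd (reg 12) (reg 12)))
            (CIStore (INum r) (IAdd (reg r) (INum 1)))))).

Lemma sure_doublings r x s (v : R) N : (r < 12)%N -> (forall s', reval I s' x = v) ->
  1 <= 2 ^+ N * v -> (forall j, (j < N)%N -> 2 ^+ j * v < 1) ->
  sure I (doublings r x) s (N * 4 + 5) (fun s' =>
    imem s' r = N /\ keep (pred2 r 12) pred0 s s').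
Proof.
move=> r12 xv hN hlt; apply: (@sure_time _ _ (1 + (1 + (N * 4).+1).+1).+1); first lia.
pose J i s' := [/\ imem s' r = i, imem s' 12 = (2 ^ i)%N & keep (pred2 r 12) pred0 s s'].
have r12F : (r == 12) = false by rewrite ltn_eqF.
apply: (sure_seq (Q1 := fun s' => imem s' r = 0%N /\ keep (pred2 r 12) pred0 s s')).
  apply: sure_istore; split; first by rewrite /= eqxx.
  by apply: keep_iupd => //=; rewrite eqxx.
move=> s0 [z0 k0]; apply: (sure_seq (Q1 := J 0%N)).
  apply: sure_istore; split=> //=; first by rewrite r12F.
  by apply: keep_iupd => //=; rewrite orbT.
move=> s1 J1; apply: sure_weaken (sure_while (N := N) (t := 3) (J := J) _ J1) _ _ => //.
  move=> i s' iN [e1 e2 e3] /=; rewrite e2 xv natrX => lt.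
  have iN' : (i < N)%N.
    by rewrite ltn_neqAle iN andbT; apply/eqP => z; move: lt; rewrite z ltNge hN.
  split=> //; apply: (sure_straight (c := CSeq _ _)) => //=.
  rewrite r12F e1 e2 addn1; split => /=.
  - by rewrite eqxx.
  - by rewrite eq_sym r12F /= expnS mul2n addnn.
  apply: keep_iupd; first by rewrite /= eqxx.
  by apply: keep_iupd => //=; rewrite orbT.
move=> s' [j [jN [e1 e2 e3]]]; rewrite /= e2 xv natrX -leNgt => ge; split=> //.
by rewrite e1; apply/eqP; rewrite eqn_leq jN leqNgt; apply/negP => /hlt; rewrite ltNge ge.
Qed.

Definition store_min (r : nat) (e : iexp) : cmd :=
  CIf (BILt e INpts) (CIStore (INum r) e) (CIStore (INum r) INpts).

Definition sample_exp : iexp := IMul (IMul (IMul (INum 64) (INum 32)) (reg 1)) (reg 1).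
Definition verify_exp : iexp :=
  IMul (IMul (IMul (IMul (INum 64) (INum 4)) (reg 1)) (reg 1)) (IAdd (reg 3) (INum 1)).

Definition sizes : cmd :=
  CSeq (CIStore (INum 4) (IMul (IMul (INum 64) (reg 0)) (IAdd (reg 2) (INum 1))))
  (CSeq (store_min 5 sample_exp)
  (CSeq (CIStore (INum 6) (INum 1))
  (CSeq (CFor 12 (reg 4) (CIStore (INum 6) (IMul (reg 6) (reg 5))))
  (CSeq (CIStore (INum 7) (IMul (IMul (IMul (IMul (INum 64) (reg 6)) (reg 5)) (reg 4)) (reg 4)))
  (CSeq (store_min 8 verify_exp)
    (CRStore (sc_at 0) (RSub (ROfInt (INum 0)) (ROfInt (INum 1))))))))).

Lemma sure_store_min r e s (Q : store R -> Prop) :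
  Q (iupd s r (minn (ieval I s e) (npts I))) -> sure I (store_min r e) s 2 Q.
Proof.
move=> h; apply: sure_if; rewrite /= ; move: h; rewrite /minn; case: ifP => _ h;
  exact: sure_istore.
Qed.

Lemma sure_sizes s E A a rr : imem s 0 = E -> imem s 1 = A -> imem s 2 = a ->
  imem s 3 = rr ->
  sure I sizes s (tuple_size E a * 4 + 20) (fun s' =>
    [/\ ready I E A a rr s', imem s' 3 = rr & scv I s' 0 = -1]).
Proof.
move=> h0 h1 h2 h3.
apply: (@sure_time _ _ (1 + (2 + (1 + ((tuple_size E a * (1 + 3) + 3) + (1 + (2 + 1).+1).+1).+1).+1).+1).+1); first lia.
pose P s' := [/\ imem s' 1 = A, imem s' 3 = rr & imem s' 4 = tuple_size E a].
apply: (sure_seq (Q1 := P)).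
  by apply: sure_istore; split=> //=; rewrite h0 h2 addn1.
move=> s1 [p1 p3 p4].
pose P5 s' := P s' /\ imem s' 5 = sample_size I A.
apply: (sure_seq (Q1 := P5)).
  by apply: sure_store_min; rewrite [ieval _ _ _]/= p1; split=> //.
move=> s2 [[q1 q3 q4] q5].
apply: (sure_seq (Q1 := fun s' => P5 s' /\ imem s' 6 = 1%N)).
  by apply: sure_istore.
move=> s3 [[[t1 t3 t4] t5] t6].
apply: (sure_seq (Q1 := fun s' => P5 s' /\ imem s' 6 = tuple_count I E A a)).
  apply: sure_weaken (sure_for (N := tuple_size E a) (t := 1)
   (J := fun i s' => [/\ imem s' 12 = i, P5 s' & imem s' 6 = (sample_size I A ^ i)%N])
   _ _ _) _ _ => //.
  - by move=> i s' _ [e1 [[e2 e3 e4] e5] e6].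
  - move=> i s' iN [e1 [[e2 e3 e4] e5] e6]; apply: sure_istore; split=> //=.
    by split=> //=; rewrite e5 e6 expnSr.
  - by move=> s' [].
move=> s4 [[[u1 u3 u4] u5] u6].
apply: (sure_seq (Q1 := fun s' => [/\ P5 s', imem s' 6 = tuple_count I E A a
   & imem s' 7 = bucket_count I E A a])).
  by apply: sure_istore; split=> //=; rewrite u4 u5 u6.
move=> s5 [[[v1 v3 v4] v5] v6 v7].
apply: (sure_seq (Q1 := fun s' => ready I E A a rr s' /\ imem s' 3 = rr)).
  by apply: sure_store_min; rewrite [ieval _ _ _]/= v1 v3 addn1; split.
move=> s6 [rd w3]; apply: sure_rstore; split=> //.
by rewrite /scv /= eqxx sub0r.
Qed.

Definition setup : cmd :=
  CSeq (least 0 REps) (CSeq (least 1 (RMul REps RRho))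
  (CSeq (doublings 2 RRho) (CSeq (doublings 3 RDelta) sizes))).

Definition setup_time (E A a rr : nat) : nat :=
  E * 2 + A * 2 + a * 4 + rr * 4 + tuple_size E a * 4 + 50.

Lemma sure_setup s E A a rr :
  1 <= E%:R * epsilon I -> (forall j, (j < E)%N -> j%:R * epsilon I < 1) ->
  1 <= A%:R * (epsilon I * Defs.rho I) ->
  (forall j, (j < A)%N -> j%:R * (epsilon I * Defs.rho I) < 1) ->
  1 <= 2 ^+ a * Defs.rho I -> (forall j, (j < a)%N -> 2 ^+ j * Defs.rho I < 1) ->
  1 <= 2 ^+ rr * Defs.delta I -> (forall j, (j < rr)%N -> 2 ^+ j * Defs.delta I < 1) ->
  sure I setup s (setup_time E A a rr) (fun s' =>
    [/\ ready I E A a rr s', imem s' 3 = rr & scv I s' 0 = -1]).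
Proof.
move=> E1 E2 A1 A2 a1 a2 d1 d2.
apply: (@sure_time _ _ ((E * 2 + 5) + ((A * 2 + 5) + ((a * 4 + 5) +
  ((rr * 4 + 5) + (tuple_size E a * 4 + 20)).+1).+1).+1).+1).
  by rewrite /setup_time; lia.
have l0 := @sure_least 0 REps s (epsilon I) E (fun _ => erefl) E1 E2.
apply: (sure_seq l0) => s1 [e1 [k1 _]].
have l1 := @sure_least 1 (RMul REps RRho) s1 (epsilon I * Defs.rho I) A (fun _ => erefl) A1 A2.
apply: (sure_seq l1) => s2 [e2 [k2 _]].
have l2 := @sure_doublings 2 RRho s2 (Defs.rho I) a isT (fun _ => erefl) a1 a2.
apply: (sure_seq l2) => s3 [e3 [k3 _]].
have l3 := @sure_doublings 3 RDelta s3 (Defs.delta I) rr isT (fun _ => erefl) d1 d2.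
apply: (sure_seq l3) => s4 [e4 [k4 _]].
apply: sure_sizes => //.
- by rewrite k4 // k3 // k2.
- by rewrite k4 // k3.
- by rewrite k4.
Qed.

End Setup.

(* When the test fails, the zero vector is a correct answer: for eps >= 1 or
   dim = 0 trivially, and for rho > 1 because a kde never exceeds 1. *)
Definition kde_program : cmd :=
  CIf (BAnd (BRLt REps (ROfInt (INum 1)))
        (BAnd (BNot (BRLt (ROfInt (INum 1)) RRho)) (BILt (INum 0) IDim)))
    (CSeq setup (CFor 10 (IAdd (reg 3) (INum 1)) round)) CSkip.

Section Main.
Variables (R : realType) (I : input R).
Implicit Types (s : store R).
Variables (E A a rr : nat).
Hypotheses (n_gt0 : (0 < npts I)%N) (d_gt0 : (0 < Defs.dim I)%N).
Hypotheses (eps01 : 0 < epsilon I < 1) (rho01 : 0 < Defs.rho I <= 1).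
Hypothesis (delta_gt0 : 0 < Defs.delta I).
Hypotheses (E1 : 1 <= E%:R * epsilon I)
  (E2 : forall j, (j < E)%N -> j%:R * epsilon I < 1)
  (A1 : 1 <= A%:R * (epsilon I * Defs.rho I))
  (A2 : forall j, (j < A)%N -> j%:R * (epsilon I * Defs.rho I) < 1)
  (a1 : 1 <= 2 ^+ a * Defs.rho I) (a2 : forall j, (j < a)%N -> 2 ^+ j * Defs.rho I < 1)
  (d1 : 1 <= 2 ^+ rr * Defs.delta I)
  (d2 : forall j, (j < rr)%N -> 2 ^+ j * Defs.delta I < 1).
Variable xs : nat -> R.

Definition success s : Prop :=
  Defs.rho I <= kde (Defs.dim I) (npts I) (read_point I) xs ->
  (1 - epsilon I) * kde (Defs.dim I) (npts I) (read_point I) xs <=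
    kde (Defs.dim I) (npts I) (read_point I) (rmem s).

Lemma expR2_ge4 : 4 <= expR 2 :> R.
Proof.
have -> : 2 = 1 + 1 :> R by [].
have := expR_ge1Dx (1 : R) => h; rewrite expRD.
have -> : 4 = (1 + 1) * (1 + 1) :> R by ring.
by rewrite ler_pM.
Qed.

(** Put N = rr + 1. Since 2^rr delta >= 1, twice 4^-N is at most delta. One 4^-N pays for N failed
    searches, the other for the verifications: 2 N eta <= 4 N exp(-4N) <= exp(-2N) <= 4^-N. The
    initial estimate -1 is trivially sound. *)
Lemma round_pot_start s : scv I s 0 = -1 ->
  round_pot I A rr xs rr.+1 s <= Defs.delta I.
Proof.
move=> s0; have [e0 e1] := andP eps01; have [r0 r1] := andP rho01.
have sb : sound_best I s.
  rewrite /sound_best s0 (@le_trans _ _ 0) ?lerN10 // addr_ge0 //.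
    by apply/ltW/smean_gt0.
  by rewrite divr_ge0 // mulr_ge0 // ltW.
rewrite /round_pot; case: asboolP => // _; rewrite add0r.
set N := rr.+1; set w : R := 4^-1 ^+ N.
have w0 : 0 < w by rewrite exprn_gt0 // invr_gt0.
have hd : 2 * w <= Defs.delta I.
  have p2 : 0 < 2 ^+ rr :> R by rewrite exprn_gt0.
  have hw : 2 * w * 2 ^+ rr <= 1.
    have -> : 2 * w * 2 ^+ rr = 2^-1 * 2^-1 ^+ rr.
      rewrite /w exprS; have -> : 4^-1 = 2^-1 * 2^-1 :> R by field.
      by rewrite exprMn -!mulrA -exprMn mulVf // expr1n; field.
    by rewrite mulr_ile1 ?invr_ge0 ?exprn_ge0 ?exprn_ile1 ?invr_ge0 // invf_le1 ?ler1n.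
  rewrite -(ler_pM2r p2); apply: le_trans hw _; rewrite mulrC; exact: d1.
apply: le_trans hd; rewrite [2 * w]mulr_natl mulr2n; apply: lerD.
  by rewrite ler_piMl ?lern1 ?leq_b1 // ltW.
case: ifP => [mn|_]; last by rewrite mulr0 ltW.
have mE : verify_size I A rr = (64 * 4 * A * A * N)%N.
  by move: mn; rewrite /verify_size /minn; case: ifP => //; rewrite ltnn.
rewrite mE.
set z := (_ * _ / 4).
have N0 : 0 <= N%:R :> R by [].
have hz : 4 * N%:R <= z.
  rewrite /z !natrM.
  have -> : 64 * 4 * A%:R * A%:R * N%:R * (epsilon I * Defs.rho I / 4) ^+ 2 / 4
     = 4 * N%:R * (A%:R * (epsilon I * Defs.rho I)) ^+ 2 by field.
  by rewrite ler_peMr ?exprn_ege1 // mulr_ge0.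
have h1 : expR (- z) <= expR (- (4 * N%:R)) by rewrite ler_expR lerN2.
have hx : 4 * N%:R <= expR (2 * N%:R) :> R.
  have := expR_ge1Dx (N%:R : R) => h.
  have -> : expR (2 * N%:R) = expR N%:R * expR N%:R :> R.
    by rewrite -expRD; congr expR; ring.
  apply: le_trans (_ : (1 + N%:R) * (1 + N%:R) <= _); last by rewrite ler_pM // addr_ge0.
  have := sqr_ge0 (1 - N%:R : R); move: (N%:R : R) => x; rewrite expr2; lra.
have hw : expR (- (2 * N%:R)) <= w.
  rewrite expRN expRM_natr /w exprVn lef_pV2 ?posrE ?exprn_gt0 ?expR_gt0 //.
  by rewrite lerXn2r ?nnegrE ?expR_ge0 // expR2_ge4.
apply: le_trans (_ : 4 * N%:R * expR (- (4 * N%:R)) <= _).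
  have -> : 2 * N%:R * (2 * expR (- z)) = 4 * N%:R * expR (- z) by ring.
  by rewrite ler_wpM2l // mulr_ge0.
apply: le_trans hw; apply: le_trans (ler_wpM2r (expR_ge0 _) hx) _.
rewrite -expRD le_eqVlt; apply/orP; left; apply/eqP; congr expR; ring.
Qed.

Lemma round_pot_end s : (`[< ~ success s >])%:R <= round_pot I A rr xs 0 s.
Proof.
have [e0 e1] := andP eps01; have [r0 r1] := andP rho01.
rewrite /round_pot expr0 mulr1 mulr0 mul0r addr0.
case: (asboolP (~ sound_best I s)) => [_|/contrapT sb].
  by rewrite (@le_trans _ _ 1) ?lern1 ?leq_b1 // lerDl.
case: (asboolP (~ reached I xs s)) => [_|/contrapT re].
  by rewrite (@le_trans _ _ 1) ?lern1 ?leq_b1 // lerDr.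
rewrite addr0; case: asboolP => // ns; exfalso; apply: ns => hr.
have := le_trans (re hr) sb; move: hr.
move: (kde _ _ _ xs) (kde _ _ _ (rmem s)) => G H hr h.
have : epsilon I * Defs.rho I <= epsilon I * G by rewrite ler_pM2l.
have : 0 < epsilon I * Defs.rho I by rewrite mulr_gt0.
move: h; have -> : (1 - epsilon I / 4) * G = G - epsilon I * G / 4 by ring.
have -> : (1 - epsilon I) * G = G - epsilon I * G by ring.
by move: (epsilon I * Defs.rho I) (epsilon I * G) => er eG; lra.
Qed.

Definition main_time : nat :=
  setup_time E A a rr + rr.+1 * (round_time I E A a rr + 3) + 10.

Lemma triple_main s : triple I kde_program s main_time
  (fun=> True) (fun s' => (`[< ~ success s' >])%:R) (Defs.delta I).
Proof.
have [e0 e1] := andP eps01; have [r0 r1] := andP rho01.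
apply: (@triple_time _ _ (setup_time E A a rr +
   (rr.+1 * (round_time I E A a rr + 3) + 3)).+2).
  by rewrite /main_time; move: (rr.+1 * _)%N; lia.
apply: triple_if; rewrite /= e1 -leNgt r1 d_gt0 /=.
have su := sure_setup s E1 E2 A1 A2 a1 a2 d1 d2.
apply: (triple_seq (su (Defs.delta I))) => s1 [rd h3 v0].
pose J i s' := [/\ imem s' 10 = i, ready I E A a rr s' & imem s' 3 = rr].
apply: triple_weaken (triple_for (N := rr.+1) (t := round_time I E A a rr) (J := J)
  (G := fun i s' => round_pot I A rr xs (rr.+1 - i) s') _ _ _) _ _ _ => //.
- by move=> i s' _ [g1 g2 g3]; split=> //=; rewrite g3 addn1.
- move=> i s' iN [g1 g2 g3].
  have tr := triple_round n_gt0 d_gt0 eps01 rho01 E1 A1 a1 (xs := xs) (r := (rr.+1 - i.+1)%N) g2.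
  have ei : (rr.+1 - i = (rr.+1 - i.+1).+1)%N by rewrite subnSK.
  rewrite ei; apply: triple_weaken tr _ _ _ => // s2 fr; split; first split.
  + by rewrite fr.
  + case: g2 => g4 g5 g6 g7 g8; split=> //=; last by rewrite fr.
    by split; rewrite /= fr.
  + exact: lexx.
- by rewrite subn0; apply: round_pot_start.
- by move=> s' [g1 g2 g3]; split=> //; rewrite subnn; exact: round_pot_end.
Qed.

End Main.

(** * Running time *)

Section TimeNat.

Lemma leq_prodl (x y z : nat) : (0 < y)%N -> (x * y = z)%N -> (x <= z)%N.
Proof. by move=> y0 <-; rewrite leq_pmulr. Qed.

End TimeNat.

Section TimeBound.
Variables (R : realType) (I : input R).
Variables (E A a rr : nat).
Let d := Defs.dim I.
Hypotheses (d_gt0 : (0 < Defs.dim I)%N) (E_gt0 : (0 < E)%N) (A_gt0 : (0 < A)%N).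
Hypothesis n_gt0 : (0 < npts I)%N.

(** A crude product dominating the costs free of the dimension; polynomial waste only changes the
    constant in the final exponent. *)
Definition bulk (k sz T M : nat) : nat := (E * A * a.+1 * (k * sz * sz * T * M))%N.

Lemma find_time_le (k sz T M : nat) :
  (0 < sz)%N -> (0 < k)%N -> (0 < T)%N -> (T <= M)%N ->
  (find_time I sz k T M <= 200 * (k * sz * sz * T * M) + 40 * (Defs.dim I * sz))%N.
Proof.
move=> s0 k0 T0 TM; have M0 : (0 < M)%N by exact: leq_trans TM.
rewrite /find_time /sketch_time /search_make_time /search_time /decode_time.
move: (Defs.dim I) d_gt0 => D D0.
set Q := (k * sz * sz * T * M)%N.
have b1 : (T * sz <= Q)%N by apply: (leq_prodl (y := k * sz * M)); rewrite ?muln_gt0 ?k0 ?s0 // /Q; ring.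
have b2 : (T * k * T <= Q)%N.
  apply: (@leq_trans (T * k * M)); first by rewrite leq_mul2l TM orbT.
  by apply: (leq_prodl (y := sz * sz)); rewrite ?muln_gt0 ?s0 // /Q; ring.
have b3 : (T * k <= Q)%N by apply: (leq_prodl (y := sz * sz * M)); rewrite ?muln_gt0 ?s0 // /Q; ring.
have b4 : (T <= Q)%N by apply: (leq_prodl (y := sz * sz * M * k)); rewrite ?muln_gt0 ?s0 ?k0 ?M0 // /Q; ring.
have b5 : (T * sz * M * sz <= Q)%N by apply: (leq_prodl (y := k)) => //; rewrite /Q; ring.
have b6 : (T * sz * M <= Q)%N by apply: (leq_prodl (y := k * sz)); rewrite ?muln_gt0 ?s0 ?k0 // /Q; ring.
have b7 : (sz <= Q)%N by apply: (leq_prodl (y := k * sz * T * M)); rewrite ?muln_gt0 ?s0 ?k0 ?T0 ?M0 // /Q; ring.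
have b8 : (sz * M <= Q)%N by apply: (leq_prodl (y := k * sz * T)); rewrite ?muln_gt0 ?s0 ?k0 ?T0 // /Q; ring.
have b9 : (k <= Q)%N by apply: (leq_prodl (y := sz * sz * T * M)); rewrite ?muln_gt0 ?s0 ?T0 ?M0 // /Q; ring.
have b10 : (D <= D * sz)%N by rewrite leq_pmulr.
have b11 : (1 <= Q)%N by exact: leq_trans b4.
have -> : (T * (4 * sz + k * (4 * T + 13) + 20 + sz * (M * (4 * sz + 13) + 13) + 30) =
   17 * (T * sz) + 4 * (T * k * T) + 13 * (T * k) + 50 * T
   + 4 * (T * sz * M * sz) + 13 * (T * sz * M))%N by ring.
have -> : (k * (4 * T + 13) = 4 * (T * k) + 13 * k)%N by ring.
have -> : (D * (sz * 4 + 10) = 4 * (D * sz) + 10 * D)%N by ring.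
have -> : (D * (4 * sz + 13) = 4 * (D * sz) + 13 * D)%N by ring.
have -> : (sz * M * 4 = 4 * (sz * M))%N by ring.
by move: b1 b2 b3 b4 b5 b6 b7 b8 b9 b10 b11; clear;
  move: Q (T * sz)%N (T * k * T)%N (T * k)%N (T * sz * M * sz)%N (T * sz * M)%N (sz * M)%N (D * sz)%N; lia.
Qed.

Lemma main_time_le : let k := tuple_size E a in let sz := sample_size I A in
  let T := tuple_count I E A a in let M := bucket_count I E A a in
  let m := verify_size I A rr in
  (main_time I E A a rr <= 20 * 20 * (rr.+1 * bulk k sz T M)
    + 60 * (rr.+1 * (Defs.dim I * sz)) + 20 * (rr.+1 * (Defs.dim I * m)))%N.
Proof.
have k0 : (0 < tuple_size E a)%N by rewrite /tuple_size !muln_gt0 E_gt0.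
have s0 : (0 < sample_size I A)%N by rewrite leq_min !muln_gt0 A_gt0.
have T0 : (0 < tuple_count I E A a)%N by rewrite expn_gt0 s0.
have TM : (tuple_count I E A a <= bucket_count I E A a)%N.
  have TM T k sz : (0 < k)%N -> (0 < sz)%N -> (T <= 64 * T * sz * k * k)%N.
    move=> k0' s0'; apply: (leq_prodl (y := 64 * sz * k * k)); last by ring.
    by rewrite !muln_gt0 s0' k0'.
  exact: TM.
rewrite /main_time /setup_time /round_time /verify_time /=.
have hft0 := find_time_le s0 k0 T0 TM; move: hft0 k0 s0 T0 TM.
move: (tuple_size E a) (sample_size I A) (tuple_count I E A a) (bucket_count I E A a).
move: (verify_size I A rr) => m k sz T M; move: (find_time _ _ _ _ _) => ft.
rewrite /bulk; move: (Defs.dim I) d_gt0 => D D0 hft k0 s0 T0 TM.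
have M0 : (0 < M)%N by exact: leq_trans TM.
set Q := (k * sz * sz * T * M)%N in hft *.
have kQ : (k <= Q)%N by apply: (leq_prodl (y := sz * sz * T * M)); rewrite ?muln_gt0 ?s0 ?T0 ?M0 // /Q; ring.
move: Q kQ hft => Q kQ hft.
have Q0 : (0 < Q)%N by exact: leq_trans kQ.
set P := (E * A * a.+1 * Q)%N.
have c1 : (E <= P)%N by apply: (leq_prodl (y := A * a.+1 * Q)); rewrite ?muln_gt0 ?A_gt0 // /P; ring.
have c2 : (A <= P)%N by apply: (leq_prodl (y := E * a.+1 * Q)); rewrite ?muln_gt0 ?E_gt0 // /P; ring.
have c3 : (a.+1 <= P)%N by apply: (leq_prodl (y := E * A * Q)); rewrite ?muln_gt0 ?E_gt0 ?A_gt0 // /P; ring.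
have c4 : (Q <= P)%N by apply: (leq_prodl (y := E * A * a.+1)); rewrite ?muln_gt0 ?E_gt0 ?A_gt0 // /P; ring.
have c5 : (D <= D * sz)%N by rewrite leq_pmulr.
have c6 : (m <= D * m)%N by rewrite leq_pmull.
have body : (ft + (m * (D * 6 + 13) + 10) + D * 4 + 10 + 3 <=
    233 * P + 44 * (D * sz) + 19 * (D * m))%N.
  have -> : (m * (D * 6 + 13) = 6 * (D * m) + 13 * m)%N by ring.
  by move: hft c4 c5 c6 c3; clear; move: P (D * sz)%N (D * m)%N; lia.
have := leq_mul (leqnn rr.+1) body.
have -> : (rr.+1 * (233 * P + 44 * (D * sz) + 19 * (D * m)) =
  233 * (rr.+1 * P) + 44 * (rr.+1 * (D * sz)) + 19 * (rr.+1 * (D * m)))%N by ring.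
have d1 : (P <= rr.+1 * P)%N by rewrite leq_pmull.
have d2 : (rr.+1 <= rr.+1 * P)%N by rewrite leq_pmulr //; apply: leq_trans c3.
by move: kQ c1 c2 c3 c4 d1 d2; clear; move: P (D * sz)%N (D * m)%N (rr.+1 * _)%N; lia.
Qed.

End TimeBound.

(** * Growth rates of the parameters *)

Section Growth.
Variable R : realType.

(** Bookkeeping by rates: under products the rates [c] add up. *)
Definition exp_le (W c x : R) : Prop := 0 <= x /\ x <= expR (c * W).

Lemma exp_leM W c c' x y : exp_le W c x -> exp_le W c' y -> exp_le W (c + c') (x * y).
Proof.
move=> [x0 xc] [y0 yc]; split; first exact: mulr_ge0.
by rewrite mulrDl expRD ler_pM.
Qed.

Lemma exp_le_id W c x : 0 <= x -> x <= c * W -> exp_le W c x.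
Proof.
move=> x0 xc; split=> //; apply: le_trans xc _; apply: le_trans (expR_ge1Dx _).
by rewrite lerDr.
Qed.

Lemma half_le_ln2 : 2^-1 <= ln 2 :> R.
Proof.
have h : expR 2^-1 <= 2 :> R.
  have := expR_ge1Dx (- 2^-1 : R); rewrite expRN => h.
  rewrite -[leLHS]invrK -[leRHS]invrK lef_pV2 ?posrE ?invr_gt0 ?expR_gt0 //.
  by move: h; lra.
by rewrite -[leLHS]expRK ler_ln ?posrE ?expR_gt0.
Qed.

Lemma doublings_le (v : R) N : 0 < v -> (forall j, (j < N)%N -> 2 ^+ j * v < 1) ->
  N.+1%:R <= 4 * logp (1 / v).
Proof.
move=> v0 h; have l1 : 1 <= logp (1 / v) by rewrite le_max lexx.
have l2 : ln (1 / v) <= logp (1 / v) by rewrite le_max lexx orbT.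
case: N h => [|N] h; first by move: l1; lra.
have := h N (ltnSn _); rewrite -ltr_pdivlMr // => hN.
have : ln (2 ^+ N) <= ln (1 / v).
  by rewrite ler_ln ?posrE ?exprn_gt0 ?divr_gt0 // ltW.
rewrite lnXn // => hl.
have : N%:R * 2^-1 <= ln (1 / v).
  by apply: le_trans hl; rewrite -[X in _ <= X]mulr_natl ler_wpM2l // half_le_ln2.
by rewrite -[N.+2%:R]natr1 -[N.+1%:R]natr1; move: l1 l2; lra.
Qed.

Lemma least_le (v : R) N : 0 < v -> v <= 1 -> (0 < N)%N ->
  (forall j, (j < N)%N -> j%:R * v < 1) -> N%:R <= 2 / v.
Proof.
move=> v0 v1; case: N => // N _ /(_ N (ltnSn _)); rewrite ler_pdivlMr // -natr1.
by rewrite mulrDl mul1r; lra.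
Qed.

End Growth.

Section TotalTime.
Variables (R : realType) (I : input R).
Variables (E A a rr : nat).
Hypotheses (n_gt0 : (0 < npts I)%N) (d_gt0 : (0 < Defs.dim I)%N).
Hypotheses (eps01 : 0 < epsilon I < 1) (rho01 : 0 < Defs.rho I <= 1).
Hypotheses (delta_gt0 : 0 < Defs.delta I).
Hypotheses (E_gt0 : (0 < E)%N) (A_gt0 : (0 < A)%N).
Hypotheses (E2 : forall j, (j < E)%N -> j%:R * epsilon I < 1)
  (A2 : forall j, (j < A)%N -> j%:R * (epsilon I * Defs.rho I) < 1)
  (a2 : forall j, (j < a)%N -> 2 ^+ j * Defs.rho I < 1)
  (d2 : forall j, (j < rr)%N -> 2 ^+ j * Defs.delta I < 1).

Local Notation eps := (epsilon I).
Local Notation er := (epsilon I * Defs.rho I).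
Local Notation L := (logp (1 / (epsilon I * Defs.rho I))).
Local Notation W := (logp (1 / (epsilon I * Defs.rho I)) ^+ 2 / epsilon I).

Let e0 : 0 < eps. Proof. by case/andP: eps01. Qed.
Let e1 : eps <= 1. Proof. by case/andP: eps01 => _ /ltW. Qed.
Let r0 : 0 < Defs.rho I. Proof. by case/andP: rho01. Qed.
Let r1 : Defs.rho I <= 1. Proof. by case/andP: rho01. Qed.
Let er0 : 0 < er. Proof. by rewrite mulr_gt0 ?e0 ?r0. Qed.
Let er_eps : er <= eps. Proof. by rewrite ler_piMr ?(ltW e0) ?r1. Qed.
Let er_rho : er <= Defs.rho I. Proof. by rewrite ler_piMl ?(ltW r0) ?e1. Qed.
Let er1 : er <= 1. Proof. exact: le_trans er_eps e1. Qed.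

Lemma L_ge1 : 1 <= L. Proof. by rewrite le_max lexx. Qed.

Lemma inv_er_le : 1 / er <= expR L.
Proof.
rewrite -[leLHS]lnK ?posrE ?divr_gt0 ?er0 // ler_expR.
by rewrite le_max lexx orbT.
Qed.

Lemma inv_eps_le : 1 / eps <= expR L.
Proof.
apply: le_trans inv_er_le.
by rewrite !div1r lef_pV2 ?posrE ?er0 ?e0 // er_eps.
Qed.

Lemma L_le_W : L <= W.
Proof.
have := L_ge1; move: (logp _) => l l1.
have l0 : 0 <= l := le_trans ler01 l1.
rewrite ler_pdivlMr ?e0 //; apply: (@le_trans _ _ (l * 1)).
  by rewrite ler_wpM2l ?e1.
by rewrite expr2 ler_wpM2l.
Qed.

Lemma exp_le_LW c x : 0 <= c -> exp_le L c x -> exp_le W c x.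
Proof.
move=> c0 [x0 xc]; split=> //; apply: le_trans xc _.
by rewrite ler_expR ler_wpM2l // L_le_W.
Qed.

Lemma exp_le_const (c : R) : 0 <= c -> exp_le L c c.
Proof. by move=> c0; apply: exp_le_id => //; rewrite ler_peMr // L_ge1. Qed.

Lemma two_div_exp_le (v x : R) : 0 < v -> 0 <= x -> x <= 2 / v ->
  1 / v <= expR L -> exp_le L 2 x.
Proof.
move=> v0 x0 xv vL; split=> //; apply: le_trans xv _.
have -> : 2 / v = 2 * (1 / v) by rewrite mulrA mulr1.
have -> : 2 * L = L + L by ring.
rewrite expRD; apply: ler_pM => //; first by rewrite divr_ge0 // ltW.
by apply: le_trans (expR_ge1Dx _); have := L_ge1; lra.
Qed.

Lemma E_exp_le : exp_le L 2 E%:R.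
Proof. exact: two_div_exp_le e0 _ (least_le e0 e1 E_gt0 E2) inv_eps_le. Qed.

Lemma A_le : A%:R <= 2 / er.
Proof. exact: least_le er0 er1 A_gt0 A2. Qed.

Lemma A_exp_le : exp_le L 2 A%:R.
Proof. exact: two_div_exp_le er0 _ A_le inv_er_le. Qed.

Lemma a_le : a.+1%:R <= 4 * L.
Proof.
apply: le_trans (doublings_le r0 a2) _; rewrite ler_pM2l //.
have le_ln : ln (1 / Defs.rho I) <= ln (1 / er).
  by rewrite ler_ln ?posrE ?divr_gt0 ?r0 ?er0 // !div1r lef_pV2 ?posrE ?er0 ?r0 // er_rho.
by rewrite ge_max !le_max lexx le_ln orbT.
Qed.

Lemma k_le : (tuple_size E a)%:R <= (8 * 64) * (L / eps).
Proof.
rewrite /tuple_size !natrM.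
have -> : (8 * 64) * (L / eps) = 64 * (2 / eps) * (4 * L) by ring.
by rewrite ler_pM ?mulr_ge0 ?a_le // ler_pM2l // (least_le e0 e1 E_gt0 E2).
Qed.

Lemma sample_le : (sample_size I A)%:R <= 64 * 32 * (A%:R * A%:R) :> R.
Proof.
rewrite mulrA -!natrM ler_nat; exact: geq_minl.
Qed.

Lemma sample_exp_le : exp_le L (64 + 32 + (2 + 2)) (sample_size I A)%:R.
Proof.
have [h0 h1] : exp_le L (64 + 32 + (2 + 2)) (64 * 32 * (A%:R * A%:R)).
  apply: exp_leM; first by apply: exp_leM; exact: exp_le_const.
  by apply: exp_leM; exact: A_exp_le.
by split=> //; exact: le_trans sample_le h1.
Qed.

Lemma k_exp_le : exp_le W (8 * 64) (tuple_size E a)%:R.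
Proof.
apply: (exp_le_id (ler0n _ _)); apply: le_trans k_le _.
apply: ler_wpM2l; first by apply: mulr_ge0; exact: ler0n.
rewrite ler_pM2r ?invr_gt0 ?e0 // expr2 ler_peMl ?L_ge1 //.
exact: le_trans ler01 L_ge1.
Qed.

(** The dominant quantity: the sample size is exp(O(L)) and the tuple size O(L / eps), so the
    logarithm of their power is O(L^2 / eps) = O(W). *)
Lemma tuples_exp_le : exp_le W ((64 + 32 + (2 + 2)) * (8 * 64)) (tuple_count I E A a)%:R.
Proof.
split=> //; rewrite natrX; have [s0 sc] := sample_exp_le.
set c := _ + _ in sc *.
have c0 : 0 <= c by rewrite /c !addr_ge0.
apply: (@le_trans _ _ (expR (c * L) ^+ tuple_size E a)).
  by rewrite lerXn2r ?nnegrE ?expR_ge0.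
rewrite -expRM_natr ler_expR -mulrA -[leRHS]mulrA ler_wpM2l //.
have l0 : 0 <= L := le_trans ler01 L_ge1.
apply: le_trans (ler_wpM2l l0 k_le) _.
by rewrite le_eqVlt; apply/orP; left; apply/eqP; ring.
Qed.

(** The summands follow the factors of [bulk], with s, b and t the rates of the sample size, tuple
    size and tuple count; the last bracket is the bucket count. *)
Definition bulk_rate : R :=
  let s := 64 + 32 + (2 + 2) in let b := 8 * 64 in let t := s * b in
  (2 + 2 + 4) + (b + s + s + t + (64 + t + s + b + b)).

Lemma bulk_rate_gt0 : 0 < bulk_rate.
Proof.
rewrite /bulk_rate.
have s0 : 0 <= 64 + 32 + (2 + 2) :> R.
  by apply: addr_ge0; apply: addr_ge0; exact: ler0n.
move: (64 + 32 + (2 + 2)) s0 => s s0.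
have b0 : 0 <= 8 * 64 :> R by apply: mulr_ge0; exact: ler0n.
move: (8 * 64) b0 => b b0.
have t0 := mulr_ge0 s0 b0; move: (s * b) t0 => t t0.
have n0 (k : nat) : 0 <= k%:R :> R by exact: ler0n.
move: (ltr0Sn R 1) (n0 4) (n0 64); move: (2%:R) (4%:R) (64%:R) => x2 x4 x64 h2 h4 h64.
by rewrite /= -!addrA ltr_wpDr // !addr_ge0 // ltW.
Qed.

Lemma bulk_exp_le : exp_le W bulk_rate
  (bulk E A a (tuple_size E a) (sample_size I A) (tuple_count I E A a)
     (bucket_count I E A a))%:R.
Proof.
have sW : exp_le W (64 + 32 + (2 + 2)) (sample_size I A)%:R.
  by apply: exp_le_LW sample_exp_le; rewrite !addr_ge0.
have kW := k_exp_le; have tW := tuples_exp_le.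
have cW : exp_le W 64 64 by apply: exp_le_LW => //; exact: exp_le_const.
have l0 : 0 <= L := le_trans ler01 L_ge1.
have EW := exp_le_LW (ler0n R 2) E_exp_le.
have AW := exp_le_LW (ler0n R 2) A_exp_le.
have aW : exp_le W 4 a.+1%:R := exp_le_LW (ler0n R 4) (exp_le_id (ler0n _ _) a_le).
have MW := exp_leM (exp_leM (exp_leM (exp_leM cW tW) sW) kW) kW.
have QW := exp_leM (exp_leM (exp_leM (exp_leM kW sW) sW) tW) MW.
have PW := exp_leM (exp_leM (exp_leM EW AW) aW) QW.
move: PW; rewrite /bulk /bucket_count.
move: (tuple_size E a) (sample_size I A) (tuple_count I E A a) => k s T.
by rewrite !natrM.
Qed.

(** If L >= 2 then ln L >= 1/2, whence the factor 2 in the exponent, and the spare factor L / eps is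
    at least 1. If L < 2 the power may be as small as 1, but then 1 / eps <= exp(L) <= exp(2) and W
    is bounded by 4 exp(2), which goes into the constant. *)
Lemma rate_growth (K : R) : 0 <= K ->
  expR (K * W) <= expR (K * (4 * expR 2)) * L `^ (2 * K * (1 / eps ^+ 2) * L ^+ 3).
Proof.
move=> K0; have l1 := L_ge1; have l0 : 0 <= L := le_trans ler01 l1.
have lpos : 0 < L := lt_le_trans ltr01 l1.
have ex0 : 0 <= 2 * K * (1 / eps ^+ 2) * L ^+ 3.
  by rewrite !mulr_ge0 ?invr_ge0 ?exprn_ge0 ?(ltW e0).
have lnL : 0 <= ln L by rewrite ln_ge0.
have pw1 : 1 <= L `^ (2 * K * (1 / eps ^+ 2) * L ^+ 3).
  rewrite /powR (gt_eqF lpos); apply: le_trans (expR_ge1Dx _).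
  by rewrite lerDl mulr_ge0.
have [L2|L2] := leP 2 L.
  rewrite -[leLHS]mul1r ler_pM // ?expR_ge0 //.
    apply: le_trans (expR_ge1Dx _).
    by rewrite lerDl !mulr_ge0 ?expR_ge0.
  rewrite /powR gt_eqF // ler_expR.
  have ln_half : 2^-1 <= ln L.
    by apply: le_trans (half_le_ln2 R) _; rewrite ler_ln ?posrE.
  have ie : 1 <= 1 / eps by rewrite div1r invf_ge1 ?e0 ?e1.
  apply: le_trans (_ : 2 * K * (1 / eps ^+ 2) * L ^+ 3 * 2^-1 <= _); last first.
    by rewrite ler_wpM2l.
  have -> : 2 * K * (1 / eps ^+ 2) * L ^+ 3 * 2^-1 = K * W * ((1 / eps) * L).
    by field; rewrite gt_eqF ?e0.
  rewrite ler_peMr //; last by apply: (le_trans ie); rewrite ler_peMr // (le_trans ler01 ie).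
  by rewrite mulr_ge0 // divr_ge0 ?exprn_ge0 // ?(ltW e0).
rewrite -[leLHS]mulr1 ler_pM // ?expR_ge0 // ler_expR ler_wpM2l //.
have -> : W = L ^+ 2 * (1 / eps) by rewrite mulrA mulr1.
have L24 : L ^+ 2 <= 4.
  have -> : 4 = 2 ^+ 2 :> R by ring.
  by rewrite lerXn2r ?nnegrE // ltW.
apply: ler_pM => //; first exact: exprn_ge0.
  by rewrite divr_ge0 // ltW.
by apply: le_trans inv_eps_le _; rewrite ler_expR; exact: ltW.
Qed.

Let n := npts I.
Let d := Defs.dim I.
Local Notation l := (logp (1 / Defs.delta I)).
Let Min := Num.min (n%:R * d%:R * l) (d%:R / (eps ^+ 2 * Defs.rho I ^+ 2) * l ^+ 2).

Let l_ge1 : 1 <= l. Proof. by rewrite le_max lexx. Qed.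
Let l_ge0 : 0 <= l := le_trans ler01 l_ge1.

Lemma le_scaled_min (c x : R) : 0 <= c -> x <= c * (n%:R * d%:R * l) ->
  x <= c * (d%:R / (eps ^+ 2 * Defs.rho I ^+ 2) * l ^+ 2) -> x <= c * Min.
Proof. by move=> c0 h1 h2; rewrite /Min minEle; case: ifP. Qed.

Lemma rounds_le : rr.+1%:R <= 4 * l.
Proof. exact: doublings_le delta_gt0 d2. Qed.

Lemma A2_le : A%:R * A%:R <= 4 * (eps ^+ 2 * Defs.rho I ^+ 2)^-1 :> R.
Proof.
have -> : 4 * (eps ^+ 2 * Defs.rho I ^+ 2)^-1 = (2 / er) * (2 / er) :> R.
  by field; rewrite (gt_eqF e0) (gt_eqF r0).
by rewrite ler_pM // A_le.
Qed.

Lemma sample_cost_le : (rr.+1 * (d * sample_size I A))%:R <= 64 * 32 * 4 * 4 * Min.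
Proof.
apply: le_scaled_min; first by rewrite !mulr_ge0.
  rewrite !natrM; have hs : (sample_size I A)%:R <= n%:R :> R by rewrite ler_nat geq_minr.
  apply: (@le_trans _ _ (4 * l * (d%:R * n%:R))).
    by rewrite ler_pM ?mulr_ge0 ?rounds_le // ler_wpM2l.
  have -> : 4 * l * (d%:R * n%:R) = 4 * (n%:R * d%:R * l) by ring.
  rewrite ler_wpM2r ?mulr_ge0 // ler_peMl //.
  by rewrite -!natrM ler1n.
rewrite !natrM.
apply: (@le_trans _ _ (4 * l * (d%:R * (64 * 32 * (4 * (eps ^+ 2 * Defs.rho I ^+ 2)^-1))))).
  rewrite ler_pM ?mulr_ge0 ?rounds_le // ler_wpM2l //.
  by apply: le_trans sample_le _; rewrite ler_wpM2l ?mulr_ge0 // A2_le.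
have -> : 4 * l * (d%:R * (64 * 32 * (4 * (eps ^+ 2 * Defs.rho I ^+ 2)^-1))) =
  64 * 32 * 4 * 4 * (d%:R / (eps ^+ 2 * Defs.rho I ^+ 2) * l) by ring.
apply: ler_wpM2l; first by rewrite !mulr_ge0.
apply: ler_wpM2l; first by rewrite divr_ge0 // mulr_ge0 ?sqr_ge0.
by rewrite expr2 ler_peMl.
Qed.

(** The square of the logarithm of 1 / delta arises because both the number of rounds and each
    verification sample are proportional to it; the cap at n removes one of the two. *)
Lemma verify_cost_le : (rr.+1 * (d * verify_size I A rr))%:R <= 64 * 4 * 4 * 4 * 4 * Min.
Proof.
apply: le_scaled_min; first by rewrite !mulr_ge0.
  rewrite !natrM; have hs : (verify_size I A rr)%:R <= n%:R :> R by rewrite ler_nat geq_minr.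
  apply: (@le_trans _ _ (4 * l * (d%:R * n%:R))).
    by rewrite ler_pM ?mulr_ge0 ?rounds_le // ler_wpM2l.
  have -> : 4 * l * (d%:R * n%:R) = 4 * (n%:R * d%:R * l) by ring.
  rewrite ler_wpM2r ?mulr_ge0 // ler_peMl //.
  by rewrite -!natrM ler1n.
rewrite !natrM.
have hv : (verify_size I A rr)%:R <= 64 * 4 * (4 * (eps ^+ 2 * Defs.rho I ^+ 2)^-1) * (4 * l).
  apply: (@le_trans _ _ (64 * 4 * (A%:R * A%:R) * rr.+1%:R)).
    by rewrite [64 * 4 * _]mulrA -!natrM ler_nat geq_minl.
  by rewrite ler_pM ?mulr_ge0 ?rounds_le // ler_wpM2l ?mulr_ge0 // A2_le.
apply: (@le_trans _ _ (4 * l * (d%:R * (64 * 4 * (4 * (eps ^+ 2 * Defs.rho I ^+ 2)^-1) * (4 * l))))).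
  by rewrite ler_pM ?mulr_ge0 ?rounds_le // ler_wpM2l.
by rewrite le_eqVlt; apply/orP; left; apply/eqP; ring.
Qed.

Lemma powr_rate_ge1 (c : R) : 0 <= c -> 1 <= L `^ (c * (1 / eps ^+ 2) * L ^+ 3).
Proof.
move=> c0; have l0 : 0 <= L := le_trans ler01 L_ge1.
rewrite /powR (gt_eqF (lt_le_trans ltr01 L_ge1)); apply: le_trans (expR_ge1Dx _).
by rewrite lerDl !mulr_ge0 ?invr_ge0 ?exprn_ge0 ?(ltW e0) // ln_ge0 // L_ge1.
Qed.

Lemma main_time_bound (C : R) :
  (20 * 20) * (4 * expR (bulk_rate * (4 * expR 2))) <= C ->
  60 * (64 * 32 * 4 * 4) + 20 * (64 * 4 * 4 * 4 * 4) <= C ->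
  (main_time I E A a rr)%:R <=
  time_bound C (2 * bulk_rate) n d eps (Defs.rho I) (Defs.delta I).
Proof.
move=> hC1 hC2; have K0 := ltW bulk_rate_gt0.
have := main_time_le a rr d_gt0 E_gt0 A_gt0 n_gt0.
rewrite /= -(ler_nat R) => hm; apply: le_trans hm _.
have [P0 hP] := bulk_exp_le.
have hg := le_trans hP (rate_growth K0).
move: (bulk _ _ _ _ _ _ _) P0 hP hg => P P0 hP hg.
have cost1 := sample_cost_le; have cost2 := verify_cost_le.
rewrite /time_bound -/n -/d; move: cost1 cost2.
move: (rr.+1 * (d * sample_size I A))%N (rr.+1 * (d * verify_size I A rr))%N => x y.
have pw0 : 0 <= L `^ (2 * bulk_rate * (1 / eps ^+ 2) * L ^+ 3).
  by apply: le_trans ler01 (powr_rate_ge1 _); rewrite mulr_ge0.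
move: (L `^ _) pw0 hg => pw pw0 hg cost1 cost2.
have M0 : 0 <= Min.
  by rewrite le_min !mulr_ge0 ?invr_ge0 ?mulr_ge0 ?exprn_ge0 ?(ltW e0) ?(ltW r0).
have nd0 : 0 <= n%:R * d%:R :> R by rewrite mulr_ge0.
have cost0 : (rr.+1 * P)%:R <= 4 * expR (bulk_rate * (4 * expR 2)) * (pw * l).
  rewrite natrM; apply: (@le_trans _ _ (4 * l * (expR (bulk_rate * (4 * expR 2)) * pw))).
    by rewrite ler_pM ?rounds_le.
  by rewrite le_eqVlt; apply/orP; left; apply/eqP; ring.
have X0 : 0 <= pw * l by rewrite mulr_ge0.
move: (rr.+1 * P)%N cost0 => z cost0.
rewrite -/Min; move: (Min) M0 cost1 cost2 => mn M0 cost1 cost2.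
have C0 : 0 <= C by apply: le_trans hC2; rewrite addr_ge0 // !mulr_ge0.
have b1 : (20 * 20) * z%:R <= C * (pw * l).
  apply: (@le_trans _ _ ((20 * 20) * (4 * expR (bulk_rate * (4 * expR 2)) * (pw * l)))).
    by apply: ler_wpM2l cost0; apply: mulr_ge0; exact: ler0n.
  rewrite mulrA; exact: ler_wpM2r X0 _ _ hC1.
have b2 : 60 * x%:R + 20 * y%:R <= C * mn.
  apply: le_trans (ler_wpM2r M0 hC2).
  rewrite [leRHS]mulrDl -!(mulrA 60) -!(mulrA 20); apply: lerD; exact: ler_wpM2l.
rewrite 2!natrD (natrM _ (20 * 20)%N) (natrM _ 60%N) !(natrM _ 20%N).
have e3 (u v w : R) : C * (u + v + w) = C * u + C * v + C * w by ring.
rewrite e3 -[leLHS]addrA.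
apply: lerD => //; apply: le_trans b1 _; rewrite lerDr; exact: mulr_ge0.
Qed.

End TotalTime.
(** * The theorem *)

Section Bridge.
Variable R : realType.

Lemma enorm_sqd d (x y : 'rV[R]_d) (u v : nat -> R) :
  (forall j : 'I_d, u j = x ord0 j) -> (forall j : 'I_d, v j = y ord0 j) ->
  enorm (x - y) ^+ 2 = sqd d u v.
Proof.
move=> ux vy; rewrite /enorm sqr_sqrtr; last by apply: sumr_ge0 => j _; exact: sqr_ge0.
by apply: eq_bigr => j _; rewrite !mxE ux vy.
Qed.

Lemma gkde_kde n d (eps rho delta : R) (P : 'I_n -> 'rV[R]_d) (x : 'rV[R]_d) (u : nat -> R) :
  (forall j : 'I_d, u j = x ord0 j) ->
  gkde P x = kde d n (read_point (Input eps rho delta P)) u.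
Proof.
move=> ux; rewrite /gkde /kde /smean; congr (_ * _); apply: eq_bigr => i _.
congr (expR (- _)); apply: enorm_sqd => // j.
by rewrite /read_point !insubT // => lt1 lt2; congr (P _ _ _); apply: val_inj.
Qed.

Lemma ex_least (v : R) : 0 < v ->
  exists N, 1 <= N%:R * v /\ forall j, (j < N)%N -> j%:R * v < 1.
Proof.
move=> v0.
have ex : exists N, 1 <= N%:R * v.
  exists (Num.truncn v^-1).+1; rewrite -ler_pdivrMr // div1r.
  by apply: ltW; exact: truncnS_gt.
case: (ex_minnP ex) => N hN hmin; exists N; split=> // j jN.
by rewrite ltNge; apply/negP => /hmin; rewrite leqNgt jN.
Qed.

Lemma ex_doublings (v : R) : 0 < v ->
  exists N, 1 <= 2 ^+ N * v /\ forall j, (j < N)%N -> 2 ^+ j * v < 1.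
Proof.
move=> v0.
have ex : exists N, 1 <= 2 ^+ N * v.
  have [N [hN _]] := ex_least v0; exists N; apply: le_trans hN _.
  by rewrite ler_pM2r // -natrX ler_nat ltnW // ltn_expl.
case: (ex_minnP ex) => N hN hmin; exists N; split=> // j jN.
by rewrite ltNge; apply/negP => /hmin; rewrite leqNgt jN.
Qed.

(** The triple is closed with the empty continuation; as every branch halts, success and failure
    probabilities add up to 1. *)
Lemma triple_output_prob (I : input R) prog t (E : 'rV[R]_(Defs.dim I) -> Prop) b :
  triple I prog (init_store R) t (fun=> True)
    (fun s => (`[< ~ E (output (Defs.dim I) s) >])%:R) b ->
  runs_in prog I t /\ 1 - b <= @output_prob R prog I t E.
Proof.
move=> h; pose f s : R := (`[< ~ E (output (Defs.dim I) s) >])%:R.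
have [|hh he] := h [::] 0%N f; first by move=> s' _; split=> /=.
rewrite addn0 in hh he; split=> //.
rewrite /output_prob prob_within_expect.
have -> : (fun s : store R => (`[< E (output (Defs.dim I) s) >])%:R : R) =
    fun s => -1 * f s + 1.
  apply/funext => s; rewrite /f asbool_neg; case: asboolP => _ /=; ring.
by rewrite expect_affine // mulN1r [leRHS]addrC lerD2l lerN2.
Qed.

(** Pays for the early exit of constant length: the summand containing the power is at least 1. *)
Lemma time_bound_ge (C c : R) n d (eps rho delta : R) : 0 <= C -> 0 <= c ->
  0 < delta -> C <= time_bound C c n d eps rho delta.
Proof.
move=> C0 c0 de0; rewrite /time_bound -[leLHS]mulr1 ler_wpM2l //.
have logp1 (x : R) : 1 <= logp x by rewrite le_max lexx.
have logp0 (x : R) : 0 <= logp x := le_trans ler01 (logp1 x).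
have nd0 : 0 <= n%:R * d%:R :> R by rewrite mulr_ge0.
have min0 : 0 <= Num.min (n%:R * d%:R * logp (1 / delta))
    (d%:R / (eps ^+ 2 * rho ^+ 2) * logp (1 / delta) ^+ 2).
  rewrite le_min; apply/andP; split; first by rewrite !mulr_ge0.
  by rewrite mulr_ge0 ?sqr_ge0 // divr_ge0 // mulr_ge0 ?sqr_ge0.
apply: (@le_trans _ _ (logp (1 / (eps * rho)) `^ (c * (1 / eps ^+ 2)
    * logp (1 / (eps * rho)) ^+ 3) * logp (1 / delta))); last first.
  by rewrite -addrA addrCA lerDl addr_ge0.
rewrite -[leLHS]mulr1 ler_pM //.
rewrite /powR gt_eqF ?(lt_le_trans ltr01) //; apply: le_trans (expR_ge1Dx _).
by rewrite lerDl !mulr_ge0 ?invr_ge0 ?sqr_ge0 ?exprn_ge0 // ln_ge0.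
Qed.

Lemma triple_kde_program_exit (I : input R) s (g : store R -> R) b :
  ~~ [&& epsilon I < 1, ~~ (1 < Defs.rho I) & (0 < Defs.dim I)%N] ->
  (forall s', g s' <= b) -> triple I kde_program s 2 (fun=> True) g b.
Proof.
move=> /negbTE nc gb; apply: triple_if.
by rewrite /= nc; apply: triple_skip.
Qed.

End Bridge.

Theorem theorem2 (R : realType) :
  exists (prog : cmd) (C c : R),
    [/\ 0 < C, 0 < c &
      forall (n d : nat) (eps rho delta : R) (P : 'I_n -> 'rV[R]_d),
        (0 < n)%N -> injective P ->
        0 < eps -> 0 < rho -> 0 < delta < 1 ->
        exists t : nat,
          [/\ t%:R <= time_bound C c n d eps rho delta,
              runs_in prog (Input eps rho delta P) t &
              forall xstar : 'rV[R]_d,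
                is_argmax (gkde P) xstar ->
                rho <= gkde P xstar ->
                1 - delta <=
                  @output_prob R prog (Input eps rho delta P) t
                    (fun x' : 'rV[R]_d =>
                       (1 - eps) * gkde P xstar <= gkde P x')]].
Proof.
pose C1 : R := 20 * 20 * (4 * expR (bulk_rate R * (4 * expR 2))).
pose C2 : R := 60 * (64 * 32 * 4 * 4) + 20 * (64 * 4 * 4 * 4 * 4).
have C1_ge0 : 0 <= C1.
  by apply: mulr_ge0; [apply: mulr_ge0; exact: ler0n | rewrite mulr_ge0 ?expR_ge0].
have C2_ge0 : 0 <= C2.
  by apply: addr_ge0; apply: mulr_ge0; do ?[exact: ler0n | apply: mulr_ge0].
have c_gt0 : 0 < 2 * bulk_rate R by rewrite mulr_gt0 // bulk_rate_gt0.
(* C1 pays for the search, C2 for the costs linear in the dimension, and 2 for the two steps of the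
   early exit. *)
have C_gt0 : 0 < C1 + C2 + 2 by rewrite ltr_wpDl ?addr_ge0.
exists kde_program, (C1 + C2 + 2), (2 * bulk_rate R); split=> //.
move=> n d eps rho delta P n0 _ e0 r0 /andP[d0 d1].
pose I := Input eps rho delta P.
have kde_gkde (x : 'rV[R]_d) (u : nat -> R) : (forall j : 'I_d, u j = x ord0 j) ->
    gkde P x = kde d n (read_point I) u by exact: gkde_kde.
pose coords (x : 'rV[R]_d) (j : nat) : R := if insub j is Some j' then x ord0 j' else 0.
have coordsE x (j : 'I_d) : coords x j = x ord0 j by rewrite /coords valK.
have gkde_ge0 x : 0 <= gkde P x.
  by rewrite (kde_gkde _ _ (coordsE x)); apply/ltW/smean_gt0.
have gkde_le1 x : gkde P x <= 1.
  rewrite (kde_gkde _ _ (coordsE x)); apply: smean_le1 => // i; exact: sqd_ge0.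
have [cond|ncond] := boolP [&& eps < 1, ~~ (1 < rho) & (0 < d)%N]; last first.
  exists 2%N.
  have ex (Q : 'rV[R]_d -> Prop) : (forall x, Q x) ->
      runs_in kde_program I 2 /\ 1 - delta <= @output_prob R kde_program I 2 Q.
    move=> hQ; apply: triple_output_prob; apply: triple_kde_program_exit => // s'.
    by case: asboolP => [[]|_]; [exact: hQ | exact: ltW].
  split.
  - apply: le_trans (time_bound_ge _ _ _ _ (ltW C_gt0) (ltW c_gt0) d0).
    by rewrite lerDr addr_ge0.
  - by have [] := ex (fun=> True).
  move=> xstar _ hr; have [|_ //] := ex (fun x' => (1 - eps) * gkde P xstar <= gkde P x').
  move=> x'; have [eps1|eps1] := ltP eps 1; last first.
    by apply: le_trans (gkde_ge0 x'); rewrite mulr_le0_ge0 // subr_le0.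
  have rho1 : ~~ (1 < rho) by rewrite -leNgt (le_trans hr).
  move: ncond; rewrite eps1 rho1 /= -leqNgt leqn0 => /eqP dz.
  have -> : x' = xstar by apply/rowP => j; move: (ltn_ord j); rewrite [in X in (_ < X)%N]dz.
  by rewrite ler_piMl // gerBl ltW.
have {cond} [eps1 rho1 dpos] := and3P cond; rewrite -leNgt in rho1.
have er0 : 0 < eps * rho by rewrite mulr_gt0.
have [E [E1 E2]] := ex_least e0.
have [A [A1 A2]] := ex_least er0.
have [a [a1 a2]] := ex_doublings r0.
have [rr [rr1 rr2]] := ex_doublings d0.
have pos (N : nat) (v : R) : 1 <= N%:R * v -> (0 < N)%N.
  by rewrite lt0n; case: eqP => // ->; rewrite mul0r ler10.
have e01 : 0 < eps < 1 by rewrite e0.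
have r01 : 0 < rho <= 1 by rewrite r0.
exists (main_time I E A a rr).
(* The density condition is placed inside the event, so that the running time is obtained
   independently of it. *)
have run (xs : 'rV[R]_d) : runs_in kde_program I (main_time I E A a rr) /\
    1 - delta <= @output_prob R kde_program I (main_time I E A a rr)
      (fun x' => rho <= gkde P xs -> (1 - eps) * gkde P xs <= gkde P x').
  apply: triple_output_prob.
  have tm := @triple_main R I E A a rr n0 dpos e01 r01 d0 E1 E2 A1 A2 a1 a2 rr1 rr2
    (coords xs) (init_store R).
  apply: triple_weaken tm _ _ _ => // s' _; split=> //.
  rewrite /success -(kde_gkde _ _ (coordsE xs)).
  rewrite -(kde_gkde (output d s') (rmem s')) //.
  by move=> j; rewrite mxE.
split.
- apply: (@main_time_bound R I E A a rr n0 dpos e01 r01 d0 (pos _ _ E1) (pos _ _ A1) E2 A2 a2 rr2).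
    by rewrite -/C1 -addrA lerDl addr_ge0.
  by rewrite -/C2 -addrA addrCA lerDl addr_ge0.
- by have [] := run 0.
- move=> xstar _ hr; have [_] := run xstar; congr (_ <= output_prob _ _ _).
  by apply/funext => x'; apply/propext; split=> [/(_ hr)|].
Qed.
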